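(* Let $\pi:\Gamma\to\mathcal U(\mathcal H)$ be a unitary representation of $\Gamma$. Suppose that (i) $(\pi',\mathcal H')$ is an irreducible $\Gamma\ltimes C(\partial\Gamma)$-representation; (ii) $\iota:\mathcal H\to\mathcal H'$ is an imperfect boundary realization of $\pi$; (iii) (Finite Trace Condition) $\|P_2\,\pi'(\mathbf 1_{\partial\Gamma(a)})\,P_1\|_{HS}<\infty$ for each $a\in A$, where $P_1:\mathcal H'\to\mathcal H'$ is the orthogonal projection onto $\iota(\mathcal H)$ and $P_2=\operatorname{Id}-P_1$ is the projection onto the orthogonal complement of $\iota(\mathcal H)$. Then: (1) $\pi$ is irreducible as a $\Gamma$-representation. (2) Up to equivalence, $\iota$ is the only boundary realization of $\pi$. Moreover, the unitary $\Gamma$-action which $\pi'$ gives on $\mathcal H'$ stabilizes $\mathcal H_1=\iota(\mathcal H)$, hence also the orthogonal complement $\mathcal H_2=\mathcal H'\ominus\mathcal H_1$; let $\pi_2:\Gamma\to\mathcal U(\mathcal H_2)$ denote the $\Gamma$-action on $\mathcal H_2$. Then: (3) $\pi_2$ is irreducible. (4) $\pi_2$ is inequivalent to $\pi$ (as $\Gamma$-representations).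
   Context: $\Gamma$ is a non-abelian free group on a given finite set of free generators; $A\subset\Gamma$ is the set of these generators and their inverses. $\partial\Gamma$ is the set of infinite reduced words $a_1a_2a_3\dots$ ($a_j\in A$, $a_ja_{j+1}\ne 1$) with the compact topology having as basis the sets $\partial\Gamma(x)$, $x\in\Gamma$, where $\partial\Gamma(x)$ is the set of infinite reduced words that start with the reduced word for $x$. $\Gamma$ acts continuously on $\partial\Gamma$ by left multiplication (followed by reduction). $\mathbf 1_S$ is the characteristic function of $S$. $C(\partial\Gamma)$ is the $C^*$-algebra of continuous complex functions on $\partial\Gamma$, and $(\lambda(x)G)(\omega)=G(x^{-1}\omega)$ for $x\in\Gamma$, $G\in C(\partial\Gamma)$. All Hilbert spaces are complex and separable. $\|\cdot\|_{HS}$ is the Hilbert–Schmidt norm (with value $+\infty$ for operators that are not Hilbert–Schmidt). A $\Gamma\ltimes C(\partial\Gamma)$-representation $\pi'$ on $\mathcal H'$ is a pair consisting of a unitary representation of $\Gamma$ on $\mathcal H'$ and a $*$-representation of $C(\partial\Gamma)$ on $\mathcal H'$, both denoted $\pi'$, with $\pi'(x)\pi'(G)\pi'(x)^{-1}=\pi'(\lambda(x)G)$ for all $x\in\Gamma$, $G\in C(\partial\Gamma)$. It is irreducible if $\mathcal H'\neq0$ and no closed subspace other than $0$ and $\mathcal H'$ is invariant under both actions. A boundary realization of $\pi$ is an isometric linear map $\iota:\mathcal H\to\mathcal H'$ intertwining the $\Gamma$-actions, where $\mathcal H'$ is the space of a $\Gamma\ltimes C(\partial\Gamma)$-representation $\pi'$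 and $\iota(\mathcal H)$ is cyclic for $C(\partial\Gamma)$, i.e. the closed linear span of $\pi'(C(\partial\Gamma))\iota(\mathcal H)$ is $\mathcal H'$. It is perfect if $\iota$ is bijective (unitary), and imperfect otherwise. Two boundary realizations $\iota_j:\mathcal H\to\mathcal H'_j$ ($j=1,2$) are equivalent if there is a unitary $J:\mathcal H'_1\to\mathcal H'_2$ intertwining both the $\Gamma$-actions and the $C(\partial\Gamma)$-actions with $J\iota_1=\iota_2$. *)

(* Defs.v *)
From HB Require Import structures.
From mathcomp Require Import all_boot all_order all_algebra sesquilinear complex.
From mathcomp Require Import all_classical all_reals.
From mathcomp Require Import ereal topology normedtype numfun esum exp.

Set Implicit Arguments.
Unset Strict Implicit.
Unset Printing Implicit Defensive.

Import Order.TTheory GRing.Theory Num.Theory.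
Import numFieldNormedType.Exports.

Local Open Scope classical_set_scope.
Local Open Scope ring_scope.

(* [(i, false)] is the generator [i], [(i, true)] is its inverse. *)
Notation letter I := (I * bool)%type.

Definition linv (I : finType) (a : letter I) : letter I := (a.1, ~~ a.2).

Definition reduced (I : finType) (s : seq (letter I)) : bool :=
  sorted (fun a b => b != linv a) s.

Record freeGroup (I : finType) :=
  FreeWord { fword :> seq (letter I); fwordP : reduced fword }.
HB.instance Definition _ (I : finType) := [isSub for @fword I].
HB.instance Definition _ (I : finType) := [Choice of freeGroup I by <:].

Section FreeGroup.
Variable I : finType.
Implicit Types (a b : letter I) (s t : seq (letter I)) (x y z : freeGroup I).

(* [lcons a] is left multiplication by [a] on reduced words; [lact_word a] below
   is the same operation on infinite reduced words. *)
Definition lcons a s : seq (letter I) :=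
  if s is b :: s' then if b == linv a then s' else a :: s else [:: a].

Lemma linvK : involutive (@linv I).
Proof. by case=> i b; rewrite /linv /= negbK. Qed.

Lemma reduced_behead a s : reduced (a :: s) -> reduced s.
Proof. by case: s => //= b s /andP[]. Qed.

Lemma reduced_lcons a s : reduced s -> reduced (lcons a s).
Proof.
case: s => [//|b s] rs; rewrite /lcons.
case: eqP => [_|/eqP ba]; first exact: reduced_behead rs.
by rewrite /reduced /= ba.
Qed.

Lemma lconsK a s : reduced s -> lcons (linv a) (lcons a s) = s.
Proof.
case: s => [|b s] rs; rewrite /lcons; first by rewrite linvK eqxx.
case: (eqVneq b (linv a)) => [eb|nb]; last by rewrite linvK eqxx.
case: s rs => [|c s] /=; first by rewrite eb.
by rewrite eb linvK => /andP[/negbTE-> _].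
Qed.

Lemma reduced_foldr s t : reduced t -> reduced (foldr lcons t s).
Proof. by move=> rt; elim: s => //= a s; exact: reduced_lcons. Qed.

Lemma foldr_lcons a s t : reduced t ->
  foldr lcons t (lcons a s) = lcons a (foldr lcons t s).
Proof.
move=> rt; case: s => [//|b s]; rewrite [lcons a (b :: s)]/lcons.
case: (eqVneq b (linv a)) => [->|//]; rewrite [in RHS]/=.
by have := lconsK (linv a) (reduced_foldr s rt); rewrite linvK => ->.
Qed.

Lemma foldr_lcons_nil s : reduced s -> foldr lcons [::] s = s.
Proof.
elim: s => //= a s IH rs; rewrite IH; last exact: reduced_behead rs.
by case: s rs {IH} => //= b s /andP[/negbTE-> _].
Qed.

Lemma foldr_lconsA s t u : reduced u ->
  foldr lcons u (foldr lcons t s) = foldr lcons (foldr lcons u t) s.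
Proof. by move=> ru; elim: s => //= a s IH; rewrite foldr_lcons // IH. Qed.

Lemma reduced_inv s : reduced s -> reduced (rev (map (@linv I) s)).
Proof.
rewrite /reduced rev_sorted sorted_map; apply: sub_sorted => a b /=.
by rewrite linvK eq_sym.
Qed.

Definition fg_one : freeGroup I := @FreeWord I [::] isT.
Definition fg_mul x y : freeGroup I := FreeWord (reduced_foldr x (fwordP y)).
Definition fg_inv x : freeGroup I := FreeWord (reduced_inv (fwordP x)).

Lemma fg_mulA : associative fg_mul.
Proof.
by move=> x y z; apply: val_inj; rewrite /= foldr_lconsA //; exact: fwordP.
Qed.

Lemma fg_mul1 : left_id fg_one fg_mul.
Proof. by move=> x; exact: val_inj. Qed.

Lemma fg_mulr1 : right_id fg_one fg_mul.
Proof. by move=> x; apply: val_inj; rewrite /= foldr_lcons_nil ?fwordP. Qed.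

Lemma foldr_lconsV s t : reduced t ->
  foldr lcons (foldr lcons t s) (rev (map (@linv I) s)) = t.
Proof.
move=> rt; elim: s => //= a s IH.
by rewrite rev_cons foldr_rcons lconsK // reduced_foldr.
Qed.

Lemma fg_mulV : left_inverse fg_one fg_inv fg_mul.
Proof.
move=> x; apply: val_inj => /=.
by have := @foldr_lconsV x [::] isT; rewrite foldr_lcons_nil ?fwordP.
Qed.

Lemma fg_invK : involutive fg_inv.
Proof.
move=> x; apply: val_inj => /=.
by rewrite map_rev revK mapK //; exact: linvK.
Qed.

Lemma fg_mulrV : right_inverse fg_one fg_inv fg_mul.
Proof. by move=> x; rewrite -{1}[x]fg_invK fg_mulV. Qed.

HB.instance Definition _ := isGroup.Build (freeGroup I)
  fg_mulA fg_mul1 fg_mulr1 fg_mulV fg_mulrV.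
HB.instance Definition _ := isPointed.Build (freeGroup I) 1%g.

Definition fg_letter a : freeGroup I := @FreeWord I [:: a] isT.

End FreeGroup.

Record boundary (I : finType) := Boundary {
  bword :> nat -> letter I;
  bwordP : forall n, bword n.+1 != linv (bword n) }.
HB.instance Definition _ (I : finType) := gen_eqMixin (boundary I).
HB.instance Definition _ (I : finType) := gen_choiceMixin (boundary I).

Definition cylinder (I : finType) (x : freeGroup I) : set (boundary I) :=
  [set w | mkseq w (size x) = x].

Section Boundary.
Variable I : finType.
Implicit Types (a b : letter I) (x y : freeGroup I) (w : boundary I).

Lemma boundary_eq w1 w2 : w1 =1 w2 -> w1 = w2.
Proof.
case: w1 w2 => [f Pf] [g Pg] /= /funext fg; subst g.
by congr Boundary; exact: Prop_irrelevance.
Qed.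

Lemma reduced_mkseq w n : reduced (mkseq w n).
Proof.
apply/(sortedP (w 0%N)) => i; rewrite size_mkseq => lti.
by rewrite !nth_mkseq ?bwordP // ltnW.
Qed.

Definition bprefix w n : freeGroup I := FreeWord (reduced_mkseq w n).

Lemma cylinderP w w' n :
  cylinder (bprefix w n) w' <-> (forall i, (i < n)%N -> w' i = w i).
Proof.
rewrite /cylinder /= size_mkseq; split=> [e i ltin|e].
  by have := congr1 (nth (w 0%N) ^~ i) e; rewrite !nth_mkseq.
by apply/eq_in_map => i; rewrite mem_iota => /andP[_]; exact: e.
Qed.

Lemma cylinder_bprefix x w : cylinder x w -> bprefix w (size x) = x.
Proof. by move=> xw; apply: val_inj. Qed.

Lemma cylinder_cover : \bigcup_(x in [set: freeGroup I]) cylinder x = setT.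
Proof. by apply/seteqP; split=> // w _; exists 1%g. Qed.

Lemma cylinder_join x y w : [set: freeGroup I] x -> [set: freeGroup I] y ->
  cylinder x w -> cylinder y w ->
  exists z, [/\ [set: freeGroup I] z, cylinder z w &
    cylinder z `<=` cylinder x `&` cylinder y].
Proof.
move=> _ _ xw yw; exists (bprefix w (maxn (size x) (size y))).
split=> //; first by apply/cylinderP.
move=> w' /cylinderP e.
rewrite -(cylinder_bprefix xw) -(cylinder_bprefix yw).
by split; apply/cylinderP => i lti; apply: e; rewrite leq_max lti ?orbT.
Qed.

HB.instance Definition _ := isBaseTopological.Build (boundary I)
  cylinder_cover cylinder_join.

Lemma open_cylinder x : open (cylinder x).
Proof. by exists [set x] => //; rewrite bigcup_set1. Qed.

Lemma nbhs_boundaryP w (A : set (boundary I)) :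
  nbhs w A <-> exists n, forall w', (forall i, (i < n)%N -> w' i = w i) -> A w'.
Proof.
split.
  rewrite nbhsE => -[U [[D _ <-] [x Dx xw] sUA]].
  exists (size x) => w' e; apply: sUA; exists x => //.
  by rewrite -(cylinder_bprefix xw); apply/cylinderP.
move=> [n nA]; rewrite nbhsE; exists (cylinder (bprefix w n)).
  by split; [exact: open_cylinder|apply/cylinderP].
by move=> w' /cylinderP; exact: nA.
Qed.

Definition lact_word a w (n : nat) : letter I :=
  if w 0%N == linv a then w n.+1 else if n is m.+1 then w m else a.

Lemma lact_wordP a w n : lact_word a w n.+1 != linv (lact_word a w n).
Proof.
rewrite /lact_word; case: ifPn => [_|nwa]; first exact: bwordP.
by case: n => [|n] //; exact: bwordP.
Qed.

Definition lact a w : boundary I := Boundary (lact_wordP a w).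

Definition bact x w : boundary I := foldr lact w x.

Lemma lact_continuous a : continuous (lact a).
Proof.
move=> w A /nbhs_boundaryP[n nA]; apply/nbhs_boundaryP; exists n.+2 => w' e.
apply: nA => i ltin; rewrite /= /lact_word (e 0%N isT).
case: ifP => _; first by apply: e; rewrite ltnS ltnW.
case: i ltin => // i /ltnW ltin; apply: e.
exact: leq_trans ltin (leq_addl 2 n).
Qed.

Lemma bact_continuous x : continuous (bact x).
Proof.
rewrite /bact; elim: (fword x) => [|a s IH] w /=; first exact: cvg_id.
exact: (@continuous_comp _ _ _ _ (lact a) w (IH w) (@lact_continuous a _)).
Qed.

End Boundary.

(* The topology on [R[i]] is the one of the modulus, as on [R[i]^o]. *)
HB.instance Definition _ (R : realType) := GRing.ComAlgebra.copy R[i] R[i]^o.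
HB.instance Definition _ (R : realType) := NormedModule.copy R[i] R[i]^o.

Section ContinuousFunctions.
Variables (R : realType) (X : topologicalType).

Definition continuous_pred : {pred X -> R[i]} := [pred f | `[< continuous f >]].

(* The library's [continuousType] has no ring structure, so C(X) is built as a
   subring of [X -> R[i]], with pointwise operations. *)
Record cfun := CFun { cfun_fun :> X -> R[i]; cfunP : cfun_fun \in continuous_pred }.
HB.instance Definition _ := [isSub for cfun_fun].
HB.instance Definition _ := [Choice of cfun by <:].

Lemma continuous_subring : subring_closed continuous_pred.
Proof.
split.
- by apply/asboolP => x; exact: cvg_cst.
- move=> f g /asboolP cf /asboolP cg; apply/asboolP => x.
  exact: (cvgB (cf x) (cg x)).
- move=> f g /asboolP cf /asboolP cg; apply/asboolP => x.
  exact: (cvgM (cf x) (cg x)).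
Qed.

Lemma continuous_scaler : scaler_closed continuous_pred.
Proof.
move=> c f /asboolP cf; apply/asboolP => x.
exact: (cvgM (cvg_cst c) (cf x)).
Qed.

HB.instance Definition _ :=
  GRing.isSubringClosed.Build (X -> R[i]) continuous_pred continuous_subring.
HB.instance Definition _ :=
  GRing.isScaleClosed.Build R[i] (X -> R[i]) continuous_pred continuous_scaler.
HB.instance Definition _ := GRing.SubChoice_isSubComPzRing.Build
  _ _ cfun (subringClosedP _).
HB.instance Definition _ := [SubZmodule_isSubLmodule of cfun by <:].

Lemma cfun_conj_subproof (f : cfun) :
  (fun x => (f x)^* : R[i])%R \in continuous_pred.
Proof.
case: f => f cf; apply/asboolP => x /=; move/asboolP/(_ x) in cf.
apply/cvgrPdist_lt => e e0; move/cvgrPdist_lt: cf => /(_ e e0).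
by apply: filterS => t; rewrite -rmorphB norm_conjC.
Qed.

Definition cfun_conj (f : cfun) : cfun := CFun (cfun_conj_subproof f).

End ContinuousFunctions.

Section BoundaryFunctions.
Variables (R : realType) (I : finType).

Lemma ctranslate_subproof (x : freeGroup I) (G : cfun R (boundary I)) :
  (fun w => G (bact x^-1%g w)) \in @continuous_pred R (boundary I).
Proof.
case: G => G cG; apply/asboolP => w /=; move/asboolP in cG.
exact: (@continuous_comp _ _ _ (bact x^-1%g) G w (@bact_continuous _ _ w) (cG _)).
Qed.

Definition ctranslate x G : cfun R (boundary I) := CFun (ctranslate_subproof x G).

Lemma cylinder_indic_subproof (x : freeGroup I) :
  (\1_(cylinder x) : boundary I -> R[i]) \in @continuous_pred R (boundary I).
Proof.
apply/asboolP => w; apply: near_cst_continuous.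
apply/nbhs_boundaryP; exists (size x) => w' e.
rewrite /indic; congr (_%:R); congr nat_of_bool.
suff E : mkseq w' (size x) = mkseq w (size x).
  by apply/idP/idP => /set_mem h; apply/mem_set;
    [exact: etrans (esym E) h|exact: etrans E h].
by apply/eq_in_map => i; rewrite mem_iota => /andP[_]; exact: e.
Qed.

Definition cylinder_indic x : cfun R (boundary I) :=
  CFun (cylinder_indic_subproof x).

End BoundaryFunctions.

(* [{dot H for conjC}] is linear in its first argument and conjugate-linear in
   the second. *)
HB.mixin Record NormedModule_isHilbert (R : realType) H
    of CompleteNormedModule R[i] H := {
  hdot : {dot H for (@Num.conj R[i])};
  hdot_norm : forall u : H, `|u| ^+ 2 = hdot u u }.

#[short(type="hilbertType")]
HB.structure Definition Hilbert (R : realType) :=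
  {H of NormedModule_isHilbert R H & CompleteNormedModule R[i] H}.

Notation "''[' u , v ]" := (hdot u v) : ring_scope.

Definition separable (T : topologicalType) :=
  exists D : set T, countable D /\ dense D.

Section Hilbert.
Variables (R : realType) (H : hilbertType R).
Implicit Types (u v w : H) (A V : set H).

Record closed_subspace V : Prop := ClosedSubspace {
  csubspace_closed : closed V;
  csubspace0 : V 0;
  csubspaceP : forall (c : R[i]) u v, V u -> V v -> V (c *: u + v) }.

Definition linear_span A : set H :=
  [set v | exists n (c : 'I_n -> R[i]) (a : 'I_n -> H),
     (forall i, A (a i)) /\ v = \sum_(i < n) c i *: a i].

Definition orthocomp A : set H := [set u | forall v, A v -> '[u, v] = 0].

Definition is_orthoproj V v p := V p /\ orthocomp V (v - p).

(* [p] is unique; it exists for every [v] when [V] is a closed subspace. *)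
Definition orthoproj V v : H := xget 0 (is_orthoproj V v).

Definition hnorm v : R := complex.Re `|v|.

Definition orthonormal_basis A : Prop :=
  (forall u, A u -> '[u, u] = 1) /\
  (forall u v, A u -> A v -> u <> v -> '[u, v] = 0) /\
  closure (linear_span A) = setT.

(* The sum does not depend on the orthonormal basis, so the infimum is over
   one value. *)
Definition hs_norm (T : H -> H) : \bar R :=
  ereal_inf [set ((\esum_(e in B) ((hnorm (T e)) ^+ 2)%:E) `^ 2^-1)%E
            | B in orthonormal_basis].

Lemma hdot0l v : '[(0 : H), v] = 0.
Proof. exact: linear0l. Qed.

Lemma hdotDl u v w : '[u + v, w] = '[u, w] + '[v, w].
Proof. exact: linearDl. Qed.

Lemma hdotZl c u v : '[c *: u, v] = c * '[u, v].
Proof. exact: linearZl_LR. Qed.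

Lemma hdotBl u v w : '[u - v, w] = '[u, w] - '[v, w].
Proof. exact: linearBl. Qed.

Lemma hdotC u v : '[u, v] = ('[v, u])^*.
Proof. by rewrite (hermitian_subproof u v) expr0 mul1r. Qed.

Lemma hdotZr c u v : '[u, c *: v] = c^* * '[u, v].
Proof. by rewrite hdotC hdotZl rmorphM /= -hdotC. Qed.

Lemma hdotBr u v w : '[u, v - w] = '[u, v] - '[u, w].
Proof. by rewrite hdotC hdotBl rmorphB /= -!hdotC. Qed.

Lemma hCauchySchwarz u v : `|'[u, v]| <= `|u| * `|v|.
Proof.
have [->|v0] := eqVneq v 0.
  by rewrite hdotC hdot0l conjC0 !normr0 mulr0.
have nv : 0 < `|v| ^+ 2 by rewrite exprn_gt0 // normr_gt0.
pose c := '[u, v] / `|v| ^+ 2.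
have : 0 <= `|u - c *: v| ^+ 2 by rewrite exprn_ge0.
have cc : c^* = '[v, u] / `|v| ^+ 2.
  rewrite /c rmorphM fmorphV rmorphXn /= (CrealP (normr_real v)).
  by rewrite [in RHS]hdotC.
rewrite hdot_norm hdotBl hdotZl !hdotBr !hdotZr -!hdot_norm cc.
rewrite divfK ?lt0r_neq0 // subrr mulr0 subr0 subr_ge0.
rewrite mulrAC ler_pdivrMr // [in X in X <= _]hdotC mulrC -normCK.
by rewrite -exprMn ler_sqr ?nnegrE ?mulr_ge0.
Qed.

Lemma orthocomp_closed A : closed (orthocomp A).
Proof.
move=> u clu v Av; apply/eqP; rewrite -normr_eq0 eq_le normr_ge0 andbT.
have [->|v0] := eqVneq v 0; first by rewrite hdotC hdot0l conjC0 normr0.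
apply/ler_addgt0Pl => e e0; rewrite addr0.
have nv : 0 < `|v| by rewrite normr_gt0.
have [w [Aw /= uw]] := clu _ (nbhsx_ballx u _ (divr_gt0 e0 nv)).
have -> : '[u, v] = '[u - w, v] by rewrite hdotBl (Aw v Av) subr0.
apply: le_trans (hCauchySchwarz _ _) _.
by rewrite -ler_pdivlMr // ltW //; move: uw; rewrite -ball_normE.
Qed.

Lemma closed_subspace_orthocomp A : closed_subspace (orthocomp A).
Proof.
split; [exact: orthocomp_closed|by move=> v _; exact: hdot0l|].
by move=> c u v Au Av w Aw; rewrite hdotDl hdotZl Au // Av // mulr0 addr0.
Qed.

End Hilbert.

Section SubHilbert.
Variables (R : realType) (H : hilbertType R) (V : set H).
Hypothesis HV : closed_subspace V.

Definition csub_pred of closed_subspace V : {pred H} := [pred v | `[< V v >]].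

Record csub := CSub { csub_val :> H; csub_valP : csub_val \in csub_pred HV }.
HB.instance Definition _ := [isSub for csub_val].
HB.instance Definition _ := [Choice of csub by <:].

Lemma csub_submod : submod_closed (csub_pred HV).
Proof.
split=> [|c u v /asboolP Vu /asboolP Vv]; apply/asboolP.
  exact: csubspace0 HV.
exact: csubspaceP.
Qed.

HB.instance Definition _ :=
  GRing.isSubmodClosed.Build R[i] H (csub_pred HV) csub_submod.
HB.instance Definition _ := [SubChoice_isSubLmodule of csub by <:].

Definition csub_norm (u : csub) : R[i] := `|val u|.

Lemma csub_ler_normD u v : csub_norm (u + v) <= csub_norm u + csub_norm v.
Proof. exact: ler_normD. Qed.

Lemma csub_normrZ (c : R[i]) u : csub_norm (c *: u) = `|c| * csub_norm u.
Proof. exact: normrZ. Qed.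

Lemma csub_normr0_eq0 u : csub_norm u = 0 -> u = 0.
Proof. by move=> /normr0_eq0 u0; exact: val_inj. Qed.

HB.instance Definition _ := Lmodule_isNormed.Build R[i] csub
  csub_ler_normD csub_normrZ csub_normr0_eq0.

Lemma csub_complete (F : set_system csub) :
  ProperFilter F -> cauchy F -> cvg F.
Proof.
move=> FF /cauchyP cF; pose G := csub_val @ F.
have /cauchy_cvg cG : cauchy G.
  apply/cauchyP => e e0; have [u Fu] := cF e e0.
  exists (csub_val u); suff : ball u e `<=` csub_val @^-1` ball (csub_val u) e.
    by move=> /filterS; exact.
  by move=> v; rewrite -!ball_normE.
have Vl : V (lim G).
  apply: (csubspace_closed HV) => B /cG GB.
  have [u Bu] := filter_ex (GB : F (csub_val @^-1` B)).
  by exists (csub_val u); split=> //; have /asboolP := csub_valP u.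
apply/cvg_ex; exists (CSub (asboolT Vl)); apply/cvg_ballP => e e0.
move/cvg_ballP: cG => /(_ e e0); apply: filterS => v.
by rewrite -[in X in X -> _]ball_normE -ball_normE.
Qed.

HB.instance Definition _ := Uniform_isComplete.Build csub csub_complete.

Definition csub_dot (u v : csub) : R[i] := '[csub_val u, csub_val v].

Lemma csub_dot_bilinear :
  bilinear_for ( *%R : GRing.Scale.law _ _) ((@Num.conj R[i]) \; *%R : GRing.Scale.law _ _) csub_dot.
Proof.
split=> u c v w; rewrite /csub_dot /=.
  by rewrite hdotDl hdotZl.
rewrite hdotC hdotDl hdotZl rmorphD rmorphM /=.
by rewrite -!hdotC.
Qed.
HB.instance Definition _ := bilinear_isBilinear.Build R[i] csub csub R[i] *%R ((@Num.conj R[i]) \; *%R) csub_dot csub_dot_bilinear.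

Lemma csub_dot_herm u v : csub_dot u v = (-1) ^+ false * (csub_dot v u)^*.
Proof. by rewrite expr0 mul1r /csub_dot hdotC. Qed.

HB.instance Definition _ := isHermitianSesquilinear.Build R[i] csub false
  (@Num.conj R[i]) csub_dot csub_dot_herm.

Lemma csub_dot_gt0 u : u != 0 -> 0 < csub_dot u u.
Proof.
move=> u0; rewrite /csub_dot -hdot_norm exprn_gt0 // normr_gt0.
by apply: contra u0 => /eqP u0; apply/eqP/val_inj.
Qed.

HB.instance Definition _ := isDotProduct.Build R[i] csub csub_dot csub_dot_gt0.

Lemma csub_dot_norm (u : csub) : `|u| ^+ 2 = csub_dot u u.
Proof. exact: hdot_norm. Qed.

HB.instance Definition _ := NormedModule_isHilbert.Build R csub csub_dot_norm.

End SubHilbert.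

Definition orthocomp_hilbert (R : realType) (H : hilbertType R) (A : set H) :
  hilbertType R := csub (closed_subspace_orthocomp A).

Definition unitary_map (R : realType) (H K : hilbertType R)
    (U : {linear H -> K}) : Prop :=
  (forall u v, '[U u, U v] = '[u, v]) /\ bijective U.

Record urep (R : realType) (G : groupType) (H : hilbertType R) := URep {
  urep_op :> G -> {linear H -> H};
  urep_unitary : forall x, unitary_map (urep_op x);
  urepM : forall x y v, urep_op (x * y)%g v = urep_op x (urep_op y v) }.

Definition urep_irreducible (R : realType) (G : groupType) (H : hilbertType R)
    (pi : urep G H) : Prop :=
  (exists v : H, v <> 0) /\
  (forall V : set H, closed_subspace V ->
     (forall x v, V v -> V (pi x v)) -> V = [set 0] \/ V = setT).

Definition urep_equivalent (R : realType) (G : groupType)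
    (H1 H2 : hilbertType R) (pi1 : urep G H1) (pi2 : urep G H2) : Prop :=
  exists U : {linear H1 -> H2},
    unitary_map U /\ (forall x v, U (pi1 x v) = pi2 x (U v)).

(* [starrep_op 1 = id] is not required: it follows from [breal_cyclic] below for
   every boundary realization. *)
Record starrep (R : realType) (X : topologicalType) (H : hilbertType R) :=
  StarRep {
    starrep_op :> cfun R X -> {linear H -> H};
    starrep_continuous : forall F, continuous (starrep_op F);
    starrep_linear : forall (c : R[i]) F G v,
      starrep_op (c *: F + G) v = c *: starrep_op F v + starrep_op G v;
    starrepM : forall F G v, starrep_op (F * G) v = starrep_op F (starrep_op G v);
    starrep_conj : forall F u v,
      '[starrep_op F u, v] = '[u, starrep_op (cfun_conj F) v] }.

Section BoundaryRepresentations.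
Variables (R : realType) (I : finType).
Implicit Types H : hilbertType R.

Record brep H := BRep {
  brep_group : urep (freeGroup I) H;
  brep_algebra : starrep (boundary I) H;
  brep_covariant : forall x G v,
    brep_group x (brep_algebra G (brep_group x^-1%g v)) =
    brep_algebra (ctranslate x G) v }.

Definition brep_irreducible H (pi : brep H) : Prop :=
  (exists v : H, v <> 0) /\
  (forall V : set H, closed_subspace V ->
     (forall x v, V v -> V (brep_group pi x v)) ->
     (forall G v, V v -> V (brep_algebra pi G v)) ->
     V = [set 0] \/ V = setT).

Record boundary_realization H H' (pi : urep (freeGroup I) H) (pi' : brep H')
    (iota : {linear H -> H'}) : Prop := BoundaryRealization {
  breal_isometry : forall v, `|iota v| = `|v|;
  breal_intertwine : forall x v, iota (pi x v) = brep_group pi' x (iota v);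
  breal_cyclic : closure (linear_span
    [set brep_algebra pi' G (iota v) | G in setT & v in setT]) = setT }.

Definition perfect H H' (iota : {linear H -> H'}) : Prop := bijective iota.

Definition breal_equivalent H H1 H2 (pi1 : brep H1) (iota1 : {linear H -> H1})
    (pi2 : brep H2) (iota2 : {linear H -> H2}) : Prop :=
  exists J : {linear H1 -> H2},
    [/\ unitary_map J,
        forall x v, J (brep_group pi1 x v) = brep_group pi2 x (J v),
        forall G v, J (brep_algebra pi1 G v) = brep_algebra pi2 G (J v) &
        forall v, J (iota1 v) = iota2 v].

End BoundaryRepresentations.

(* Main.v *)
From HB Require Import structures.
Require Import Defs.
From mathcomp Require Import all_boot all_order all_algebra complex.
From mathcomp Require Import all_classical all_reals.
From mathcomp Require Import ereal topology normedtype numfun esum exp realfun.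
From mathcomp Require Import ring lra.

Set Implicit Arguments.
Unset Strict Implicit.
Unset Printing Implicit Defensive.

Import Order.TTheory GRing.Theory Num.Theory.
Import numFieldNormedType.Exports.

Local Open Scope classical_set_scope.
Local Open Scope ring_scope.

(** Only the unitaries [U_a] of the letters and the projections [E_a], the images of
    the indicators of the cylinders of letters, matter; they generate everything.

    Averaging [sum_(|y| = n) <w, y u> <y u', w'>] over [n], with [u], [u'] supported
    off the cylinder of [s] and [y] running over the reduced words with last letter
    [s^-1], gives in the limit a form in [(w, w')] which is invariant under the group
    and under the indicators. By irreducibility it is [c_s(u, u') <w, w'>]. Replacing
    the words by their inverses exchanges the roles of the vectors, so for [S], [T] in
    the commutant of the group
      [c_s(e, e') <E_t T u, E_t S u'> = conj (c_t(u, u') <E_s T^* e, E_s S^* e'>)].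

    The finite trace condition shows that the [c_s] are not all zero: the averages of
    [sum_(|y| = n) |P U_y^-1 1_y v|^2] and of its analogue for [1 - P] add up to
    [|v|^2], and for [v] in the opposite summand they are sums of
    [|P E_s (1 - P) y u|^2] (or of the same with [P] and [1 - P] exchanged), which the
    Hilbert-Schmidt bound reduces to finitely many coefficients.

    The identity above then forces the commutant of the group to be spanned by [1] and
    the projection [P] onto [iota(H)], which contains (1), (3) and (4). Applied to two
    realizations it produces a nonzero intertwiner of the full representations, and
    Schur's lemma turns it into the equivalence (2). *)

(** * Hilbert spaces *)

(** Shift invariance of the mean makes the limit forms rigid. Passing from [n] to [n.+1] applies the
    transfer operator once more, so a limit form is a fixed point of [transfer], and such a fixed
    point is block diagonal for the cylinders and invariant under the letters. Boundedness of the
    averages is automatic, since |u|^2 + |v|^2 is itself fixed by [transfer]. Vectors off the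
    cylinder of [s] appear because for them the truncation to a cylinder does not affect the matrix
    coefficients. What remains is a sum over the reduced words with prescribed first and last
    letters, a condition that inversion preserves up to exchanging the letters. The Hilbert-Schmidt
    bound acts uniformly in [n]: for [u] off the cylinder of [t], the vectors y u, with [y] of fixed
    length and last letter t^-1, lie in disjoint cylinders, hence satisfy a Bessel inequality with
    constant |u|^2. A small tail of the operator therefore contributes little, and the head involves
    finitely many averages, of mean zero if all the coefficients vanish. *)

Section Hdot.
Variables (R : realType) (H : hilbertType R).
Implicit Types (u v w : H) (c : R[i]).

(** Norms and moduli take values in [R[i]], which is only partially ordered; [nsq] and [csq] carry
    their squares to the ordered field [R], where most estimates take place. *)
Definition nsq u : R := complex.Re '[u, u].

Definition csq c : R := complex.Re c ^+ 2 + complex.Im c ^+ 2.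

Lemma csqE c : (csq c)%:C%C = c * c^*.
Proof. by rewrite add_Re2_Im2 -normCK. Qed.

Lemma csq_ge0 c : 0 <= csq c.
Proof. by rewrite addr_ge0 ?sqr_ge0. Qed.

Lemma csq_eq0 c : csq c = 0 -> c = 0.
Proof.
move=> c0; have := csqE c; rewrite c0 -normCK => /esym/eqP.
by rewrite sqrf_eq0 normr_eq0 => /eqP.
Qed.

Lemma csqM c d : csq (c * d) = csq c * csq d.
Proof. by case: c d => [a b] [a' b']; rewrite /csq /=; ring. Qed.

Lemma csqJ c : csq c^* = csq c.
Proof. by case: c => a b; rewrite /csq /= sqrrN. Qed.

Lemma hdot0r v : '[v, 0 : H] = 0.
Proof. by rewrite hdotC hdot0l conjC0. Qed.

Lemma hdotDr u v w : '[u, v + w] = '[u, v] + '[u, w].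
Proof. by rewrite hdotC hdotDl rmorphD /= -!hdotC. Qed.

Lemma hdotNl u v : '[- u, v] = - '[u, v].
Proof. by rewrite -scaleN1r hdotZl mulN1r. Qed.

Lemma hdotNr u v : '[u, - v] = - '[u, v].
Proof. by rewrite hdotC hdotNl rmorphN /= -hdotC. Qed.

Lemma hdot_suml (J : Type) (r : seq J) (P : pred J) (f : J -> H) v :
  '[\sum_(j <- r | P j) f j, v] = \sum_(j <- r | P j) '[f j, v].
Proof.
by elim/big_rec2: _ => [|j y x _ <-]; rewrite ?hdot0l ?hdotDl.
Qed.

Lemma hdot_sumr (J : Type) (r : seq J) (P : pred J) (f : J -> H) v :
  '[v, \sum_(j <- r | P j) f j] = \sum_(j <- r | P j) '[v, f j].
Proof.
by elim/big_rec2: _ => [|j y x _ <-]; rewrite ?hdot0r ?hdotDr.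
Qed.

Lemma hdot_nsq u : '[u, u] = (nsq u)%:C%C.
Proof. by rewrite /nsq -hdot_norm RRe_real // ger0_real // exprn_ge0. Qed.

Lemma norm_nsq u : `|u| ^+ 2 = (nsq u)%:C%C.
Proof. by rewrite hdot_norm hdot_nsq. Qed.

Lemma nsq_ge0 u : 0 <= nsq u.
Proof. by rewrite -(@lecR R) -norm_nsq exprn_ge0. Qed.

Lemma nsq_eq0 u : nsq u = 0 -> u = 0.
Proof.
move=> u0; apply/eqP; rewrite -normr_eq0 -sqrf_eq0 norm_nsq u0.
exact: eqxx.
Qed.

Lemma nsq0 : nsq 0 = 0.
Proof. by rewrite /nsq hdot0l. Qed.

Lemma hdot_eq0 u : '[u, u] = 0 -> u = 0.
Proof. by move=> u0; apply: nsq_eq0; rewrite /nsq u0. Qed.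

Lemma hdot_ext u v : (forall w, '[u, w] = '[v, w]) -> u = v.
Proof.
move=> uv; apply/subr0_eq/hdot_eq0.
by rewrite hdotBl uv subrr.
Qed.

Lemma hdot_extr u v : (forall w, '[w, u] = '[w, v]) -> u = v.
Proof. by move=> uv; apply: hdot_ext => w; rewrite hdotC uv -hdotC. Qed.

Lemma nsqZ c u : nsq (c *: u) = csq c * nsq u.
Proof.
by rewrite /nsq hdotZl hdotZr mulrA -csqE hdot_nsq /= !mul0r subr0.
Qed.

Lemma nsqZr (r : R) u : nsq (r%:C%C *: u) = r ^+ 2 * nsq u.
Proof. by rewrite nsqZ /csq /= expr0n addr0. Qed.

Lemma nsqN u : nsq (- u) = nsq u.
Proof. by rewrite /nsq hdotNl hdotNr opprK. Qed.

Lemma nsqD u v : nsq (u + v) = nsq u + nsq v + 2 * complex.Re '[u, v].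
Proof.
rewrite /nsq hdotDl !hdotDr (hdotC v u).
case: '[u, v] => a b; case: '[u, u] => ? ?; case: '[v, v] => ? ? /=; ring.
Qed.

Lemma nsqB u v : nsq (u - v) = nsq u + nsq v - 2 * complex.Re '[u, v].
Proof. by rewrite nsqD nsqN hdotNr; case: '[u, v] => a b /=; ring. Qed.

Lemma nsqBC u v : nsq (u - v) = nsq (v - u).
Proof. by rewrite -nsqN opprB. Qed.

Lemma parallelogram u v : nsq (u + v) + nsq (u - v) = 2 * nsq u + 2 * nsq v.
Proof. rewrite nsqD nsqB; ring. Qed.

Lemma nsqD_le u v : nsq (u + v) <= 2 * nsq u + 2 * nsq v.
Proof. by rewrite -parallelogram lerDl nsq_ge0. Qed.

Lemma CauchySchwarz_csq u v : csq '[u, v] <= nsq u * nsq v.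
Proof.
rewrite -(@lecR R) rmorphM /= -!norm_nsq csqE -normCK -exprMn.
by rewrite ler_sqr ?nnegrE ?mulr_ge0 ?normr_ge0 // hCauchySchwarz.
Qed.

Lemma Re_hdot_le u v : complex.Re '[u, v] ^+ 2 <= nsq u * nsq v.
Proof. by apply: le_trans (CauchySchwarz_csq u v); rewrite lerDl sqr_ge0. Qed.

Lemma ball_nsq u (e : R[i]) v : 0 < e ->
  ball u e v <-> nsq (u - v) < complex.Re e ^+ 2.
Proof.
move=> e0; rewrite -ball_normE /ball_ /=.
have ee : e = (complex.Re e)%:C%C by rewrite RRe_real ?gtr0_real.
rewrite -(@ltr_pXn2r _ 2) ?nnegrE ?normr_ge0 // ?ltW //.
by rewrite norm_nsq {1}ee -rmorphXn ltcR.
Qed.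

Lemma Re_gt0 (e : R[i]) : 0 < e -> 0 < complex.Re e.
Proof. by move=> e0; rewrite -ltcR RRe_real ?gtr0_real. Qed.

Lemma closure_nsq (A : set H) u :
  closure A u <-> forall e : R, 0 < e -> exists2 a, A a & nsq (u - a) < e.
Proof.
split=> [cA e e0|cA B /nbhs_ballP[e /= e0 eB]].
  have se : 0 < (Num.sqrt e)%:C%C :> R[i] by rewrite ltcR sqrtr_gt0.
  have [a [Aa /(ball_nsq _ _ se) ua]] := cA _ (nbhsx_ballx u _ se).
  by exists a => //; move: ua; rewrite /= sqr_sqrtr // ltW.
have [|a Aa ua] := cA (complex.Re (e : R[i]) ^+ 2); first by rewrite exprn_gt0 ?Re_gt0.
by exists a; split=> //; apply: eB; apply/(ball_nsq _ _ e0).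
Qed.

Lemma closed_nsq (A : set H) u : closed A ->
  (forall e : R, 0 < e -> exists2 a, A a & nsq (u - a) < e) -> A u.
Proof. by move=> cA h; apply: cA; apply/closure_nsq. Qed.

Lemma closed_nsqP (A : set H) :
  (forall u, (forall e : R, 0 < e -> exists2 a, A a & nsq (u - a) < e) -> A u) ->
  closed A.
Proof. by move=> h u /closure_nsq; exact: h. Qed.

Lemma complete_nsq (f : nat -> H) :
  (forall e : R, 0 < e -> exists N, forall m n, (N <= m)%N -> (N <= n)%N ->
    nsq (f m - f n) < e) ->
  exists l, forall e : R, 0 < e -> exists N, forall n, (N <= n)%N ->
    nsq (l - f n) < e.
Proof.
move=> cf; have /cauchy_cvg cvf : cauchy (f @ \oo).
  apply/cauchyP => e e0.
  have [|N hN] := cf (complex.Re e ^+ 2); first by rewrite exprn_gt0 ?Re_gt0.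
  exists (f N); exists N => // n /= Nn; apply/(ball_nsq _ _ e0).
  exact: hN.
exists (lim (f @ \oo)) => e e0.
have se : 0 < (Num.sqrt e)%:C%C :> R[i] by rewrite ltcR sqrtr_gt0.
move/cvg_ballP: cvf => /(_ _ se)[N _ hN]; exists N => n Nn.
by have /(ball_nsq _ _ se) := hN n Nn; rewrite /= sqr_sqrtr // ltW.
Qed.

End Hdot.

Lemma invS_lt (R : realType) (e : R) : 0 < e ->
  exists N, forall n, (N <= n)%N -> n.+1%:R^-1 < e.
Proof.
move=> e0; exists (Num.truncn e^-1) => n Nn; rewrite invf_plt ?posrE //.
by apply: lt_le_trans (truncnS_gt _) _; rewrite ler_nat ltnS.
Qed.

(** * Orthogonal projections, adjoints and bounded forms *)

Section Projection.
Variables (R : realType) (H : hilbertType R).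
Implicit Types (u v w : H) (c : R[i]) (V : set H).

Lemma csqD_le c d : csq (c + d) <= 2 * csq c + 2 * csq d :> R.
Proof.
case: c d => [a b] [a' b']; rewrite /csq /=.
have := sqr_ge0 (a - a'); have := sqr_ge0 (b - b'); nra.
Qed.

Lemma hdot_min_dist u w (d : R) : (forall c, d <= nsq (u - c *: w)) ->
  csq '[u, w] <= nsq w * (nsq u - d).
Proof.
move=> hd; have [->|w0] := eqVneq w 0.
  by rewrite hdot0r nsq0 mul0r /csq /= expr0n addr0.
have nw : 0 < nsq w.
  by rewrite lt_neqAle nsq_ge0 andbT eq_sym; apply: contra w0 => /eqP/nsq_eq0->.
(* This coefficient minimizes the distance from [u] to the line spanned by [w]; there the hypothesis
   reads d <= |u|^2 - |<u, w>|^2 / |w|^2. *)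
have := hd ((nsq w)^-1%:C%C * '[u, w]).
rewrite nsqB nsqZ hdotZr rmorphM /= csqM.
have -> : csq (nsq w)^-1%:C%C = (nsq w)^-1 ^+ 2 by rewrite /csq /= expr0n addr0.
have -> : complex.Re ((((nsq w)^-1)%:C%C)^* * '[u, w]^* * '[u, w]) =
  (nsq w)^-1 * csq '[u, w].
  by case: '[u, w] => a b; rewrite /csq /=; ring.
move=> h; rewrite mulrC -ler_pdivrMr //.
move: h; rewrite expr2 (mulrC (_ * _ * _)) !mulrA divff ?lt0r_neq0 //; lra.
Qed.

Lemma csq_small c : (forall e : R, 0 < e -> csq c <= e) -> c = 0.
Proof.
move=> h; apply: csq_eq0; apply/eqP; rewrite eq_le csq_ge0 andbT.
by apply/ler_addgt0Pl => e e0; rewrite addr0 h.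
Qed.

(** A minimizing sequence for the distance is Cauchy by the parallelogram identity, as midpoints
    stay in [V]. Orthogonality comes from [hdot_min_dist] for the near-minimizers, with an error
    that tends to zero. *)
Lemma ex_orthoproj V v : closed_subspace V -> exists p, is_orthoproj V v p.
Proof.
move=> HV; pose D := [set nsq (v - p) | p in V].
have D0 : D !=set0 by exists (nsq (v - 0)), 0 => //; exact: csubspace0.
have lD : has_lbound D by exists 0 => _ [p _ <-]; exact: nsq_ge0.
pose d := inf D.
have dle p : V p -> d <= nsq (v - p) by move=> Vp; apply: ge_inf => //; exists p.
have /choice[p hp] (n : nat) : exists p, V p /\ nsq (v - p) < d + n.+1%:R^-1.
  have e0 : 0 < n.+1%:R^-1 :> R by rewrite invr_gt0.
  by have [_ [p Vp <-] h] := inf_adherent e0 (conj D0 lD); exists p.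
have Vp n : V (p n) by case: (hp n).
have pn n : nsq (v - p n) < d + n.+1%:R^-1 by case: (hp n).
have VB x y : V x -> V y -> V (x - y).
  by move=> Vx Vy; rewrite addrC -scaleN1r; exact: csubspaceP.
have VZ c x : V x -> V (c *: x).
  by move=> Vx; rewrite -[_ *: _]addr0; apply: csubspaceP => //; exact: csubspace0.
have [e e0|q hq] := @complete_nsq R H p.
  have [N hN] := @invS_lt R (e / 4) ltac:(by rewrite divr_gt0).
  exists N => m n Nm Nn.
  pose a := v - p m; pose b := v - p n.
  have hab := parallelogram a b.
  have E1 : nsq (a - b) = nsq (p m - p n).
    by rewrite /a /b -nsqN; congr nsq; rewrite opprB opprB addrC addrA subrK.
  have E2 : nsq (a + b) = 4 * nsq (v - (2^-1)%:C%C *: (p m + p n)).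
    have -> : 4 = 2 ^+ 2 :> R by ring.
    rewrite -nsqZr; congr nsq; rewrite scalerBr scalerA -rmorphM /=.
    rewrite divff ?pnatr_eq0 // scale1r /a /b.
    have -> : (2 : R)%:C%C = 1 + 1 :> R[i] by rewrite rmorphD /= rmorph1.
    by rewrite scalerDl scale1r opprD addrACA.
  have : d <= nsq (v - (2^-1)%:C%C *: (p m + p n)).
    apply/dle/VZ; rewrite -[p n]opprK; apply/VB => //.
    by rewrite -sub0r; apply/VB => //; exact: csubspace0.
  have := pn m; have := pn n; have := hN _ Nm; have := hN _ Nn.
  rewrite -/a -/b; move: hab; rewrite E1 E2.
  move: (n.+1%:R^-1) (m.+1%:R^-1) => x y; lra.
exists q; split.
  apply: (closed_nsq (csubspace_closed HV)) => e e0.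
  by have [N hN] := hq e e0; exists (p N) => //; exact: hN.
move=> w Vw; apply: csq_small => e e0.
have nw := nsq_ge0 w.
have w1 : 0 < nsq w + 1 by lra.
have [N hN] := @invS_lt R (e / 4 / (nsq w + 1)) ltac:(by rewrite !divr_gt0).
have [M hM] := hq (e / 4 / (nsq w + 1)) ltac:(by rewrite !divr_gt0).
pose n := maxn N M.
have {}hN := hN n (leq_maxl _ _); have {}hM := hM n (leq_maxr _ _).
have -> : '[v - q, w] = '[v - p n, w] + '[p n - q, w].
  by rewrite -hdotDl addrA subrK.
apply: le_trans (csqD_le _ _) _.
have h1 : csq '[v - p n, w] <= nsq w * (nsq (v - p n) - d).
  apply: hdot_min_dist => c; rewrite -addrA -opprD; apply: dle.
  rewrite -[_ *: _]opprK; apply/VB => //.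
  by rewrite -scaleN1r; apply/VZ/VZ.
have h2 := CauchySchwarz_csq (p n - q) w.
rewrite nsqBC in h2.
have h3 : (nsq w + 1) * (e / 4 / (nsq w + 1)) = e / 4.
  by rewrite mulrC divfK // lt0r_neq0.
have h4 : nsq w * (nsq (v - p n) - d) <= e / 4.
  rewrite -h3; apply: ler_pM => //; first by rewrite subr_ge0 dle.
    by lra.
  by have := pn n; move: hN; move: (n.+1%:R^-1) => x; lra.
have h5 : nsq (q - p n) * nsq w <= e / 4.
  by rewrite -h3 mulrC; apply: ler_pM => //; [exact: nsq_ge0|lra|exact: ltW].
lra.
Qed.

Lemma orthoprojP V v : closed_subspace V -> is_orthoproj V v (orthoproj V v).
Proof.
move=> HV; have [p hp] := ex_orthoproj v HV.
exact: (xgetI 0 hp).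
Qed.

End Projection.

(** A relation between plain functions. Linearity of both partners follows from it, so [adj] also
    serves as the linearity hypothesis for operators given by formulas. *)
Definition adj (R : realType) (H K : hilbertType R) (T : H -> K) (S : K -> H) :=
  forall u v, '[T u, v] = '[u, S v].

Definition bounded_op (R : realType) (H K : hilbertType R) (T : H -> K) :=
  exists2 C : R, 0 <= C & forall u, nsq (T u) <= C * nsq u.

Section Adjoint.
Variables (R : realType) (H K : hilbertType R) (T : H -> K) (S : K -> H).
Hypothesis TS : adj T S.

Lemma adj_sym : adj S T.
Proof. by move=> u v; rewrite hdotC -TS -hdotC. Qed.

Lemma adj_lin c u v : T (c *: u + v) = c *: T u + T v.
Proof. by apply: hdot_ext => w; rewrite TS !(hdotDl, hdotZl) !TS. Qed.

Lemma adj_0 : T 0 = 0.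
Proof. by apply: hdot_ext => w; rewrite TS !hdot0l. Qed.

Lemma adj_add u v : T (u + v) = T u + T v.
Proof. by have := adj_lin 1 u v; rewrite !scale1r. Qed.

Lemma adj_scale c u : T (c *: u) = c *: T u.
Proof. by have := adj_lin c u 0; rewrite adj_0 !addr0. Qed.

Lemma adj_opp u : T (- u) = - T u.
Proof. by rewrite -scaleN1r adj_scale scaleN1r. Qed.

Lemma adj_sub u v : T (u - v) = T u - T v.
Proof. by rewrite adj_add adj_opp. Qed.

Lemma adj_sum (J : Type) (r : seq J) (P : pred J) (f : J -> H) :
  T (\sum_(j <- r | P j) f j) = \sum_(j <- r | P j) T (f j).
Proof. by elim/big_rec2: _ => [|j x y _ <-]; rewrite ?adj_0 ?adj_add. Qed.

Lemma bounded_adj : bounded_op T -> bounded_op S.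
Proof.
move=> [C C0 hT]; exists C => // v.
have [v0|v0] := eqVneq (nsq (S v)) 0; first by rewrite v0 mulr_ge0 ?nsq_ge0.
have sv : 0 < nsq (S v) by rewrite lt_neqAle nsq_ge0 eq_sym v0.
have := CauchySchwarz_csq (T (S v)) v; rewrite TS hdot_nsq /csq /= expr0n addr0.
move=> h; have := hT (S v); move: h (nsq_ge0 v) => {hT}.
move: (nsq (T (S v))) (nsq v) (nsq (S v)) sv => x y z z0 h y0 h2.
rewrite -(@ler_pM2l _ z) // -expr2; apply: le_trans h _.
apply: le_trans (ler_wpM2r y0 h2) _; lra.
Qed.

End Adjoint.

Section Riesz.
Variables (R : realType) (H : hilbertType R).

Lemma riesz (f : H -> R[i]) (C : R) :
  (forall c u v, f (c *: u + v) = c * f u + f v) ->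
  (forall u, csq (f u) <= C * nsq u) -> exists z, forall u, f u = '[u, z].
Proof.
move=> fl fb.
have f0 : f 0 = 0.
  by have := fl (- 1) 0 0; rewrite scaler0 addr0 mulN1r addNr.
have fD u v : f (u + v) = f u + f v by have := fl 1 u v; rewrite scale1r mul1r.
have fZ c u : f (c *: u) = c * f u by have := fl c u 0; rewrite f0 !addr0.
pose V := [set u | f u = 0].
have HV : closed_subspace V.
  split=> //.
    apply: closed_nsqP => u hu; apply: csq_small => e e0.
    have C1 : 0 < `|C| + 1 by rewrite ltr_wpDl.
    have [a Va ua] := hu (e / (`|C| + 1)) ltac:(by rewrite divr_gt0).
    have -> : f u = f (u - a) by rewrite fD -scaleN1r fZ Va mulr0 addr0.
    apply: le_trans (fb _) _.
    have -> : e = (`|C| + 1) * (e / (`|C| + 1)).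
      by rewrite mulrC divfK // lt0r_neq0.
    apply: le_trans (_ : (`|C| + 1) * nsq (u - a) <= _); last first.
      by rewrite ler_pM2l // ltW.
    by rewrite ler_wpM2r ?nsq_ge0 // (le_trans (ler_norm C)) // lerDl.
  by move=> c u v /= fu fv; rewrite /V /= fl fu fv mulr0 addr0.
have [fz|] := pselect (forall u, f u = 0).
  by exists 0 => u; rewrite hdot0r fz.
move=> /existsNP[w /eqP fw].
have [p [Vp hp]] := ex_orthoproj w HV.
pose x := w - p.
have fx : f x = f w by rewrite fD -scaleN1r fZ Vp mulr0 addr0.
have x0 : '[x, x] != 0.
  apply: contra fw => /eqP/hdot_eq0 x0; by rewrite -fx x0 f0.
exists ((f x / '[x, x])^* *: x) => u.
have hu : '[u - (f u / f x) *: x, x] = 0.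
  rewrite hdotC hp ?conjC0 //= /V /= fD -scaleNr fZ mulNr.
  by rewrite divfK ?subrr // fx.
move/eqP: hu; rewrite hdotBl hdotZl subr_eq0 => /eqP hu.
rewrite hdotZr hu conjCK; field.
by rewrite x0 fx fw.
Qed.

End Riesz.

Section Form.
Variables (R : realType) (H K : hilbertType R) (M : H -> K -> R[i]).
Hypothesis Ml : forall c u v w, M (c *: u + v) w = c * M u w + M v w.
Hypothesis Mr : forall c u v w, M w (c *: u + v) = c^* * M w u + M w v.

(** [M] does not change under (u, v) -> (s u, s^-1 v) for real s > 0. The choice s^2 = |v| / |u|
    makes both squared norms equal to |u| |v|, which produces the factor 4. The hypothesis has the
    shape of the bounds that transfer operators preserve. *)
Lemma form_bound (C : R) : (forall u v, csq (M u v) <= C * (nsq u + nsq v) ^+ 2) ->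
  forall u v, csq (M u v) <= 4 * C * nsq u * nsq v.
Proof.
move=> hM u v.
have M0l w : M 0 w = 0.
  by have := Ml (- 1) 0 0 w; rewrite scaler0 addr0 mulN1r addNr.
have M0r w : M w 0 = 0.
  have := Mr (- 1) 0 0 w.
  by rewrite scaler0 addr0 rmorphN rmorph1 mulN1r addNr.
have c0 : csq (0 : R[i]) = 0 by rewrite /csq /= expr0n addr0.
have MZl c w w' : M (c *: w) w' = c * M w w'.
  by have := Ml c w 0 w'; rewrite M0l !addr0.
have MZr c w w' : M w (c *: w') = c^* * M w w'.
  by have := Mr c w' 0 w; rewrite M0r !addr0.
have [u0|u0] := eqVneq (nsq u) 0.
  by rewrite (nsq_eq0 u0) M0l c0 nsq0 mulr0 mul0r.
have [v0|v0] := eqVneq (nsq v) 0.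
  by rewrite (nsq_eq0 v0) M0r c0 nsq0 mulr0.
have up : 0 < nsq u by rewrite lt_neqAle nsq_ge0 eq_sym u0.
have vp : 0 < nsq v by rewrite lt_neqAle nsq_ge0 eq_sym v0.
pose q := Num.sqrt (nsq v / nsq u).
have qp : 0 < q by rewrite sqrtr_gt0 divr_gt0.
have q2 : q ^+ 2 = nsq v / nsq u by rewrite sqr_sqrtr // ltW // divr_gt0.
pose s := Num.sqrt q.
have sp : 0 < s by rewrite sqrtr_gt0.
have s2 : s ^+ 2 = q by rewrite sqr_sqrtr // ltW.
have -> : M u v = M (s%:C%C *: u) (s^-1%:C%C *: v).
  rewrite MZl MZr; set z := M u v.
  have -> : ((s^-1)%:C%C)^* = (s^-1)%:C%C :> R[i].
    by apply: conj_Creal; rewrite complex_real.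
  by rewrite mulrA -rmorphM /= divff ?lt0r_neq0 // mul1r.
apply: le_trans (hM _ _) _.
rewrite !nsqZr exprVn s2.
have -> : C * (q * nsq u + q^-1 * nsq v) ^+ 2 =
   C * (q ^+ 2 * nsq u ^+ 2 + 2 * nsq u * nsq v + (q ^+ 2)^-1 * nsq v ^+ 2).
  by field; rewrite lt0r_neq0.
rewrite q2 le_eqVlt; apply/orP; left; apply/eqP; field.
by rewrite u0 v0.
Qed.

Lemma form_op (C : R) : 0 <= C ->
  (forall u v, csq (M u v) <= C * (nsq u + nsq v) ^+ 2) ->
  exists T S, [/\ adj T S, bounded_op T, bounded_op S &
    forall u v, M u v = '[T u, v]].
Proof.
move=> C0 /form_bound hM.
have /choice[S hS] (v : K) : exists z, forall u, M u v = '[u, z].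
  apply: (@riesz _ _ _ (4 * C * nsq v)) => [c u w|u]; first exact: Ml.
  by rewrite mulrAC; exact: hM.
have /choice[T hT] (u : H) : exists z, forall v, (M u v)^* = '[v, z].
  apply: (@riesz _ _ (fun v => (M u v)^*) (4 * C * nsq u)) => [c v w|v].
    by rewrite Mr rmorphD rmorphM /= conjCK.
  by rewrite csqJ; exact: hM.
have TS : adj T S.
  by move=> u v; rewrite -hS hdotC -hT conjCK.
have bT : bounded_op T.
  exists (4 * C); first by rewrite mulr_ge0.
  move=> u; have := hM u (T u).
  have -> : M u (T u) = '[T u, T u] by rewrite hS TS.
  have [v0|v0] := eqVneq (nsq (T u)) 0.
    by rewrite v0 => _; rewrite !mulr_ge0 ?nsq_ge0.
  rewrite hdot_nsq /csq /= expr0n addr0 expr2 ler_pM2r //.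
  by rewrite lt_neqAle nsq_ge0 eq_sym v0.
exists T, S; split=> //; first exact: bounded_adj bT.
by move=> u v; rewrite hS TS.
Qed.

End Form.

(** * Absolute values and Schur's lemma *)

Section SquareRoot.
Variables (R : realType) (H : hilbertType R) (T : H -> H).
Hypothesis TT : adj T T.
Hypothesis T1 : forall u, nsq (T u) <= nsq u.
Implicit Types (u v w : H) (D E : H -> H).

Let B u := u - T (T u).

Lemma B_sa : adj B B.
Proof. by move=> u v; rewrite /B hdotBl hdotBr !TT. Qed.

Lemma B_quad u : complex.Re '[B u, u] = nsq u - nsq (T u).
Proof. by rewrite /B hdotBl TT -/(nsq u) !hdot_nsq /=. Qed.

Lemma B_contr u : nsq (B u) <= nsq u.
Proof.
rewrite /B nsqBC nsqB TT hdot_nsq /=.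
have := T1 (T u); have := nsq_ge0 (T u); have := nsq_ge0 u; lra.
Qed.

Lemma iterB_sa n : adj (iter n B) (iter n B).
Proof.
elim: n => [//|n IH] u v.
by rewrite iterSr IH B_sa.
Qed.

Lemma iterB_quad n u : 0 <= complex.Re '[iter n B u, u].
Proof.
have hB w : 0 <= complex.Re '[B w, w] by rewrite B_quad subr_ge0.
(* Half of the factors moves to the other side of the inner product, leaving |w|^2 or <B w, w>
   according to the parity of [n]. *)
have -> : n = (n./2 + (odd n + n./2))%N.
  by rewrite addnCA addnn odd_double_half.
rewrite iterD iterD iterB_sa; case: (odd n) => /=; first exact: hB.
exact: nsq_ge0.
Qed.

(* The operators p(B) with p a polynomial with nonnegative coefficients; they are
   positive, which is not clear for arbitrary products of positive operators. *)
Inductive pospoly : (H -> H) -> Prop :=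
| pospoly0 : pospoly (fun=> 0)
| pospolyD r n D : 0 <= r -> pospoly D ->
    pospoly (fun u => r%:C%C *: iter n B u + D u).

Lemma pospoly_sa D : pospoly D -> adj D D.
Proof.
elim=> [u v|r n D' r0 _ IH u v]; first by rewrite hdot0l hdot0r.
rewrite hdotDl hdotDr hdotZl hdotZr iterB_sa IH.
by congr (_ * _ + _); rewrite conj_Creal // complex_real.
Qed.

Lemma pospoly_quad D u : pospoly D -> 0 <= complex.Re '[D u, u].
Proof.
elim=> [|r n D' r0 _ IH]; first by rewrite hdot0l.
rewrite hdotDl hdotZl; have := iterB_quad n u.
move: '[_, _] IH => z; case: '[_, _] => a b; case: z => c d /= h h'.
by rewrite mul0r subr0 addr_ge0 // mulr_ge0.
Qed.

Lemma pospoly_add D E : pospoly D -> pospoly E -> pospoly (fun u => D u + E u).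
Proof.
elim=> [|r n D' r0 _ IH] pE.
  by have -> : (fun u => 0 + E u) = E by apply/funext => u; rewrite add0r.
have -> : (fun u => r%:C%C *: iter n B u + D' u + E u) =
  (fun u => r%:C%C *: iter n B u + (D' u + E u)).
  by apply/funext => u; rewrite addrA.
by apply: pospolyD => //; exact: IH.
Qed.

Lemma pospoly_comp D E : pospoly D -> pospoly E -> pospoly (fun u => D (E u)).
Proof.
elim=> [|r n D' r0 _ IH] pE; first exact: pospoly0.
apply: pospoly_add; last exact: IH.
elim: pE => [|s m E' s0 pE IHE].
  have -> : (fun u : H => r%:C%C *: iter n B 0) = fun=> 0.
    by apply/funext => u; rewrite (adj_0 (iterB_sa n)) scaler0.
  exact: pospoly0.
have -> : (fun u => r%:C%C *: iter n B (s%:C%C *: iter m B u + E' u)) =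
  (fun u => (r * s)%:C%C *: iter (n + m) B u + r%:C%C *: iter n B (E' u)).
  apply/funext => u; rewrite (adj_lin (iterB_sa n)) scalerDr scalerA iterD.
  by rewrite -rmorphM.
by apply: pospolyD => //; rewrite mulr_ge0.
Qed.

Lemma pospoly_half D : pospoly D -> pospoly (fun u => 2^-1%:C%C *: D u).
Proof.
move=> pD; apply: (pospoly_comp _ pD).
have -> : ( *:%R 2^-1%:C%C) = (fun u => 2^-1%:C%C *: iter 0 B u + 0) :> (H -> H).
  by apply/funext => u; rewrite addr0.
by apply: pospolyD; [rewrite invr_ge0|exact: pospoly0].
Qed.

Lemma pospoly_B : pospoly B.
Proof.
have -> : B = (fun u => 1%:C%C *: iter 1 B u + 0).
  by apply/funext => u; rewrite addr0 scale1r.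
by apply: pospolyD => //; exact: pospoly0.
Qed.

(** The fixed point equation 2 Z = B + Z^2 says (1 - Z)^2 = 1 - B = T^2, so the limit of the
    iterates is 1 - |T|. *)
Fixpoint sqrt_iter n u := if n is m.+1 then 2^-1%:C%C *: (B u + sqrt_iter m (sqrt_iter m u)) else 0.

Lemma sqrt_iter_pospoly n : pospoly (sqrt_iter n).
Proof.
elim: n => [|n IH]; first exact: pospoly0.
exact/pospoly_half/(pospoly_add pospoly_B)/pospoly_comp.
Qed.

Lemma sqrt_iter_commute X X' : adj X X' -> (forall u, T (X u) = X (T u)) ->
  forall n u, sqrt_iter n (X u) = X (sqrt_iter n u).
Proof.
move=> aX TX; elim=> [u|n IH u] /=; first by rewrite (adj_0 aX).
by rewrite !IH (adj_scale aX) (adj_add aX) /B (adj_sub aX) !TX.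
Qed.

(** The iterates Y_n commute, so Y_(n+2) - Y_(n+1) is half the product of Y_(n+1) - Y_n and Y_(n+1)
    + Y_n, and [pospoly] is closed under products. *)
Lemma sqrt_iter_step_pospoly n : pospoly (fun u => sqrt_iter n.+1 u - sqrt_iter n u).
Proof.
elim: n => [|n IH].
  have -> : (fun u => sqrt_iter 1 u - sqrt_iter 0 u) = sqrt_iter 1 by apply/funext => u; rewrite subr0.
  exact: sqrt_iter_pospoly.
have TY m u : sqrt_iter m (T u) = T (sqrt_iter m u) by apply: (sqrt_iter_commute TT).
have YY m k u : sqrt_iter m (sqrt_iter k u) = sqrt_iter k (sqrt_iter m u).
  by apply: (sqrt_iter_commute (pospoly_sa (sqrt_iter_pospoly k))) => w; rewrite TY.
have -> : (fun u => sqrt_iter n.+2 u - sqrt_iter n.+1 u) = (fun u => 2^-1%:C%C *: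
    ((fun v => sqrt_iter n.+1 v - sqrt_iter n v) ((fun v => sqrt_iter n.+1 v + sqrt_iter n v) u))).
  apply/funext => u.
  have E m : sqrt_iter m.+1 u = 2^-1%:C%C *: (B u + sqrt_iter m (sqrt_iter m u)) by [].
  rewrite [in LHS](E n.+1) [X in _ - X](E n) -scalerBr; congr (_ *: _).
  rewrite opprD addrACA subrr add0r.
  have a m := adj_add (pospoly_sa (sqrt_iter_pospoly m)).
  by rewrite -/(sqrt_iter n.+1) !a opprD (YY n n.+1 u) addrA addrK.
apply: pospoly_half.
apply: (@pospoly_comp (fun v => sqrt_iter n.+1 v - sqrt_iter n v)
                      (fun v => sqrt_iter n.+1 v + sqrt_iter n v)) => //.
by apply: pospoly_add; exact: sqrt_iter_pospoly.
Qed.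

Lemma sqrt_iter_contr n u : nsq (sqrt_iter n u) <= nsq u.
Proof.
elim: n u => [u|n IH u] /=; first by rewrite nsq0 nsq_ge0.
rewrite nsqZr; have := nsqD_le (B u) (sqrt_iter n (sqrt_iter n u)).
have := B_contr u; have := IH u; have := IH (sqrt_iter n u).
have -> : 2^-1 ^+ 2 = 4^-1 :> R by field.
lra.
Qed.

Lemma sqrt_iter_mono m n : (n <= m)%N -> pospoly (fun u => sqrt_iter m u - sqrt_iter n u).
Proof.
move=> /subnK <-; elim: (m - n)%N => [|k IH].
  have -> : (fun u => sqrt_iter (0 + n) u - sqrt_iter n u) = fun=> 0.
    by apply/funext => u; rewrite subrr.
  exact: pospoly0.
have -> : (fun u => sqrt_iter (k.+1 + n) u - sqrt_iter n u) =
  (fun u => (fun v => sqrt_iter (k + n).+1 v - sqrt_iter (k + n) v) u +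
            (fun v => sqrt_iter (k + n) v - sqrt_iter n v) u).
  by apply/funext => u; rewrite addrA subrK.
by apply: pospoly_add => //; exact: sqrt_iter_step_pospoly.
Qed.

(** This reduces strong convergence to that of the bounded increasing real sequence <Y_n u, u>. *)
Lemma sqrt_iter_diff m n u : (n <= m)%N ->
  nsq (sqrt_iter m u - sqrt_iter n u) <= 4 * (complex.Re '[sqrt_iter m u, u] - complex.Re '[sqrt_iter n u, u]).
Proof.
move=> /sqrt_iter_mono pZ; pose Z v := sqrt_iter m v - sqrt_iter n v.
have Zsa : adj Z Z := pospoly_sa pZ.
(* Positivity of [Z] at u - Z u / 4, together with <Z Z u, Z u> <= 2 |Z u|^2, gives 3/8 |Z u|^2 <=
   <Z u, u>. *)
have h := pospoly_quad (u - (4^-1)%:C%C *: Z u) pZ.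
have Zb : nsq (Z (Z u)) <= 4 * nsq (Z u).
  have := nsqD_le (sqrt_iter m (Z u)) (- sqrt_iter n (Z u)); rewrite nsqN.
  have := sqrt_iter_contr m (Z u); have := sqrt_iter_contr n (Z u); rewrite -/(Z (Z u)); lra.
have hc := Re_hdot_le (Z (Z u)) (Z u).
have {}hc : complex.Re '[Z (Z u), Z u] <= 2 * nsq (Z u).
  have := nsq_ge0 (Z u); move: hc Zb (nsq_ge0 (Z (Z u))).
  move: (nsq (Z u)) (nsq (Z (Z u))) (complex.Re _) => a b x; nra.
have -> : complex.Re '[sqrt_iter m u, u] - complex.Re '[sqrt_iter n u, u] = complex.Re '[Z u, u].
  by rewrite /Z hdotBl; case: '[sqrt_iter m u, u] => ? ?; case: '[sqrt_iter n u, u].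
move: h; rewrite -/(Z _) (adj_sub Zsa) (adj_scale Zsa).
rewrite hdotBl !hdotBr !hdotZl !hdotZr (Zsa (Z u) u) -/(Z u) hdot_nsq.
move: hc (nsq_ge0 (Z u)); rewrite -/(Z (Z u)).
case: '[Z u, u] => a b; case: '[Z (Z u), Z u] => c d /=.
rewrite !(mul0r, mulr0, subr0, addr0, oppr0, add0r); lra.
Qed.

End SquareRoot.

Definition cv (R : realType) (H : hilbertType R) (f : nat -> H) (l : H) :=
  forall e : R, 0 < e -> exists N, forall n, (N <= n)%N -> nsq (l - f n) < e.

Section StrongLimits.
Variables (R : realType) (H : hilbertType R).
Implicit Types (f g : nat -> H) (l : H).

Lemma cv_uniq f l l' : cv f l -> cv f l' -> l = l'.
Proof.
move=> fl fl'; apply/subr0_eq/nsq_eq0/eqP.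
rewrite eq_le nsq_ge0 andbT; apply/ler_addgt0Pl => e e0; rewrite addr0.
have [N hN] := fl (e / 4) ltac:(by rewrite divr_gt0).
have [M hM] := fl' (e / 4) ltac:(by rewrite divr_gt0).
have {}hN := hN _ (leq_maxl N M); have {}hM := hM _ (leq_maxr N M).
move: hN hM; set x := f _ => hN hM.
have -> : l - l' = (l - x) + (x - l') by rewrite addrA subrK.
apply: le_trans (nsqD_le _ _) _; rewrite (nsqBC x); lra.
Qed.

Lemma cvD f g l l' : cv f l -> cv g l' -> cv (fun n => f n + g n) (l + l').
Proof.
move=> fl gl e e0.
have [N hN] := fl (e / 4) ltac:(by rewrite divr_gt0).
have [M hM] := gl (e / 4) ltac:(by rewrite divr_gt0).
exists (maxn N M) => n; rewrite geq_max => /andP[/hN h1 /hM h2].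
rewrite opprD addrACA; apply: le_lt_trans (nsqD_le _ _) _; lra.
Qed.

Lemma cv_cst l : cv (fun=> l) l.
Proof. by move=> e e0; exists 0%N => n _; rewrite subrr nsq0. Qed.

Lemma cv_shift f l : cv f l -> cv (fun n => f n.+1) l.
Proof. by move=> fl e /fl[N hN]; exists N => n Nn; apply/hN/leqW. Qed.

Lemma cvZ (c : R[i]) f l : cv f l -> cv (fun n => c *: f n) (c *: l).
Proof.
move=> fl e e0.
have c1 : 0 < csq c + 1 by rewrite ltr_wpDl // csq_ge0.
have [N hN] := fl (e / (csq c + 1)) ltac:(by rewrite divr_gt0).
exists N => n /hN; rewrite -scalerBr nsqZ ltr_pdivlMr // mulrC => h.
by apply: le_lt_trans h; rewrite ler_wpM2r ?nsq_ge0 // lerDl.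
Qed.

Lemma cv_Re f l v (b : R) : cv f l -> (forall n, complex.Re '[f n, v] <= b) ->
  complex.Re '[l, v] <= b.
Proof.
move=> fl hb; apply/ler_addgt0Pl => e e0.
have v1 : 0 < nsq v + 1 by rewrite ltr_wpDl // nsq_ge0.
have [N /(_ _ (leqnn N)) hN] := fl (e ^+ 2 / (nsq v + 1))
  ltac:(by rewrite divr_gt0 // exprn_gt0).
have -> : '[l, v] = '[l - f N, v] + '[f N, v] by rewrite -hdotDl subrK.
rewrite raddfD /= lerD //.
have := Re_hdot_le (l - f N) v; move: hN; rewrite ltr_pdivlMr //.
have := nsq_ge0 v; have := nsq_ge0 (l - f N).
move: (complex.Re _) (nsq _) (nsq _) => x a b' a0 b0 h1 h2.
rewrite leNgt; apply/negP => h3; nra.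
Qed.

Lemma cv_dot f g l l' v w : cv f l -> cv g l' ->
  (forall n, '[f n, v] = '[w, g n]) -> '[l, v] = '[w, l'].
Proof.
move=> fl gl fg; apply/subr0_eq/csq_small => e e0.
have s0 x : 0 < nsq (x : H) + 1 by rewrite ltr_wpDl // nsq_ge0.
have [N hN] := fl (e / 4 / (nsq v + 1)) ltac:(by rewrite !divr_gt0).
have [M hM] := gl (e / 4 / (nsq w + 1)) ltac:(by rewrite !divr_gt0).
have := hN _ (leq_maxl N M); have := hM _ (leq_maxr N M).
set n := maxn N M; rewrite !ltr_pdivlMr // => h1 h2.
have -> : '[l, v] - '[w, l'] = '[l - f n, v] + '[w, - (l' - g n)].
  by rewrite opprB hdotBl hdotBr fg addrA subrK.
apply: le_trans (csqD_le _ _) _.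
have := CauchySchwarz_csq (l - f n) v; have := CauchySchwarz_csq w (- (l' - g n)).
rewrite nsqN; have := nsq_ge0 (l - f n); have := nsq_ge0 (l' - g n); lra.
Qed.

End StrongLimits.

Section AbsoluteValue.
Variables (R : realType) (H : hilbertType R) (T : H -> H).
Hypothesis TT : adj T T.
Hypothesis T1 : forall u, nsq (T u) <= nsq u.

(** [S] is the absolute value of [T], obtained as 1 - Z with [Z] the strong limit of [sqrt_iter]. An
    operator commuting with [T] commutes with every iterate; the relation passes to the limit once
    [X] is moved to [X'] on the other side of the inner product. *)
Lemma abs_contraction : exists S, [/\ adj S S, (forall u, S (S u) = T (T u)),
  (forall u, 0 <= complex.Re '[S u, u]) &
  forall X X', adj X X' -> (forall u, T (X u) = X (T u)) ->
    forall u, S (X u) = X (S u)].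
Proof.
have Yc n u : nsq (sqrt_iter T n u) <= nsq u by exact: sqrt_iter_contr.
have Ysa n : adj (sqrt_iter T n) (sqrt_iter T n) by exact/pospoly_sa/sqrt_iter_pospoly.
have /choice[Z hZ] u : exists l, cv (fun n => sqrt_iter T n u) l.
  apply: complete_nsq => e e0.
  pose q n := complex.Re '[sqrt_iter T n u, u].
  have qb n : q n <= nsq u.
    have := Re_hdot_le (sqrt_iter T n u) u; have := Yc n u; have := nsq_ge0 u.
    rewrite -/(q n); move: (q n) (nsq u) (nsq _) => x a b a0 h1 h2.
    rewrite leNgt; apply/negP => h3; nra.
  have qm m n : (n <= m)%N -> q n <= q m.
    move=> nm; have := sqrt_iter_diff TT T1 u nm; have := nsq_ge0 (sqrt_iter T m u - sqrt_iter T n u).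
    rewrite -/(q m) -/(q n); lra.
  pose D := range q.
  have hD : has_sup D.
    by split; [exists (q 0%N), 0%N|exists (nsq u) => _ [n _ <-]].
  have [|_ [N _ <-] hN] := @sup_adherent R D (e / 16) _ hD.
    by rewrite divr_gt0.
  have qs n : q n <= sup D by apply: ub_le_sup; [case: hD|exists n].
  exists N => m n Nm Nn.
  have -> : sqrt_iter T m u - sqrt_iter T n u = (sqrt_iter T m u - sqrt_iter T N u) + (sqrt_iter T N u - sqrt_iter T n u).
    by rewrite addrA subrK.
  apply: le_lt_trans (nsqD_le _ _) _; rewrite (nsqBC (sqrt_iter T N u)).
  have := sqrt_iter_diff TT T1 u Nm; have := sqrt_iter_diff TT T1 u Nn.
  rewrite -/(q m) -/(q n) -/(q N); have := qs m; have := qs n.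
  have := qm _ _ Nm; have := qm _ _ Nn; lra.
have Zsa : adj Z Z by move=> u v; apply: cv_dot (hZ u) (hZ v) _ => n; exact: Ysa.
have ZZ u : Z (Z u) = 2%:R *: Z u - (u - T (T u)).
  have YYZ : cv (fun n => sqrt_iter T n (sqrt_iter T n u)) (Z (Z u)).
    move=> e e0; have [N hN] := hZ u (e / 4) ltac:(by rewrite divr_gt0).
    have [M hM] := hZ (Z u) (e / 4) ltac:(by rewrite divr_gt0).
    exists (maxn N M) => n; rewrite geq_max => /andP[/hN h1 /hM h2].
    have -> : Z (Z u) - sqrt_iter T n (sqrt_iter T n u) =
      (Z (Z u) - sqrt_iter T n (Z u)) + sqrt_iter T n (Z u - sqrt_iter T n u).
      by rewrite (adj_sub (Ysa n)) addrA subrK.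
    apply: le_lt_trans (nsqD_le _ _) _; have := Yc n (Z u - sqrt_iter T n u); lra.
  have := cvZ (2^-1)%:C%C (cvD (cv_cst (u - T (T u))) YYZ).
  move=> /(cv_uniq (cv_shift (hZ u))) E; rewrite [in RHS]E.
  rewrite scalerA.
  have -> : 2 * (2^-1)%:C%C = 1 :> R[i].
    have -> : 2%:R = (2%:R : R)%:C%C by rewrite rmorph_nat.
    by rewrite -rmorphM /= divff ?pnatr_eq0.
  by rewrite scale1r addrAC subrr add0r.
exists (fun u => u - Z u); split.
- by move=> u v; rewrite hdotBl hdotBr Zsa.
- move=> u; rewrite (adj_sub Zsa) ZZ; apply: hdot_ext => w.
  by rewrite !(hdotBl, hdotZl); ring.
- move=> u; rewrite hdotBl hdot_nsq raddfB /= subr_ge0.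
  apply: (cv_Re (hZ u)) => n.
  have := Re_hdot_le (sqrt_iter T n u) u; have := Yc n u; have := nsq_ge0 u.
  move: (complex.Re _) (nsq u) (nsq _) => x a b a0 h1 h2.
  rewrite leNgt; apply/negP => h3; nra.
move=> X X' aX TX u; rewrite (adj_sub aX); congr (_ - _).
apply: hdot_ext => v; rewrite aX [RHS]Zsa.
apply: cv_dot (hZ (X u)) (hZ (X' v)) _ => n.
by rewrite (sqrt_iter_commute aX TX) aX Ysa.
Qed.

End AbsoluteValue.

Section LinearCombination.
Variables (R : realType) (H K : hilbertType R) (T S : H -> K).

Lemma bounded_op_lincomb (c d : R[i]) : bounded_op T -> bounded_op S ->
  bounded_op (fun u => c *: T u + d *: S u).
Proof.
move=> [C C0 hC] [D D0 hD]; exists (2 * (csq c * C) + 2 * (csq d * D)).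
  by rewrite addr_ge0 // mulr_ge0 // mulr_ge0 // csq_ge0.
move=> u; apply: le_trans (nsqD_le _ _) _; rewrite !nsqZ.
have := ler_wpM2l (csq_ge0 c) (hC u); have := ler_wpM2l (csq_ge0 d) (hD u); lra.
Qed.

Lemma bounded_opB : bounded_op T -> bounded_op S ->
  bounded_op (fun u => T u - S u).
Proof.
move=> bT bS; have := bounded_op_lincomb 1 (- 1) bT bS.
by congr bounded_op; apply/funext => u; rewrite scale1r scaleN1r.
Qed.

Lemma bounded_opD : bounded_op T -> bounded_op S ->
  bounded_op (fun u => T u + S u).
Proof.
move=> bT bS; have := bounded_op_lincomb 1 1 bT bS.
by congr bounded_op; apply/funext => u; rewrite !scale1r.
Qed.

End LinearCombination.

Lemma adj_lincomb (R : realType) (H : hilbertType R) (T S : H -> H) (c : R[i]) :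
  adj T S -> adj (fun u => c *: T u + c^* *: S u) (fun u => c *: T u + c^* *: S u).
Proof.
move=> TS u v; rewrite hdotDl hdotDr !hdotZl !hdotZr TS (adj_sym TS).
by rewrite conjCK addrC.
Qed.

Section Schur.
Variables (R : realType) (H : hilbertType R) (G : (H -> H) -> Prop).
Hypothesis G_adj : forall X, G X -> exists X', adj X X'.
Hypothesis G_irr : forall V : set H, closed_subspace V ->
  (forall X, G X -> forall v, V v -> V (X v)) -> V = [set 0] \/ V = setT.

Lemma adj_bounded_closed (K : hilbertType R) (T : H -> K) (S : K -> H) : adj T S -> bounded_op T ->
  closed_subspace [set u | T u = 0].
Proof.
move=> TS [C C0 hC]; split; last first.
- by move=> c u v /= Tu Tv; rewrite (adj_lin TS) Tu Tv scaler0 addr0.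
- exact: adj_0 TS.
apply: closed_nsqP => u hu; apply: nsq_eq0; apply/eqP.
rewrite eq_le nsq_ge0 andbT; apply/ler_addgt0Pl => e e0; rewrite addr0.
have C1 : 0 < C + 1 by rewrite ltr_wpDl.
have [a Ta ua] := hu (e / (C + 1)) ltac:(by rewrite divr_gt0).
have -> : T u = T (u - a) by rewrite (adj_sub TS) Ta subr0.
apply: le_trans (hC _) _; move: ua; rewrite ltr_pdivlMr //.
have := nsq_ge0 (u - a); lra.
Qed.

Lemma bounded_opZ (c : R[i]) : bounded_op ( *:%R c : H -> H).
Proof. by exists (csq c) => [|u]; rewrite ?csq_ge0 ?nsqZ. Qed.

Lemma adj_real (r : R) : adj ( *:%R r%:C%C : H -> H) ( *:%R r%:C%C).
Proof. by move=> u v; rewrite hdotZl hdotZr conj_Creal // complex_real. Qed.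

(* With [S = |A|], the kernel of [S - A] is invariant, hence [0] or everything; in
   the first case [(S - A) (S + A) = 0] gives [A = - S], in the second [A = S]. *)
Lemma sa_semidefinite (A : H -> H) : adj A A -> bounded_op A ->
  (forall X, G X -> forall v, A (X v) = X (A v)) ->
  (forall u, 0 <= complex.Re '[A u, u]) \/ (forall u, complex.Re '[A u, u] <= 0).
Proof.
move=> AA [C C0 hC] AX.
pose s := Num.sqrt (C + 1).
have s0 : 0 < s by rewrite sqrtr_gt0 ltr_wpDl.
have s2 : s ^+ 2 = C + 1 by rewrite sqr_sqrtr // addr_ge0.
pose T u := s^-1%:C%C *: A u.
have TT : adj T T.
  by move=> u v; rewrite /T -(adj_scale AA) AA; apply: adj_real.
have T1 u : nsq (T u) <= nsq u.
  rewrite nsqZr exprVn s2 mulrC ler_pdivrMr ?ltr_wpDl //.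
  have := hC u; have := nsq_ge0 u; lra.
have AT u : A u = s%:C%C *: T u.
  by rewrite scalerA -rmorphM /= divff ?scale1r // lt0r_neq0.
have [S [SS S2 S0 SX]] := abs_contraction TT T1.
have TX X : G X -> forall u, T (X u) = X (T u).
  by move=> GX u; have [X' aX] := G_adj GX; rewrite (adj_scale aX) /T AX.
have bS : bounded_op S.
  exists 1 => // u; rewrite mul1r.
  by apply: le_trans (T1 u); rewrite /nsq SS S2 -TT.
have bT : bounded_op T by exists 1 => // u; rewrite mul1r.
have aST : adj (fun u => S u - T u) (fun u => S u - T u).
  by move=> u v; rewrite hdotBl hdotBr SS TT.
have scal (r : R) z : complex.Re (r%:C%C * z) = r * complex.Re z.
  by case: z => a b /=; rewrite mul0r subr0.
have [] := G_irr (adj_bounded_closed aST (bounded_opB bS bT)).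
- move=> X GX v /= /subr0_eq e; have [X' aX] := G_adj GX.
  by rewrite (SX _ _ aX) ?(TX _ GX) ?e ?subrr // => u; exact: TX.
- move=> h; right => u.
  have ST v : S (T v) = T (S v) by apply: SX TT _ v.
  have /[!h] : [set u | S u - T u = 0] (S u + T u).
    rewrite /= (adj_add SS) (adj_add TT) S2 ST; apply: hdot_ext => w.
    by rewrite !(hdotBl, hdotDl) hdot0l; ring.
  move=> /= /eqP; rewrite addrC addr_eq0 => /eqP Tu.
  by rewrite AT hdotZl scal Tu hdotNl raddfN /= mulrN oppr_le0 mulr_ge0 // ltW.
move=> h; left => u; have : [set: H] u by [].
rewrite -h /= => /subr0_eq Su.
by rewrite AT hdotZl scal -Su mulr_ge0 // ltW.
Qed.

Lemma sa_quad0 (A : H -> H) : adj A A ->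
  (forall u, complex.Re '[A u, u] = 0) -> forall u, A u = 0.
Proof.
(* Polarization: besides its values at [u] and [A u], the quadratic form at u + A u contains 2 |A
   u|^2. *)
move=> AA h u; have := h (u + A u).
rewrite (adj_add AA) hdotDl !hdotDr !raddfD /= !h.
rewrite (AA (A u) u) -!/(nsq (A u)) => h2; apply: nsq_eq0; lra.
Qed.

(** For every real [r] the operator A - r is semidefinite by [sa_semidefinite]. The cut that this
    dichotomy makes in the real line is the scalar by which [A] acts. *)
Lemma schur_sa (A : H -> H) : adj A A -> bounded_op A ->
  (forall X, G X -> forall v, A (X v) = X (A v)) ->
  exists r : R, forall v, A v = r%:C%C *: v.
Proof.
move=> AA bA AX; pose q u := complex.Re '[A u, u].
have [H0|/existsNP[v0 /eqP v00]] := pselect (forall v : H, v = 0).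
  by exists 0 => v; rewrite (H0 (A v)) (H0 (_ *: _)).
have aAr (r : R) : adj (fun u => A u - r%:C%C *: u) (fun u => A u - r%:C%C *: u).
  by move=> u v; rewrite hdotBl hdotBr AA adj_real.
have qr (r : R) u : complex.Re '[A u - r%:C%C *: u, u] = q u - r * nsq u.
  by rewrite hdotBl hdotZl hdot_nsq raddfB /= mul0r subr0.
have dich (r : R) : (forall u, r * nsq u <= q u) \/ (forall u, q u <= r * nsq u).
  have [|X GX v|h|h] := sa_semidefinite (aAr r).
  - by apply: bounded_opB bA _; exact: bounded_opZ.
  - by have [X' aX] := G_adj GX; rewrite AX // (adj_sub aX) (adj_scale aX).
  - by left => u; have := h u; rewrite qr subr_ge0.
  - by right => u; have := h u; rewrite qr subr_le0.
have v0p : 0 < nsq v0.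
  by rewrite lt_neqAle nsq_ge0 andbT eq_sym; apply: contra v00 => /eqP/nsq_eq0->.
pose D := [set r : R | forall u, r * nsq u <= q u].
have [C C0 hC] := bA.
have qC u : - (C + 1) * nsq u <= q u.
  have := nsqD_le (A u) u; have := nsq_ge0 (A u + u).
  rewrite nsqD -/(q u); have := hC u; have := nsq_ge0 u; have := nsq_ge0 (A u); lra.
have hD : has_sup D.
  split; first by exists (- (C + 1)).
  by exists (q v0 / nsq v0) => r /(_ v0); rewrite ler_pdivlMr.
exists (sup D) => v; apply/subr0_eq; move: v; apply: sa_quad0 => // u.
rewrite qr; apply/eqP; rewrite subr_eq0 eq_le; apply/andP; split.
  apply/ler_addgt0Pr => e e0.
  have u1 : 0 < nsq u + 1 by rewrite ltr_wpDl // nsq_ge0.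
  have e'0 : 0 < e / (nsq u + 1) by rewrite divr_gt0.
  have [h|/(_ u) h] := dich (sup D + e / (nsq u + 1)).
    have /ub_le_sup := h : D _; have [_ ub] := hD => /(_ ub).
    by rewrite gerDl leNgt e'0.
  apply: le_trans h _; rewrite mulrDl lerD2l.
  rewrite mulrAC ler_pdivrMr //; have := nsq_ge0 u; nra.
apply/ler_addgt0Pr => e e0.
have u1 : 0 < nsq u + 1 by rewrite ltr_wpDl // nsq_ge0.
have e'0 : 0 < e / (nsq u + 1) by rewrite divr_gt0.
have [r Dr hr] := sup_adherent e'0 hD; have Dr' := Dr u.
have : (sup D - r) * nsq u <= e; last by lra.
have : (sup D - r) * (nsq u + 1) <= e by rewrite -ler_pdivlMr //; lra.
have : 0 <= sup D - r by rewrite subr_ge0; apply: ub_le_sup => //; case: hD.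
have := nsq_ge0 u; lra.
Qed.

End Schur.

(** * Shift-invariant means *)

Definition bounded_seq (R : realType) (a : nat -> R[i]) :=
  exists B : R, forall n, csq (a n) <= B.

(** A Banach limit for complex sequences. The factor 2 in [mean_bound] leaves room for estimating
    the real and imaginary parts separately. *)
Record shift_mean (R : realType) (m : (nat -> R[i]) -> R[i]) : Prop := ShiftMean {
  mean_lin : forall c a b, bounded_seq a -> bounded_seq b ->
    m (fun n => c * a n + b n) = c * m a + m b;
  mean_cst : forall c, m (fun=> c) = c;
  mean_shift : forall a, bounded_seq a -> m (fun n => a n.+1) = m a;
  mean_conj : forall a, bounded_seq a -> m (fun n => (a n)^*) = (m a)^*;
  mean_ge0 : forall a, bounded_seq a -> (forall n, 0 <= a n) -> 0 <= m a;
  mean_bound : forall a B, (forall n, csq (a n) <= B) -> csq (m a) <= 2 * B }.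

Section Mean.
Variable R : realType.

Definition cesaro (a : nat -> R) (N : nat) : R :=
  (\sum_(i < N.+1) a i) / N.+1%:R.

Lemma cesaro_le (a : nat -> R) B : (forall n, a n <= B) -> forall N, cesaro a N <= B.
Proof.
move=> aB N; rewrite ler_pdivrMr // mulr_natr -[N.+1 in X in _ <= X]card_ord.
by rewrite -sumr_const; apply: ler_sum => i _.
Qed.

Lemma cesaro_ge (a : nat -> R) B : (forall n, B <= a n) -> forall N, B <= cesaro a N.
Proof.
move=> aB N; rewrite ler_pdivlMr // mulr_natr -[N.+1 in X in X <= _]card_ord.
by rewrite -sumr_const; apply: ler_sum => i _.
Qed.

Lemma cesaro_lin (c : R) a b :
  cesaro (fun n => c * a n + b n) = (fun N => c * cesaro a N + cesaro b N).
Proof.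
by apply/funext => N; rewrite /cesaro big_split /= -mulr_sumr mulrDl mulrA.
Qed.

Lemma cesaro_shift a N :
  cesaro (fun n => a n.+1) N = cesaro a N + (a N.+1 - a 0%N) / N.+1%:R.
Proof.
rewrite /cesaro -mulrDl; congr (_ / _).
have E : \sum_(i < N.+2) a i = a 0%N + \sum_(i < N.+1) a i.+1.
  by rewrite big_ord_recl.
have E' : \sum_(i < N.+2) a i = \sum_(i < N.+1) a i + a N.+1.
  by rewrite big_ord_recr.
by rewrite addrA -E' E addrC addKr.
Qed.

Definition bdd_real (a : nat -> R) := exists B : R, forall n, `|a n| <= B.

(** The mean is the limit of the Cesaro averages along an ultrafilter finer than the filter at
    infinity. A shift changes the N-th average by (a_(N+1) - a_0) / (N + 1), which tends to zero for
    bounded [a]. *)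
Lemma ex_real_mean : exists L : (nat -> R) -> R, [/\
  (forall c a b, bdd_real a -> bdd_real b ->
    L (fun n => c * a n + b n) = c * L a + L b),
  (forall c, L (fun=> c) = c),
  (forall a, bdd_real a -> L (fun n => a n.+1) = L a) &
  (forall a B, bdd_real a -> (forall n, a n <= B) -> L a <= B)].
Proof.
have [U [UU oU]] := @ultraFilterLemma nat \oo _.
have PU : ProperFilter U := @ultra_proper _ _ UU.
pose L a := lim (cesaro a @ U).
have cvL a : bdd_real a -> cesaro a @ U --> L a.
  move=> [B aB]; suff : cvg (cesaro a @ U) by []; apply/cvg_ex.
  have sU : (cesaro a @ U) `[- B, B]%classic.
    suff : U (cesaro a @^-1` `[- B, B]) by []; apply: filterE => N /=; rewrite in_itv /=; apply/andP; split.
      by apply: cesaro_ge => n; have := aB n; rewrite ler_norml => /andP[].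
    by apply: cesaro_le => n; have := aB n; rewrite ler_norml => /andP[].
  have [p [_ cp]] := @segment_compact R _ _ _ (fmap_proper_filter (cesaro a) PU) sU.
  exists p => V Vp.
  have [//|UC] := in_ultra_setVsetC (cesaro a @^-1` V) UU.
  by have [x [nVx Vx]] := cp (~` V) V UC Vp.
have bl (c : R) a b : bdd_real a -> bdd_real b -> bdd_real (fun n => c * a n + b n).
  move=> [A hA] [B hB]; exists (`|c| * A + B) => n.
  apply: le_trans (ler_normD _ _) _; rewrite normrM lerD //.
  by rewrite ler_wpM2l.
exists L; split.
- move=> c a b ba bb; apply: cvg_lim => //; rewrite cesaro_lin.
  by apply: cvgD; [apply: cvgM; [exact: cvg_cst|exact: cvL]|exact: cvL].
- move=> c; apply: cvg_lim => //; have -> : cesaro (fun=> c) = fun=> c.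
    apply/funext => N; apply/eqP; rewrite eq_le.
    by apply/andP; split; [apply: cesaro_le|apply: cesaro_ge].
  exact: cvg_cst.
- move=> a ba; apply: cvg_lim => //.
  have -> : cesaro (fun n => a n.+1) =
    (fun N => cesaro a N + (a N.+1 - a 0%N) / N.+1%:R).
    by apply/funext => N; exact: cesaro_shift.
  rewrite -[L a]addr0; apply: cvgD; first exact: cvL.
  have [B hB] := ba.
  suff : (fun N => (a N.+1 - a 0%N) / N.+1%:R) @ \oo --> (0 : R).
    by apply: cvg_trans => V; exact: oU.
  apply/cvgr0Pnorm_le => e e0; exists (Num.truncn (2 * B / e)) => // n /= hn.
  rewrite normrM normfV [`|_.+1%:R|]ger0_norm // ler_pdivrMr //.
  apply: le_trans (ler_normB _ _) _.
  apply: le_trans (lerD (hB _) (hB _)) _.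
  have -> : B + B = 2 * B by ring.
  rewrite -ler_pdivrMl // mulrC.
  apply: ltW; apply: lt_le_trans (truncnS_gt _) _.
  by rewrite ler_nat ltnS.
- move=> a B ba aB; apply: limr_le; first by apply/cvg_ex; exists (L a); exact: cvL.
  by apply: filterE => N; exact: cesaro_le.
Qed.

Lemma bounded_seq_Re a : bounded_seq a -> bdd_real (fun n => complex.Re (a n : R[i])).
Proof.
move=> [B hB]; exists (Num.sqrt B) => n; rewrite -sqrtr_sqr ler_wsqrtr //.
by apply: le_trans (hB n); rewrite lerDl sqr_ge0.
Qed.

Lemma bounded_seq_Im a : bounded_seq a -> bdd_real (fun n => complex.Im (a n : R[i])).
Proof.
move=> [B hB]; exists (Num.sqrt B) => n; rewrite -sqrtr_sqr ler_wsqrtr //.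
by apply: le_trans (hB n); rewrite lerDr sqr_ge0.
Qed.

Lemma ex_shift_mean : exists m, @shift_mean R m.
Proof.
have [L [Ll Lc Ls Lle]] := ex_real_mean.
have bN a : bdd_real a -> bdd_real (fun n => - a n).
  by move=> [B hB]; exists B => n; rewrite normrN.
have b0 : bdd_real (fun=> 0) by exists 0 => n; rewrite normr0.
have LZ c a : bdd_real a -> L (fun n => c * a n) = c * L a.
  move=> ba; have := Ll c a (fun=> 0) ba b0; rewrite Lc addr0 => <-.
  by congr L; apply/funext => n; rewrite addr0.
have LD a b : bdd_real a -> bdd_real b -> L (fun n => a n + b n) = L a + L b.
  move=> ba bb; have := Ll 1 a b ba bb; rewrite mul1r => <-.
  by congr L; apply/funext => n; rewrite mul1r.
have bZ c a : bdd_real a -> bdd_real (fun n => c * a n).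
  by move=> [B hB]; exists (`|c| * B) => n; rewrite normrM ler_wpM2l.
have bD a b : bdd_real a -> bdd_real b -> bdd_real (fun n => a n + b n).
  move=> [A hA] [B hB]; exists (A + B) => n.
  by apply: le_trans (ler_normD _ _) _; rewrite lerD.
have LN a : bdd_real a -> L (fun n => - a n) = - L a.
  move=> ba; have := LZ (- 1) a ba; rewrite mulN1r => <-.
  by congr L; apply/funext => n; rewrite mulN1r.
have L3 p q a b e : bdd_real a -> bdd_real b -> bdd_real e ->
    L (fun n => p * a n + q * b n + e n) = p * L a + q * L b + L e.
  by move=> ba bb be; rewrite !LD ?LZ //; do ?apply: bD; do ?apply: bZ.
have Lge a B : bdd_real a -> (forall n, B <= a n) -> B <= L a.
  move=> ba aB; rewrite -lerN2 -LN //; apply: Lle; first exact: bN.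
  by move=> n; rewrite lerN2.
have Lsq a B : (forall n, a n ^+ 2 <= B) -> L a ^+ 2 <= B.
  move=> hB.
  have B0 : 0 <= B by apply: le_trans (hB 0%N); exact: sqr_ge0.
  have hs n : `|a n| <= Num.sqrt B by rewrite -sqrtr_sqr ler_wsqrtr.
  have ba : bdd_real a by exists (Num.sqrt B).
  rewrite -[L a ^+ 2]real_normK ?num_real // -[B in _ <= B]sqr_sqrtr //.
  rewrite ler_sqr ?nnegrE ?sqrtr_ge0 // ler_norml; apply/andP; split.
    by apply: Lge => // n; have := hs n; rewrite ler_norml => /andP[].
  by apply: Lle => // n; have := hs n; rewrite ler_norml => /andP[].
exists (fun a => (L (fun n => complex.Re (a n)) +i* L (fun n => complex.Im (a n)))%C).
split.
- move=> c a b ba bb.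
  have rb := bounded_seq_Re bb; have ib := bounded_seq_Im bb.
  have ra := bounded_seq_Re ba; have ia := bounded_seq_Im ba.
  case: c => c d; rewrite -[LHS]/(_ +i* _)%C.
  have -> : (fun n => complex.Re ((c +i* d)%C * a n + b n)) =
    (fun n => (c * complex.Re (a n) + (- d) * complex.Im (a n)) + complex.Re (b n)).
    by apply/funext => n; case: (a n) => x y; case: (b n) => z t /=; ring.
  have -> : (fun n => complex.Im ((c +i* d)%C * a n + b n)) =
    (fun n => (c * complex.Im (a n) + d * complex.Re (a n)) + complex.Im (b n)).
    by apply/funext => n; case: (a n) => x y; case: (b n) => z t /=; ring.
  rewrite !L3 //; apply/eqP; rewrite eq_complex /=.
  by apply/andP; split; apply/eqP; ring.
- by move=> [c d]; rewrite !Lc.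
- move=> a ba; congr (_ +i* _)%C; apply: (Ls (fun n => _ (a n))).
    exact: bounded_seq_Re.
  exact: bounded_seq_Im.
- move=> a ba; rewrite -[RHS]/(_ +i* _)%C -LN; last exact: bounded_seq_Im.
  by congr (L _ +i* L _)%C; apply/funext => n; case: (a n).
- move=> a ba a0.
  have im0 n : complex.Im (a n) = 0.
    by have := a0 n; case: (a n) => x y; rewrite lecE /= => /andP[/eqP].
  have re0 n : 0 <= complex.Re (a n).
    by have := a0 n; case: (a n) => x y; rewrite lecE /= => /andP[_].
  have -> : (fun n => complex.Im (a n)) = fun=> 0 by apply/funext.
  rewrite Lc lecR; apply: Lge => //; exact: bounded_seq_Re.
move=> a B hB; rewrite /csq /= mulr2n mulrDl mul1r; apply: lerD.
  by apply: Lsq => n; apply: le_trans (hB n); rewrite lerDl sqr_ge0.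
by apply: Lsq => n; apply: le_trans (hB n); rewrite lerDr sqr_ge0.
Qed.

End Mean.

(** * Transfer operators and sums over words *)

Section LetterRep.
Variable I : finType.

(* [lU a] is the action of the letter [a] and [lE a] that of the indicator of the
   cylinder of [a]; [lUE] says that [a] maps the complement of the cylinder of
   [a^-1] onto the cylinder of [a]. *)
Record lrep (X : zmodType) := LRep {
  lU : letter I -> X -> X;
  lE : letter I -> X -> X;
  lUB : forall a x y, lU a (x - y) = lU a x - lU a y;
  lEB : forall a x y, lE a (x - y) = lE a x - lE a y;
  lUK : forall a x, lU (linv a) (lU a x) = x;
  lEE : forall a b x, lE a (lE b x) = if a == b then lE a x else 0;
  lE_sum : forall x, \sum_a lE a x = x;
  lUE : forall a x, lU a (lE (linv a) x) = lU a x - lE a (lU a x) }.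

Lemma linv_eq (a b : letter I) : (linv a == b) = (a == linv b).
Proof. by rewrite -(inj_eq (can_inj (@linvK I))) linvK. Qed.

Variable A : nmodType.

Section Operators.
Variables (X : zmodType) (r : lrep X).
Implicit Types (f k : X -> A) (x u : X) (a b c s d : letter I) (n : nat).

Lemma lU0 a : lU r a 0 = 0.
Proof. by have := lUB r a 0 0; rewrite !subrr. Qed.

Lemma lE0 a : lE r a 0 = 0.
Proof. by have := lEB r a 0 0; rewrite !subrr. Qed.

Lemma lUKr a x : lU r a (lU r (linv a) x) = x.
Proof. by have := lUK r (linv a) x; rewrite linvK. Qed.

Lemma lEU a x : lE r a (lU r a x) = lU r a (x - lE r (linv a) x).
Proof. by rewrite lUB lUE opprB addrC subrK. Qed.

(* The [n]-th iterate of [transfer] at [f] sums [f (U_y^-1 1_y x)] over the reduced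
   words [y] of length [n], where [1_y] is the indicator of the cylinder of [y];
   [branch s] keeps only the words with last letter [s^-1]. *)
Definition branch s f x : A := f (lU r s (lE r (linv s) x)).

Definition transfer f x : A := \sum_b f (lU r (linv b) (lE r b x)).

Lemma transfer_branch f x : transfer f x = \sum_s branch s f x.
Proof.
rewrite /transfer (reindex_inj (can_inj (@linvK I))) /=.
by apply: eq_bigr => s _; rewrite /branch linvK.
Qed.

(** For a sesquilinear form, regarded as a function on pairs, this says that vectors in distinct
    cylinders are orthogonal for the form. *)
Definition block_diagonal f := f 0 = 0 /\ forall x, f x = \sum_b f (lE r b x).

Lemma branch_E s f b x : f 0 = 0 ->
  branch s f (lE r b x) = if b == linv s then branch s f x else 0.
Proof.
move=> f0; rewrite /branch lEE eq_sym; case: eqP => // _.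
by rewrite lU0.
Qed.

Lemma branch_diagonal s f : f 0 = 0 -> block_diagonal (branch s f).
Proof.
move=> f0; split; first by rewrite /branch lE0 lU0.
move=> x; rewrite (bigD1 (linv s)) //= branch_E // eqxx.
by rewrite big1 ?addr0 // => b /negbTE nb; rewrite branch_E // nb.
Qed.

Lemma transfer_E f b x : f 0 = 0 ->
  transfer f (lE r b x) = f (lU r (linv b) (lE r b x)).
Proof.
move=> f0; rewrite /transfer (bigD1 b) //= lEE eqxx.
by rewrite big1 ?addr0 // => c /negbTE nc; rewrite lEE nc lU0.
Qed.

Lemma transfer_diagonal f : f 0 = 0 -> block_diagonal (transfer f).
Proof.
move=> f0; split; first by rewrite /transfer big1 // => b _; rewrite lE0 lU0.
by move=> x; apply: eq_bigr => b _; rewrite transfer_E.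
Qed.

Lemma iter_transfer_diagonal n f : block_diagonal f ->
  block_diagonal (iter n transfer f).
Proof. by move=> df; elim: n => //= n [IH _]; exact: transfer_diagonal. Qed.

Lemma lE_compl s b x : lE r b (x - lE r s x) = if b == s then 0 else lE r b x.
Proof. by rewrite lEB lEE; case: eqP => [->|_]; rewrite ?subrr ?subr0. Qed.

Lemma block_diagonal_compl f s x : block_diagonal f ->
  f (x - lE r s x) = \sum_(b | b != s) f (lE r b x).
Proof.
move=> [f0 fd]; rewrite fd (bigD1 s) //= lE_compl eqxx f0 add0r.
by apply: eq_bigr => b /negbTE nb; rewrite lE_compl nb.
Qed.

(* The sum of [k (U_y u)] over the reduced words [y] of length [n.+1] with first
   letter [s] and last letter [d]. *)
Fixpoint word_sum n s d k u : A :=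
  if n is m.+1 then \sum_(c | c != linv d) word_sum m s c k (lU r d u)
  else if s == d then k (lU r d u) else 0.

(** By [lUE], the indicator of d^-1 followed by the letter [d] is the letter [d] followed by removal
    of the cylinder of [d]. That removal is what forbids d^-1 as the next letter, so the indicators
    in the iterate become the reducedness of the words, and only the removal of the cylinder of [s]
    at the end remains. *)
Lemma iter_transfer_branch n s d f u : f 0 = 0 ->
  iter n transfer (branch s f) (lE r (linv d) u) =
  word_sum n s d (fun x => f (x - lE r s x)) u.
Proof.
move=> f0; have dg m := iter_transfer_diagonal m (branch_diagonal s f0).
elim: n d u => [|n IH] d u /=.
  rewrite branch_E // (inj_eq (can_inj (@linvK I))) eq_sym.
  by case: eqP => [->|//]; rewrite /branch lUE.
rewrite transfer_E ?(dg n).1 // linvK lUE block_diagonal_compl //.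
rewrite (reindex_inj (can_inj (@linvK I))) /=.
by apply: eq_big => [c|c _]; rewrite ?linv_eq ?IH.
Qed.

(** Such an [f] splits over each cylinder and satisfies f (E_b x) = f (U_b^-1 E_b x). This compares
    the part of U_a x in the cylinder of [a] with the part of [x] off the cylinder of a^-1, and the
    rest of U_a x with the part of [x] in that cylinder. *)
Lemma transfer_fixed_U f : f 0 = 0 -> (forall x, f x = transfer f x) ->
  forall a x, f (lU r a x) = f x.
Proof.
move=> f0 ff a x.
have [_ fd] : block_diagonal f.
  by have := transfer_diagonal f0; rewrite (_ : transfer f = f) //; apply/funext.
have split b z : f z = f (lE r b z) + f (z - lE r b z).
  by rewrite block_diagonal_compl // fd (bigD1 b).
have fE b z : f (lE r b z) = f (lU r (linv b) (lE r b z)).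
  by rewrite [LHS]ff transfer_E.
have -> : f (lU r a x) = f (lE r a (lU r a x)) + f (lU r a (lE r (linv a) x)).
  by rewrite lUE -split.
rewrite fE lEU lUK addrC [RHS](split (linv a)); congr (_ + _).
by rewrite [RHS]fE linvK.
Qed.

(** The recursion of [word_sum] peels off the last letter. Peeling off the first one is the same
    recursion for the inverse words, as [word_sum_sym] requires. *)
Lemma word_sum_first n s d k u : word_sum n.+1 s d k u =
  \sum_(c | c != linv s) word_sum n c d (fun x => k (lU r s x)) u.
Proof.
elim: n d u => [|n IH] d u.
  rewrite /= -!big_mkcondr /=; have [e|ne] := eqVneq s (linv d).
    rewrite big_pred0; last first.
      by move=> c; case: (eqVneq s c) => [<-|_]; rewrite ?e ?eqxx ?andbF.
    rewrite big_pred0 // => c.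
    by case: (eqVneq c d) => [->|_]; rewrite ?e ?linvK ?eqxx ?andbF.
  rewrite (big_pred1 s) => [|c]; last first.
    by rewrite /= [s == c]eq_sym; case: (eqVneq c s) => [->|_]; rewrite ?ne ?andbF.
  rewrite (big_pred1 d) // => c /=; case: (eqVneq c d) => [->|_]; rewrite ?andbF //.
  by rewrite andbT eq_sym linv_eq ne.
rewrite [LHS]/= (eq_bigr _ (fun c _ => IH c (lU r d u))) exchange_big /=.
by [].
Qed.

Lemma word_sum_ext (P : X -> Prop) n s d k k' u :
  (forall a x, P x -> P (lU r a x)) -> (forall x, P x -> k x = k' x) ->
  P u -> word_sum n s d k u = word_sum n s d k' u.
Proof.
move=> PU kk; elim: n d u => [|n IH] d u Pu /=.
  by case: eqP => // _; apply/kk/PU.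
by apply: eq_bigr => c _; apply/IH/PU.
Qed.

End Operators.

Section Maps.
Variables (X X' : zmodType) (r : lrep X) (r' : lrep X') (T : X -> X').
Hypothesis TU : forall a x, T (lU r a x) = lU r' a (T x).

Lemma word_sum_map n s d (k : X' -> A) u :
  word_sum r' n s d k (T u) = word_sum r n s d (fun x => k (T x)) u.
Proof.
elim: n d u => [|n IH] d u /=; first by rewrite TU.
by apply: eq_bigr => c _; rewrite -TU.
Qed.

Hypothesis TE : forall a x, T (lE r a x) = lE r' a (T x).

Lemma iter_transfer_map n (f : X' -> A) x :
  iter n (transfer r') f (T x) = iter n (transfer r) (fun y => f (T y)) x.
Proof.
elim: n x => //= n IH x; apply: eq_bigr => b _.
by rewrite -TE -TU IH.
Qed.

End Maps.

End LetterRep.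

Section PairRep.
Variables (I : finType) (X Y : zmodType) (r : lrep I X) (r' : lrep I Y).

Lemma pair_sum (J : finType) (f : J -> X * Y) :
  \sum_j f j = (\sum_j (f j).1, \sum_j (f j).2).
Proof.
by elim/big_rec3: _ => // j x y _ _ ->.
Qed.

(** Letters act diagonally on pairs, so that a sesquilinear form is a function on the product and
    transfer operators act on forms. *)
Program Definition prep : lrep I (X * Y)%type := @LRep I (X * Y)%type
  (fun a x => (lU r a x.1, lU r' a x.2)) (fun a x => (lE r a x.1, lE r' a x.2))
  _ _ _ _ _ _.
Next Obligation. by move=> *; rewrite /= !lUB. Qed.
Next Obligation. by move=> *; rewrite /= !lEB. Qed.
Next Obligation. by move=> a [x y]; rewrite /= !lUK. Qed.
Next Obligation. by move=> a b [x y]; rewrite /= !lEE; case: eqP. Qed.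
Next Obligation. by move=> [x y]; rewrite pair_sum /= !lE_sum. Qed.
Next Obligation. by move=> a [x y]; rewrite /= !lUE. Qed.

End PairRep.

(** * Asymptotic forms of matrix coefficients *)

Record hrep (R : realType) (I : finType) (H : hilbertType R) := HRep {
  hrep_lrep :> lrep I H;
  hU_adj : forall a, adj (lU hrep_lrep a) (lU hrep_lrep (linv a));
  hE_sa : forall a, adj (lE hrep_lrep a) (lE hrep_lrep a) }.

Definition hcomm (R : realType) (I : finType) (H K : hilbertType R)
  (r : hrep I H) (r' : hrep I K) (T : H -> K) :=
  (forall a u, T (lU r a u) = lU r' a (T u)) /\
  (forall a u, T (lE r a u) = lE r' a (T u)).

Definition hirr (R : realType) (I : finType) (H : hilbertType R) (r : hrep I H) :=
  (exists v : H, v <> 0) /\ forall V : set H, closed_subspace V ->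
  (forall a v, V v -> V (lU r a v)) -> (forall a v, V v -> V (lE r a v)) ->
  V = [set 0] \/ V = setT.

Section HilbertRep.
Variables (R : realType) (I : finType) (H : hilbertType R) (r : hrep I H).

Lemma nsq_lU a u : nsq (lU r a u) = nsq u.
Proof. by rewrite /nsq hU_adj lUK. Qed.

Lemma nsq_lE a u : nsq (lE r a u) = complex.Re '[lE r a u, u].
Proof. by rewrite /nsq !hE_sa lEE eqxx. Qed.

Lemma sum_nsq_lE u : \sum_a nsq (lE r a u) = nsq u.
Proof.
have -> : nsq u = complex.Re '[\sum_a lE r a u, u] by rewrite lE_sum.
rewrite hdot_suml raddf_sum /=.
by apply: eq_bigr => a _; exact: nsq_lE.
Qed.

Lemma sum_nsq_transfer u : \sum_a nsq (lU r (linv a) (lE r a u)) = nsq u.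
Proof.
by rewrite -[RHS]sum_nsq_lE; apply: eq_bigr => a _; rewrite nsq_lU.
Qed.

Lemma nsq_lE_le a u : nsq (lE r a u) <= nsq u.
Proof.
rewrite -[X in _ <= X]sum_nsq_lE (bigD1 a) //= lerDl sumr_ge0 // => b _.
exact: nsq_ge0.
Qed.

End HilbertRep.

Lemma schur_hrep (R : realType) (I : finType) (H : hilbertType R) (r : hrep I H)
  (A : H -> H) : hirr r -> adj A A -> bounded_op A -> hcomm r r A ->
  exists c : R, forall v, A v = c%:C%C *: v.
Proof.
move=> [_ irr] AA bA [AU AE].
apply: (@schur_sa _ _ (fun X => exists a, X = lU r a \/ X = lE r a)) => //.
- move=> X [a [->|->]]; first by exists (lU r (linv a)); exact: hU_adj.
  by exists (lE r a); exact: hE_sa.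
- move=> V HV h; apply: irr => // a v Vv; apply: h => //; exists a; by [left|right].
- by move=> X [a [->|->]] v.
Qed.

Lemma schur_form (R : realType) (I : finType) (H : hilbertType R) (r : hrep I H)
  (T S : H -> H) : hirr r -> adj T S -> bounded_op T -> bounded_op S ->
  hcomm r r T -> exists c : R[i], forall v, T v = c *: v.
Proof.
move=> irr TS bT bS [TU TE].
have ST := adj_sym TS.
have SU a u : S (lU r a u) = lU r a (S u).
  by apply: hdot_ext => w; rewrite ST !hU_adj ST TU.
have SE a u : S (lE r a u) = lE r a (S u).
  by apply: hdot_ext => w; rewrite ST !hE_sa ST TE.
have cC (c d : R[i]) : hcomm r r (fun u => c *: T u + d *: S u).
  split=> a u.
    by rewrite TU SU (adj_add (hU_adj r a)) !(adj_scale (hU_adj r a)).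
  by rewrite TE SE (adj_add (hE_sa r a)) !(adj_scale (hE_sa r a)).
have [x hx] := schur_hrep irr (adj_lincomb 1 TS) (bounded_op_lincomb _ _ bT bS) (cC _ _).
have [y hy] := schur_hrep irr (adj_lincomb 'i TS) (bounded_op_lincomb _ _ bT bS) (cC _ _).
(* [x] and [y] are the scalars of the self-adjoint operators T + S and i (T - S), from which [T] is
   recovered. *)
exists (x%:C%C / 2 + y%:C%C / (2 * 'i)) => v.
have i0 : 'i != 0 :> R[i] by rewrite neq0Ci.
apply: hdot_ext => w.
have := congr1 (hdot^~ w) (hx v); have := congr1 (hdot^~ w) (hy v).
rewrite /= !hdotDl !hdotZl conjCi rmorph1 => h1 h2.
rewrite mulrDl mulrAC [X in _ = _ + X]mulrAC -h1 -h2; field.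
exact: i0.
Qed.

Section Kernel.
Variables (R : realType) (I : finType) (H K : hilbertType R).
Variables (r : hrep I H) (r' : hrep I K).
Implicit Types (e w : (H * K)%type).

(** At (y u, y u') this is the matrix coefficient <y u, e.1> times the conjugate of <y u', e.2>. The
    hermitian symmetry [kernC] exchanges the two pairs. *)
Definition kern e w : R[i] := '[w.1, e.1] * '[e.2, w.2].

Lemma kernC e w : (kern e w)^* = kern w e.
Proof. by rewrite /kern rmorphM /= -!hdotC. Qed.

Lemma kern0 e : kern e 0 = 0.
Proof. by rewrite /kern /= hdot0l mul0r. Qed.

Lemma kern_lU a e w : kern e (lU (prep r r') a w) = kern (lU (prep r r') (linv a) e) w.
Proof. by rewrite /kern /= !hU_adj linvK. Qed.

(** Inversion turns first letter [s] and last letter [d] into d^-1 and s^-1; unitarity moves the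
    word to the other pair, and conjugation exchanges the pairs in [kern]. *)
Lemma word_sum_sym n s d e v :
  (word_sum (prep r r') n s d (kern e) v)^* =
  word_sum (prep r r') n (linv d) (linv s) (kern v) e.
Proof.
elim: n d v => [|n IH] d v.
  rewrite /= (inj_eq (can_inj (@linvK I))) eq_sym; case: eqP => [->|_].
    by rewrite kernC [in RHS]kern_lU linvK.
  by rewrite conjC0.
rewrite [RHS]word_sum_first /= rmorph_sum.
rewrite (reindex_inj (can_inj (@linvK I))) /=.
apply: eq_big => [c|c _]; first by rewrite (inj_eq (can_inj (@linvK I))) linvK.
rewrite IH linvK; apply: (word_sum_ext (P := fun=> True)) => // x _.
by rewrite kern_lU linvK.
Qed.

End Kernel.

Section Duality.
Variables (R : realType) (I : finType) (H K H' K' : hilbertType R).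
Variables (r1 : hrep I H) (r2 : hrep I K) (r1' : hrep I H') (r2' : hrep I K').
Variables (T : H -> H') (S : H' -> H) (T2 : K -> K') (S2 : K' -> K).
Hypothesis TS : adj T S.
Hypothesis TS2 : adj T2 S2.
Hypothesis TU : forall a u, T (lU r1 a u) = lU r1' a (T u).
Hypothesis TU2 : forall a u, T2 (lU r2 a u) = lU r2' a (T2 u).

(* Both sides run over the coefficients at the reduced words of length [n.+1] with
   prescribed first and last letters; passing from one side to the other inverts
   the words. *)
Lemma transfer_duality n s t (e : (H' * K')%type) (u : (H * K)%type) :
  lE (prep r1' r2') s e = 0 -> lE (prep r1 r2) t u = 0 ->
  iter n (transfer (prep r1' r2')) (branch (prep r1' r2') s (kern e))
    (lE (prep r1' r2') t (T u.1, T2 u.2)) =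
  (iter n (transfer (prep r1 r2)) (branch (prep r1 r2) t (kern u))
    (lE (prep r1 r2) s (S e.1, S2 e.2)))^*.
Proof.
move=> es ut.
have kE (A B : hilbertType R) (p : hrep I A) (q : hrep I B) (b : letter I) f x :
    lE (prep p q) b f = 0 -> kern f (x - lE (prep p q) b x) = kern f x.
  move=> fb; have [f1 f2] : lE p b f.1 = 0 /\ lE q b f.2 = 0 by case: fb.
  by rewrite /kern /= hdotBl hdotBr (hE_sa p) -(hE_sa q) f1 f2 hdot0r hdot0l !subr0.
have TTU a x : (fun y : H * K => (T y.1, T2 y.2)) (lU (prep r1 r2) a x) =
    lU (prep r1' r2') a (T x.1, T2 x.2) by rewrite /= TU TU2.
have kT f x : kern f (T x.1, T2 x.2) = kern (S f.1, S2 f.2) x.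
  by rewrite /kern /= TS -(adj_sym TS2).
rewrite -[t in LHS]linvK iter_transfer_branch ?kern0 //.
rewrite -[s in RHS]linvK iter_transfer_branch ?kern0 //.
rewrite (word_sum_map TTU).
rewrite (@word_sum_ext _ _ _ _ (fun=> True) n s (linv t) _
  (kern (S e.1, S2 e.2))) // => [|x _]; last by rewrite -kT kE.
rewrite [in RHS](@word_sum_ext _ _ _ _ (fun=> True) n t (linv s) _ (kern u))
  // => [|x _]; last by rewrite kE.
by rewrite word_sum_sym linvK.
Qed.

End Duality.

Section InvariantForm.
Variables (R : realType) (m : (nat -> R[i]) -> R[i]).
Hypothesis hm : shift_mean m.

Lemma bounded_seqD (a b : nat -> R[i]) : bounded_seq a -> bounded_seq b ->
  bounded_seq (fun n => a n + b n).
Proof.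
move=> [A hA] [B hB]; exists (2 * A + 2 * B) => n.
apply: le_trans (csqD_le _ _) _; have := hA n; have := hB n; lra.
Qed.

Lemma bounded_seqZ (c : R[i]) a : bounded_seq a -> bounded_seq (fun n => c * a n).
Proof.
by move=> [A hA]; exists (csq c * A) => n; rewrite csqM ler_wpM2l ?csq_ge0.
Qed.

Lemma bounded_seq_cst (c : R[i]) : bounded_seq (fun=> c).
Proof. by exists (csq c). Qed.

Lemma mean0 : m (fun=> 0) = 0. Proof. exact: mean_cst. Qed.

Lemma meanD a b : bounded_seq a -> bounded_seq b ->
  m (fun n => a n + b n) = m a + m b.
Proof.
move=> ba bb; rewrite -[m a]mul1r -mean_lin //; congr m.
by apply/funext => n; rewrite mul1r.
Qed.

Lemma mean_sum (J : Type) (l : seq J) (a : J -> nat -> R[i]) :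
  (forall j, bounded_seq (a j)) ->
  bounded_seq (fun n => \sum_(j <- l) a j n) /\
  m (fun n => \sum_(j <- l) a j n) = \sum_(j <- l) m (a j).
Proof.
move=> ba; elim: l => [|j l [bl ml]].
  have -> : (fun n => \sum_(j <- [::]) a j n) = fun=> 0.
    by apply/funext => n; rewrite big_nil.
  by split; [exact: bounded_seq_cst|rewrite mean0 big_nil].
have -> : (fun n => \sum_(i <- j :: l) a i n) =
          (fun n => a j n + \sum_(i <- l) a i n).
  by apply/funext => n; rewrite big_cons.
by split; [exact: bounded_seqD|rewrite meanD // ml big_cons].
Qed.

Section General.
Variables (I : finType) (X : zmodType) (r : lrep I X) (q : X -> R).
Hypothesis qr : forall x, \sum_b q (lU r (linv b) (lE r b x)) = q x.

Definition form_le (f : X -> R[i]) (C : R) := forall x, `|f x| <= (C * q x)%:C%C.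

(** As [q] is fixed by the transfer operator ([qr]), the constant survives every iteration, which
    makes the sequences of iterates bounded and admissible for the mean. *)
Lemma transfer_le f C : form_le f C -> form_le (transfer r f) C.
Proof.
move=> hf x; apply: le_trans (ler_norm_sum _ _ _) _.
rewrite -(qr x) mulr_sumr rmorph_sum /=; apply: ler_sum => b _; exact: hf.
Qed.

Lemma iter_transfer_le n f C : form_le f C -> form_le (iter n (transfer r) f) C.
Proof. by move=> hf; elim: n => //= n; exact: transfer_le. Qed.

Lemma form_le_csq f C x : 0 <= C * q x -> form_le f C -> csq (f x) <= (C * q x) ^+ 2.
Proof.
move=> p0 /(_ x) hf; rewrite -(@lecR R) csqE -normCK rmorphXn /=.
by rewrite ler_sqr ?nnegrE ?normr_ge0 // lecR.
Qed.

Definition mean_form f x := m (fun n => iter n (transfer r) f x).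

Lemma form_le_bounded f C x : 0 <= C * q x -> form_le f C ->
  bounded_seq (fun n => iter n (transfer r) f x).
Proof.
by move=> p0 hf; exists ((C * q x) ^+ 2) => n; exact/form_le_csq/iter_transfer_le.
Qed.

Hypothesis q0 : forall x, 0 <= q x.

Lemma mean_form_fixed f C : 0 <= C -> form_le f C -> f 0 = 0 ->
  mean_form f 0 = 0 /\ forall x, mean_form f x = transfer r (mean_form f) x.
Proof.
move=> C0 hf f0; have bf x := form_le_bounded (mulr_ge0 C0 (q0 x)) hf.
have F0 n : iter n (transfer r) f 0 = 0.
  by elim: n => //= n IH; rewrite /transfer big1 // => b _; rewrite lE0 lU0.
split=> [|x]; first by rewrite /mean_form -mean0; congr m; apply/funext.
(* The shifted sequence has one more transfer on the outside, a finite sum that commutes with the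
   mean. *)
rewrite /mean_form -(mean_shift hm (bf x)) /transfer.
by rewrite -(mean_sum _ _).2.
Qed.

End General.
End InvariantForm.

Section PairForm.
Variables (R : realType) (m : (nat -> R[i]) -> R[i]).
Hypothesis hm : shift_mean m.
Variables (I : finType) (H K : hilbertType R) (r : hrep I H) (r' : hrep I K).
Implicit Types (f : (H * K)%type -> R[i]) (e w : (H * K)%type).

Definition qpair w : R := nsq w.1 + nsq w.2.

Lemma qpair_ge0 w : 0 <= qpair w.
Proof. by rewrite addr_ge0 ?nsq_ge0. Qed.

Lemma sum_qpair w :
  \sum_b qpair (lU (prep r r') (linv b) (lE (prep r r') b w)) = qpair w.
Proof. by rewrite big_split /= !sum_nsq_transfer. Qed.

Definition sesquilinear f :=
  (forall c u v z, f (c *: u + v, z) = c * f (u, z) + f (v, z)) /\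
  (forall c u v z, f (z, c *: u + v) = c^* * f (z, u) + f (z, v)).

Lemma sesquilinear0 f : sesquilinear f ->
  (forall z, f (0, z) = 0) /\ (forall z, f (z, 0) = 0).
Proof.
move=> [fl fr]; split=> z.
  by have := fl (- 1) 0 0 z; rewrite scaler0 addr0 mulN1r addNr.
by have := fr (- 1) 0 0 z; rewrite scaler0 addr0 rmorphN rmorph1 mulN1r addNr.
Qed.

Lemma kern_sesquilinear e : sesquilinear (kern e).
Proof.
split=> c u v z; rewrite /kern /=.
  by rewrite hdotDl hdotZl mulrDl mulrA.
by rewrite hdotDr hdotZr mulrDr mulrCA.
Qed.

Lemma branch_sesquilinear s f : sesquilinear f -> sesquilinear (branch (prep r r') s f).
Proof.
move=> [fl fr]; split=> c u v z; rewrite /branch /=.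
  by rewrite (adj_lin (hE_sa r _)) (adj_lin (hU_adj r _)) fl.
by rewrite (adj_lin (hE_sa r' _)) (adj_lin (hU_adj r' _)) fr.
Qed.

Lemma transfer_sesquilinear f : sesquilinear f -> sesquilinear (transfer (prep r r') f).
Proof.
move=> sf; split=> c u v z; rewrite !transfer_branch mulr_sumr -big_split /=;
  by apply: eq_bigr => s _; have [l e] := branch_sesquilinear s sf; rewrite ?l ?e.
Qed.

Lemma iter_sesquilinear n f : sesquilinear f ->
  sesquilinear (iter n (transfer (prep r r')) f).
Proof. by move=> sf; elim: n => //= n; exact: transfer_sesquilinear. Qed.

Lemma kern_le e : form_le qpair (kern e) (qpair e).
Proof.
move=> w; rewrite -(@ler_pXn2r _ 2) ?nnegrE ?normr_ge0 //; last first.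
  by rewrite lecR mulr_ge0 ?qpair_ge0.
rewrite normCK -csqE -rmorphXn lecR /kern csqM.
apply: le_trans (ler_pM (csq_ge0 _) (csq_ge0 _) (CauchySchwarz_csq _ _)
  (CauchySchwarz_csq _ _)) _.
rewrite /qpair; have := nsq_ge0 w.1; have := nsq_ge0 w.2.
have := nsq_ge0 e.1; have := nsq_ge0 e.2.
move: (nsq w.1) (nsq w.2) (nsq e.1) (nsq e.2) => a b c d d0 c0 b0 a0.
have h1 : a * b <= (a + b) ^+ 2 by nra.
have h2 : c * d <= (c + d) ^+ 2 by nra.
have := ler_pM (mulr_ge0 a0 b0) (mulr_ge0 c0 d0) h1 h2.
by rewrite exprMn [X in _ -> _ <= X]mulrC; apply: le_trans; rewrite le_eqVlt; apply/orP; left; apply/eqP; ring.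
Qed.

Lemma branch_le s f C : 0 <= C -> form_le qpair f C ->
  form_le qpair (branch (prep r r') s f) C.
Proof.
move=> C0 hf w; apply: le_trans (hf _) _; rewrite lecR ler_wpM2l //.
rewrite -[X in _ <= X]sum_qpair (bigD1 (linv s)) //= linvK lerDl.
by rewrite sumr_ge0 // => b _; exact: qpair_ge0.
Qed.

(** The form is fixed by the transfer operator, hence block diagonal and invariant under the
    letters. For the operator [T] that represents it, these are commutation with the indicators and
    with the group. *)
Lemma mean_form_op f C : 0 <= C -> sesquilinear f -> form_le qpair f C ->
  exists T S, [/\ adj T S, bounded_op T, bounded_op S, hcomm r r' T &
    forall w, mean_form m (prep r r') f w = '[T w.1, w.2]].
Proof.
move=> C0 sf hf; pose M := mean_form m (prep r r') f.
have bf w := form_le_bounded sum_qpair (mulr_ge0 C0 (qpair_ge0 w)) hf.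
have f0 : f 0 = 0 by have [->] := sesquilinear0 sf.
have [M0 MT] := mean_form_fixed hm sum_qpair qpair_ge0 C0 hf f0.
rewrite -/M in M0 MT.
have sM : sesquilinear M.
  split=> c u v z; rewrite /M /mean_form -mean_lin //; congr m; apply/funext => n.
    by have [-> _] := iter_sesquilinear n sf.
  by have [_ ->] := iter_sesquilinear n sf.
have [M0l M0r] := sesquilinear0 sM.
have Mb w : csq (M w) <= 2 * (C * qpair w) ^+ 2.
  apply: mean_bound => // n; apply: (@form_le_csq _ _ qpair).
    by rewrite mulr_ge0 ?qpair_ge0.
  exact: (iter_transfer_le sum_qpair).
have [_ Md] : block_diagonal (prep r r') M.
  have := transfer_diagonal (prep r r') M0.
  by rewrite (_ : transfer _ M = M) //; apply/funext => w; rewrite -MT.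
have ME a u v : M (lE r a u, v) = M (u, lE r' a v).
  rewrite (Md (lE r a u, v)) (Md (u, lE r' a v)); apply: eq_bigr => b _ /=.
  by rewrite !lEE; case: eqP => // _; rewrite M0l M0r.
have MU := transfer_fixed_U M0 MT.
have [Ml Mr] := sM.
have [||T [S [TS bT bS MTS]]] := @form_op _ _ _ (fun u v => M (u, v)) Ml Mr (2 * C ^+ 2).
- by rewrite mulr_ge0 ?sqr_ge0.
- by move=> u v; apply: le_trans (Mb _) _; rewrite exprMn mulrA.
exists T, S; split=> //; last by move=> [u v]; rewrite -MTS.
split=> a u; apply: hdot_ext => v.
  by rewrite (hU_adj r') -!MTS -[RHS](MU a) /= lUKr.
by rewrite (hE_sa r') -!MTS ME.
Qed.

End PairForm.

Section MeanDuality.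
Variables (R : realType) (m : (nat -> R[i]) -> R[i]).
Hypothesis hm : shift_mean m.
Variables (I : finType) (H K H' K' : hilbertType R).
Variables (r1 : hrep I H) (r2 : hrep I K) (r1' : hrep I H') (r2' : hrep I K').
Variables (T : H -> H') (S : H' -> H) (T2 : K -> K') (S2 : K' -> K).
Hypothesis TS : adj T S.
Hypothesis TS2 : adj T2 S2.
Hypothesis TU : forall a u, T (lU r1 a u) = lU r1' a (T u).
Hypothesis TU2 : forall a u, T2 (lU r2 a u) = lU r2' a (T2 u).

Lemma mean_duality s t e1 e2 u1 u2 :
  lE r1' s e1 = 0 -> lE r2' s e2 = 0 -> lE r1 t u1 = 0 -> lE r2 t u2 = 0 ->
  mean_form m (prep r1' r2') (branch (prep r1' r2') s (kern (e1, e2)))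
    (lE r1' t (T u1), lE r2' t (T2 u2)) =
  (mean_form m (prep r1 r2) (branch (prep r1 r2) t (kern (u1, u2)))
    (lE r1 s (S e1), lE r2 s (S2 e2)))^*.
Proof.
move=> e1s e2s u1t u2t; rewrite /mean_form -(mean_conj hm).
  congr m; apply/funext => n.
  apply: (transfer_duality TS TS2 TU TU2 n (e := (e1, e2)) (u := (u1, u2))).
    by rewrite /= e1s e2s.
  by rewrite /= u1t u2t.
apply: (@form_le_bounded _ _ _ _ (@qpair R H K) (@sum_qpair _ _ _ _ r1 r2) _
  (qpair (u1, u2))).
- by rewrite mulr_ge0 ?qpair_ge0.
- by apply: branch_le; [exact: qpair_ge0|exact: kern_le].
Qed.

End MeanDuality.

(** * Hilbert-Schmidt operators *)

Section Parseval.
Variables (R : realType) (H : hilbertType R).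
Implicit Types (u v w z : H) (B : set H) (F : seq H).

Definition orthonormal_seq B F := uniq F /\ forall e, e \in F -> B e.

Section Basis.
Variable B : set H.
Hypothesis HB : orthonormal_basis B.

Definition fourier F z := \sum_(e <- F) '[z, e] *: e.

Lemma fourier_dot F z a : orthonormal_seq B F -> a \in F ->
  '[fourier F z, a] = '[z, a].
Proof.
move=> [uF FB] aF; have [B1 [B0 _]] := HB.
rewrite hdot_suml (bigD1_seq a) //= hdotZl B1 ?mulr1; last exact: FB.
rewrite big_seq_cond big1 ?addr0 // => e /andP[eF /eqP ea].
by rewrite hdotZl (B0 _ _ (FB _ eF) (FB _ aF) ea) mulr0.
Qed.

Lemma nsq_fourier F z : orthonormal_seq B F ->
  nsq (z - fourier F z) = nsq z - \sum_(e <- F) csq '[z, e].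
Proof.
move=> oF.
have h : '[z - fourier F z, fourier F z] = 0.
  rewrite {2}/fourier hdot_sumr big_seq_cond big1 // => e /andP[eF _].
  by rewrite hdotZr hdotBl fourier_dot // subrr mulr0.
rewrite /nsq hdotBr h subr0 hdotBl raddfB /=; congr (_ - _).
rewrite hdot_suml raddf_sum /=; apply: eq_bigr => e _.
by rewrite hdotZl (hdotC e) -csqE.
Qed.

Lemma bessel F z : orthonormal_seq B F -> \sum_(e <- F) csq '[z, e] <= nsq z.
Proof. by move=> oF; rewrite -subr_ge0 -nsq_fourier // nsq_ge0. Qed.

Lemma orthonormal_seq_undup F : (forall e, e \in F -> B e) ->
  orthonormal_seq B (undup F).
Proof. by move=> FB; split; [exact: undup_uniq|move=> e; rewrite mem_undup; exact: FB]. Qed.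

Lemma csq_sum_sub F F' z : orthonormal_seq B F -> orthonormal_seq B F' ->
  {subset F <= F'} -> \sum_(e <- F) csq '[z, e] <= \sum_(e <- F') csq '[z, e].
Proof.
move=> [uF _] [uF' _] FF'.
have P : perm_eq [seq e <- F' | e \in F] F.
  apply: uniq_perm => //; first exact: filter_uniq.
  by move=> e; rewrite mem_filter; case: (boolP (e \in F)) => // /FF' ->.
rewrite [X in _ <= X](bigID (mem F)) /= -[X in _ <= X + _]big_filter.
rewrite (perm_big _ P) /=.
by rewrite lerDl sumr_ge0 // => e _; exact: csq_ge0.
Qed.

Lemma parseval z (d : R) : 0 < d -> exists2 F0, orthonormal_seq B F0 &
  forall F, orthonormal_seq B F -> {subset F0 <= F} ->
  nsq z <= \sum_(e <- F) csq '[z, e] + d.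
Proof.
move=> d0; have [_ [_ cl]] := HB.
have : closure (linear_span B) z by rewrite cl.
move=> /closure_nsq/(_ d d0)[_ [n [c [a [aB ->]]]] hz].
pose F0 := undup [seq a i | i : 'I_n].
have oF0 : orthonormal_seq B F0.
  by apply: orthonormal_seq_undup => e /mapP[i _ ->].
exists F0 => // F oF F0F; apply: le_trans (_ : _ <= \sum_(e <- F0) csq '[z, e] + d) _; last first.
  by rewrite lerD2r csq_sum_sub.
rewrite -lerBlDl -nsq_fourier //; apply: le_trans (ltW hz).
set p := fourier F0 z; set y := \sum_(i < n) _.
have -> : z - y = (z - p) + (p - y) by rewrite addrA subrK.
rewrite [X in _ <= X]nsqD.
(* The Fourier sum [p] is the best approximation of [z] in the span of [F0], which contains [y]. *)
have -> : '[z - p, p - y] = 0.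
  have h i : i \in F0 -> '[z - p, i] = 0.
    by move=> iF; rewrite hdotBl fourier_dot // subrr.
  rewrite hdotBr {2}/p /fourier !hdot_sumr.
  rewrite big_seq_cond big1 ?sub0r => [|e /andP[eF _]]; last by rewrite hdotZr h ?mulr0.
  rewrite big1 ?oppr0 // => i _; rewrite hdotZr h ?mulr0 //.
  by rewrite mem_undup map_f // mem_enum.
by rewrite mulr0 addr0 lerDl nsq_ge0.
Qed.

Lemma parseval_list (l : seq H) (d : R) : 0 < d -> exists2 F0, orthonormal_seq B F0 &
  forall F, orthonormal_seq B F -> {subset F0 <= F} ->
  \sum_(z <- l) nsq z <= \sum_(z <- l) \sum_(e <- F) csq '[z, e] + d.
Proof.
elim: l d => [|z l IH] d d0.
  exists [::] => [|F _ _]; first by split.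
  by rewrite !big_nil add0r ltW.
have d2 : 0 < d / 2 by rewrite divr_gt0.
have [F1 oF1 h1] := parseval z d2; have [F2 oF2 h2] := IH _ d2.
exists (undup (F1 ++ F2)).
  apply: orthonormal_seq_undup => e; rewrite mem_cat.
  by move=> /orP[]; [case: oF1 => _|case: oF2 => _]; apply.
move=> F oF sF; rewrite !big_cons.
have s1 : {subset F1 <= F} by move=> e eF; apply: sF; rewrite mem_undup mem_cat eF.
have s2 : {subset F2 <= F}.
  by move=> e eF; apply: sF; rewrite mem_undup mem_cat eF orbT.
have := h1 _ oF s1; have := h2 _ oF s2; lra.
Qed.

End Basis.

(** Finiteness of the infimum [hs_norm] provides one basis with a common bound for the finite
    partial sums; [hs_adj] passes this to the adjoint with the same basis and bound. *)
Definition hilbert_schmidt (K : H -> H) := exists2 B, orthonormal_basis B &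
  exists s : R, forall F, orthonormal_seq B F -> \sum_(e <- F) nsq (K e) <= s.

Section Tail.
Variables (K K' : H -> H) (B : set H).
Hypotheses (KK' : adj K K') (HB : orthonormal_basis B).

(** Expand |K' y|^2 in the basis, with coefficients <y, K e>, and sum over [y] first. The vectors of
    [F0] are kept; each other [e] costs at most b |K e|^2 by the Bessel inequality of [l], in total
    at most b d. *)
Lemma hs_tail_bound (F0 : seq H) (d b : R) (l : seq H) :
  orthonormal_seq B F0 -> 0 <= b ->
  (forall F, orthonormal_seq B (F0 ++ F) -> \sum_(e <- F) nsq (K e) <= d) ->
  (forall w, \sum_(y <- l) csq '[y, w] <= b * nsq w) ->
  \sum_(y <- l) nsq (K' y) <=
    \sum_(e <- F0) \sum_(y <- l) csq '[y, K e] + b * d.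
Proof.
move=> oF0 b0 hd hb; apply/ler_addgt0Pr => x x0.
have [F1 oF1] := parseval_list HB [seq K' y | y <- l] x0.
pose F := F0 ++ [seq e <- F1 | e \notin F0].
have oF : orthonormal_seq B F.
  split.
    rewrite cat_uniq oF0.1 filter_uniq ?oF1.1 // andbT; apply/hasPn => e.
    by rewrite mem_filter => /andP[].
  by move=> e; rewrite mem_cat mem_filter => /orP[/oF0.2|/andP[_ /oF1.2]].
move=> /(_ F oF) h; have {}h := h _.
have sF : {subset F1 <= F}.
  by move=> e eF; rewrite mem_cat mem_filter eF andbT orbN.
move: (h sF); rewrite !big_map => {}h; apply: le_trans h _; rewrite lerD2r.
rewrite exchange_big /= big_cat /=.
have E e : \sum_(y <- l) csq '[K' y, e] = \sum_(y <- l) csq '[y, K e].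
  by apply: eq_bigr => y _; rewrite (adj_sym KK').
rewrite (eq_bigr _ (fun e _ => E e)) lerD2l.
apply: le_trans (_ : \sum_(e <- [seq e <- F1 | e \notin F0]) b * nsq (K e) <= _).
  by apply: ler_sum => e _; rewrite E; exact: hb.
by rewrite -mulr_sumr ler_wpM2l // hd.
Qed.

Lemma hs_adj (s : R) :
  (forall F, orthonormal_seq B F -> \sum_(e <- F) nsq (K e) <= s) ->
  forall F, orthonormal_seq B F -> \sum_(e <- F) nsq (K' e) <= s.
Proof.
move=> hs F oF; have o0 : orthonormal_seq B [::] by split.
have h w : \sum_(y <- F) csq '[y, w] <= 1 * nsq w.
  rewrite mul1r; under eq_bigr => e _ do rewrite hdotC csqJ.
  by have := bessel HB w oF.
(* The head is empty, and [l] is the orthonormal list [F] itself, whose Bessel constant is 1. *)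
have := hs_tail_bound o0 ler01 (fun F' => hs F') h.
by rewrite big_nil add0r mul1r.
Qed.

Lemma hs_tail (s : R) :
  (forall F, orthonormal_seq B F -> \sum_(e <- F) nsq (K e) <= s) ->
  forall d : R, 0 < d -> exists2 F0, orthonormal_seq B F0 &
  forall F, orthonormal_seq B (F0 ++ F) -> \sum_(e <- F) nsq (K e) <= d.
Proof.
move=> hs d d0; pose D := [set x | exists2 F, orthonormal_seq B F &
  x = \sum_(e <- F) nsq (K e)].
have hD : has_sup D.
  split; first by exists 0, [::]; [split|rewrite big_nil].
  by exists s => _ [F oF ->]; exact: hs.
have [_ [F0 oF0 ->] hF0] := sup_adherent d0 hD.
exists F0 => // F oF.
have : \sum_(e <- F0 ++ F) nsq (K e) <= sup D.
  by apply: ub_le_sup; [case: hD|exists (F0 ++ F)].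
rewrite big_cat /=; move: hF0; lra.
Qed.

End Tail.

Lemma hilbert_schmidt_adj K K' : adj K K' -> hilbert_schmidt K -> hilbert_schmidt K'.
Proof. by move=> KK' [B HB [s hs]]; exists B => //; exists s; have h := hs_adj KK' HB hs. Qed.

End Parseval.

(** One list serves for all [k]: in [state_vanish] it carries both the squared norms and the
    coefficient sums that bound them. *)
Lemma word_sum_list (I : finType) (A : nmodType) (X : zmodType) (r : lrep I X) n s d u :
  exists l : seq X, forall k : X -> A, word_sum r n s d k u = \sum_(y <- l) k y.
Proof.
elim: n d u => [|n IH] d u /=.
  by case: eqP => _; [exists [:: lU r d u] => k; rewrite big_seq1|
                      exists [::] => k; rewrite big_nil].
have /choice[l hl] c := IH c (lU r d u).
exists (flatten [seq l c | c <- enum {: letter I} & c != linv d]) => k.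
rewrite big_flatten /= big_map big_filter big_enum_cond /=.
by apply: eq_bigr => c _; rewrite hl.
Qed.

Lemma iter_transfer_sum (I : finType) (A : nmodType) (X : zmodType) (r : lrep I X)
  (J : finType) n (f : J -> X -> A) x :
  iter n (transfer r) (fun y => \sum_j f j y) x = \sum_j iter n (transfer r) (f j) x.
Proof.
elim: n x => //= n IH x; rewrite /transfer exchange_big /=.
by apply: eq_bigr => b _; exact: IH.
Qed.

(** * The commutant of the group *)

Lemma mean_le (R : realType) (m : (nat -> R[i]) -> R[i]) (hm : shift_mean m) a b :
  bounded_seq a -> bounded_seq b -> (forall n, a n <= b n) -> m a <= m b.
Proof.
move=> ba bb ab; rewrite -subr_ge0 addrC -mulN1r -mean_lin //.
apply: mean_ge0 => // [|n]; last by rewrite mulN1r addrC subr_ge0.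
by apply: bounded_seqD => //; exact: bounded_seqZ.
Qed.

Section Commutant.
Variables (R : realType) (m : (nat -> R[i]) -> R[i]).
Hypothesis hm : shift_mean m.
Variables (I : finType) (H : hilbertType R) (r : hrep I H).
Hypothesis irr : hirr r.
Implicit Types (u v w e : H) (s t a : letter I) (T S Q : H -> H).

Lemma ex_coef : exists c : letter I -> H -> H -> R[i], forall s e e' w w',
  mean_form m (prep r r) (branch (prep r r) s (kern (e, e'))) (w, w') =
  c s e e' * '[w, w'].
Proof.
have h (x : letter I * (H * H)) : exists c : R[i], forall w w',
    mean_form m (prep r r) (branch (prep r r) x.1 (kern x.2)) (w, w') = c * '[w, w'].
  have [T [S [TS bT bS TC hT]]] := @mean_form_op _ _ hm _ _ _ r r _ _
    (qpair_ge0 x.2) (branch_sesquilinear r r x.1 (kern_sesquilinear x.2))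
    (branch_le r r x.1 (qpair_ge0 x.2) (kern_le x.2)).
  have [c hc] := schur_form irr TS bT bS TC.
  by exists c => w w'; rewrite hT /= hc hdotZl.
have [c hc] := choice h.
by exists (fun s e e' => c (s, (e, e'))) => s e e' w w'; rewrite -hc.
Qed.

Definition lcomm T := forall a u, T (lU r a u) = lU r a (T u).

(** In blocks, the hypothesis is E_a T (1 - E_a) = 0; as [T] and E_a are self-adjoint, the opposite
    corner vanishes too. *)
Lemma offdiag_commute T : adj T T ->
  (forall a u, lE r a u = 0 -> lE r a (T u) = 0) ->
  forall a u, T (lE r a u) = lE r a (T u).
Proof.
move=> TT h a u.
have h1 v : lE r a (T v) = lE r a (T (lE r a v)).
  rewrite -[in LHS](subrK (lE r a v) v) (adj_add TT) (adj_add (hE_sa r a)).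
  by rewrite h ?add0r // lEB lEE eqxx subrr.
rewrite h1; apply: hdot_ext => v.
by rewrite TT (hE_sa r) h1 -(hE_sa r) -TT (hE_sa r).
Qed.

Variable P : H -> H.
Hypotheses (PP : adj P P) (PI : forall u, P (P u) = P u) (PU : lcomm P).
Hypotheses (P0 : exists u, P u <> 0) (P1 : exists u, P u <> u).

Lemma projection_contr u : nsq (P u) <= nsq u.
Proof.
have -> : nsq u = nsq (P u) + nsq (u - P u).
  have {1}-> : u = P u + (u - P u) by rewrite addrC subrK.
  by rewrite nsqD PP (adj_sub PP) PI subrr hdot0r mulr0 addr0.
by rewrite lerDl nsq_ge0.
Qed.

(** Otherwise [P] would commute with the indicators by [offdiag_commute], and its kernel would be a
    proper nonzero invariant subspace. *)
Lemma offdiag_projection : exists a u, lE r a u = 0 /\ lE r a (P u) <> 0.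
Proof.
apply: contrapT => /forallNP h.
have PE : forall a u, P (lE r a u) = lE r a (P u).
  apply: (offdiag_commute PP) => a u au; apply: contrapT => n.
  by apply: (h a); exists u.
have bP : bounded_op P by exists 1 => // u; rewrite mul1r projection_contr.
have [_ iV] := irr; have [||e|e] := iV _ (adj_bounded_closed PP bP).
- by move=> a v /= Pv; rewrite PU Pv (adj_0 (hU_adj r a)).
- by move=> a v /= Pv; rewrite PE Pv (adj_0 (hE_sa r a)).
- have [u nu] := P1; apply: nu; apply/eqP; rewrite eq_sym -subr_eq0; apply/eqP.
  have : [set u | P u = 0] (u - P u) by rewrite /= (adj_sub PP) PI subrr.
  by rewrite e.
have [u nu] := P0; apply: nu.
by have : [set: H] u by []; rewrite -e.
Qed.

Variable c : letter I -> H -> H -> R[i].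
Hypothesis hc : forall s e e' w w',
  mean_form m (prep r r) (branch (prep r r) s (kern (e, e'))) (w, w') =
  c s e e' * '[w, w'].

Lemma coef_duality T S T' S' s t e e' u u' : adj T S -> adj T' S' ->
  lcomm T -> lcomm T' ->
  lE r s e = 0 -> lE r s e' = 0 -> lE r t u = 0 -> lE r t u' = 0 ->
  c s e e' * '[lE r t (T u), lE r t (T' u')] =
  (c t u u' * '[lE r s (S e), lE r s (S' e')])^*.
Proof.
move=> TS TS' TU TU' se se' tu tu'.
rewrite -!hc; exact: (mean_duality hm TS TS' TU TU').
Qed.

(* By duality [<E_t X u, E_t Y u'> = k X Y * conj (c_t(u, u'))] for [u], [u'] off the
   cylinder of [t], where [k] is a hermitian form on the commutant which vanishes at
   [(X, X)] only if [X] commutes with the indicators. After subtracting a multiple of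
   [P] one may assume [k T P = 0]. Then the blocks [T_tb], [P_tb] of [T] and [P]
   satisfy [T_tb P_tb^* = 0], which is incompatible with [k T T] and [k P P] being
   both nonzero. *)
Lemma commutant_of_coef s e T : lE r s e = 0 -> c s e e <> 0 ->
  adj T T -> bounded_op T -> lcomm T ->
  exists l mu : R, forall v, T v = l%:C%C *: P v + mu%:C%C *: v.
Proof.
move=> se ce TT bT TU.
pose k T S := '[lE r s (S e), lE r s (T e)] / c s e e.
have F1 X Y t u u' : adj X X -> adj Y Y -> lcomm X -> lcomm Y ->
    lE r t u = 0 -> lE r t u' = 0 ->
    '[lE r t (X u), lE r t (Y u')] = k X Y * (c t u u')^*.
  move=> XX YY XU YU tu tu'.
  have := coef_duality XX YY XU YU se se tu tu'; rewrite rmorphM /= -hdotC => h.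
  rewrite /k mulrAC -[LHS]mulr1 -[1](divff (x := c s e e)); last exact/eqP.
  by rewrite mulrA; congr (_ / _); rewrite mulrC h mulrC.
have [t0 [u0 [tu0 tPu0]]] := offdiag_projection.
have kPP : k P P != 0.
  apply/eqP => k0; apply: tPu0; apply: hdot_eq0.
  by rewrite F1 // k0 mul0r.
have cR : (c s e e)^* = c s e e.
  have := F1 P P s e e PP PP PU PU se se; rewrite {1}/(k P P) => h.
  have h' : k P P * c s e e = k P P * (c s e e)^*.
    rewrite {1}/k divfK; last exact/eqP.
    by rewrite h.
  by apply/esym/(mulfI kPP).
have kC X Y : adj X X -> adj Y Y -> lcomm X -> lcomm Y -> k X Y = (k X Y)^*.
  move=> XX YY XU YU; have := F1 X Y s e e XX YY XU YU se se; rewrite cR => h.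
  rewrite {2}/k rmorphM fmorphV /= cR -hdotC h mulfK //; exact/eqP.
pose x := complex.Re (k T P / k P P).
have xE : x%:C%C = k T P / k P P.
  apply: RRe_real; apply/CrealP; rewrite rmorphM fmorphV /=.
  by rewrite -!kC.
pose T' u := T u - x%:C%C *: P u.
have T'T' : adj T' T'.
  by move=> u v; rewrite /T' hdotBl hdotBr TT -(adj_scale PP) PP (adj_real x).
have T'U : lcomm T'.
  by move=> a u; rewrite /T' TU PU (adj_sub (hU_adj r a)) (adj_scale (hU_adj r a)).
have kT'P : k T' P = 0.
  rewrite /k /T' (adj_sub (hE_sa r s)) (adj_scale (hE_sa r s)) hdotBr hdotZr.
  rewrite mulrBl -mulrA -/(k T P) -/(k P P) conj_Creal ?complex_real // xE.
  by rewrite divfK // subrr.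
have T'E : forall a u, T' (lE r a u) = lE r a (T' u).
  apply: (offdiag_commute T'T') => t u tu; apply: hdot_eq0; rewrite F1 //.
  suff -> : k T' T' = 0 by rewrite mul0r.
  apply/eqP; apply: contraT => kT'; exfalso; apply: tPu0.
  rewrite -[u0](lE_sum r) (adj_sum PP) (adj_sum (hE_sa r t0)) big1 // => b _.
  pose z := lE r b u0; rewrite -/z.
  have [bt|bt] := eqVneq b t0; first by rewrite /z bt tu0 (adj_0 PP) lE0.
  have tz : lE r t0 z = 0 by rewrite lEE eq_sym (negbTE bt).
  (* With t = t0 and blocks P_ij = E_i P E_j, this is P_bt P_tb z, so <z, y> = |E_t P z|^2 and it
     suffices to show y = 0. *)
  pose y := lE r b (P (lE r t0 (P z))).
  have tb v : lE r b (lE r t0 v) = 0 by rewrite lEE (negbTE bt).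
  have ty : lE r t0 y = 0 by rewrite lEE eq_sym (negbTE bt).
  have T'y : lE r t0 (T' y) = 0.
    apply: hdot_ext => v; rewrite hdot0l (hE_sa r) T'T' hdotC.
    rewrite -[T' _ in X in X^*]/(T' _) /y -(hE_sa r).
    have -> : '[lE r b (T' (lE r t0 v)), P (lE r t0 (P z))] =
       '[lE r b (T' (lE r t0 v)), lE r b (P (lE r t0 (P z)))].
      by rewrite -[in RHS](hE_sa r) lEE eqxx.
    by rewrite F1 // kT'P mul0r conjC0.
  (* Since k T' T' is nonzero, E_t T' y = 0 forces the coefficient itself to vanish. The coefficient
     does not involve the operator, so E_t P y = 0 as well. *)
  have cy : (c t0 y y)^* = 0.
    apply: (mulfI kT'); rewrite mulr0 -F1 // T'y hdot0l //.
  have Py : lE r t0 (P y) = 0.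
    by apply: hdot_eq0; rewrite F1 // cy mulr0.
  have y0 : y = 0.
    apply: hdot_eq0; rewrite {1}/y (hE_sa r) /y lEE eqxx -/y PP (hE_sa r) Py.
    by rewrite hdot0r.
  apply: hdot_eq0; rewrite (hE_sa r) lEE eqxx PP.
  by rewrite {1}/z (hE_sa r) -/y y0 hdot0r.
have bT' : bounded_op T'.
  apply: bounded_opB => //; exists (x ^+ 2) => [|u]; first exact: sqr_ge0.
  by rewrite nsqZr ler_wpM2l ?sqr_ge0 // projection_contr.
have [mu hmu] := schur_hrep irr T'T' bT' (conj T'U T'E).
by exists x, mu => v; rewrite -hmu /T' addrC subrK.
Qed.

Lemma sesquilinear_dot Q : adj Q Q -> sesquilinear (fun w : H * H => '[Q w.1, w.2]).
Proof.
move=> QQ; split=> b u v z /=; first by rewrite (adj_lin QQ) hdotDl hdotZl.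
by rewrite hdotDr hdotZr.
Qed.

Lemma dot_le Q : (forall u, nsq (Q u) <= nsq u) ->
  form_le (@qpair R H H) (fun w : H * H => '[Q w.1, w.2]) 1.
Proof.
move=> Q1 [u v]; rewrite mul1r -(@ler_pXn2r _ 2) ?nnegrE ?normr_ge0 //; last first.
  by rewrite lecR qpair_ge0.
rewrite normCK -csqE -rmorphXn lecR; apply: le_trans (CauchySchwarz_csq _ _) _.
rewrite /qpair /=; have := Q1 u; have := nsq_ge0 u; have := nsq_ge0 v.
move: (nsq u) (nsq v) (nsq (Q u)) => x y z; nra.
Qed.

(** For a projection [Q], [tau] is the limiting proportion of |w|^2 that the pieces U_y^-1 1_y w
    have in the range of [Q]. *)
Lemma ex_state Q : adj Q Q -> (forall u, nsq (Q u) <= nsq u) -> exists tau : R[i],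
  forall w w', mean_form m (prep r r) (fun w : H * H => '[Q w.1, w.2]) (w, w') = tau * '[w, w'].
Proof.
move=> QQ Q1; have [T [S [TS bT bS TC hT]]] := @mean_form_op _ _ hm _ _ _ r r _ _ ler01
  (sesquilinear_dot QQ) (dot_le Q1).
have [d hd] := schur_form irr TS bT bS TC.
by exists d => w w'; rewrite hT /= hd hdotZl.
Qed.

(** * The Hilbert-Schmidt bound when all coefficients vanish *)

Section Vanishing.
Variables (Q1 Q2 : H -> H) (K : letter I -> H -> H).
Hypotheses (Q1Q1 : adj Q1 Q1) (Q1I : forall u, Q1 (Q1 u) = Q1 u).
Hypotheses (Q1_contr : forall u, nsq (Q1 u) <= nsq u).
Hypotheses (Q2U : lcomm Q2) (Q12 : forall u, Q1 (Q2 u) = 0).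
Hypotheses (KHS : forall a, hilbert_schmidt (K a)).
Hypothesis K_adj : forall a, adj (K a) (fun v => Q1 (lE r a (Q2 v))).
Hypothesis c0 : forall s e, lE r s e = 0 -> c s e e = 0.

(** For fixed [w] these sums of |<y u, w>|^2 are, up to conjugation, the sequence with mean c_t(u,
    u) |E_s w|^2, which is zero under [c0]. *)
Lemma word_sum_coef n s t u w : lE r t u = 0 ->
  word_sum r n s (linv t) (fun y => (csq '[y, w])%:C%C) u =
  (iter n (transfer (prep r r)) (branch (prep r r) t (kern (u, u)))
    (lE r s w, lE r s w))^*.
Proof.
move=> tu.
have -> : (lE r s w, lE r s w) = lE (prep r r) (linv (linv s)) (w, w) by rewrite linvK.
rewrite iter_transfer_branch ?kern0 //.
rewrite (@word_sum_ext _ _ _ _ (fun=> True) n t (linv s) _ (kern (u, u)))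
  // => [|[x1 x2] _]; last first.
  by rewrite /kern /= hdotBl hdotBr (hE_sa r) tu hdot0r -(hE_sa r) tu hdot0l !subr0.
rewrite word_sum_sym linvK.
rewrite (word_sum_map (T := fun y : H => (y, y)) (r := r)) //.
apply: (@word_sum_ext _ _ _ _ (fun=> True)) => // y _.
by rewrite /kern /= csqE -hdotC.
Qed.

(** The Bessel inequality for the vectors y u, uniform in [n]; it supplies the constant [b] of
    [hs_tail_bound]. It follows from the invariance of the squared norm under the transfer. *)
Lemma word_sum_coef_le n s t u w : lE r t u = 0 ->
  word_sum r n s (linv t) (fun y => (csq '[y, w])%:C%C) u <= (nsq u * nsq w)%:C%C.
Proof.
move=> tu; have -> : word_sum r n s (linv t) (fun y => (csq '[y, w])%:C%C) u =
    `|word_sum r n s (linv t) (fun y => (csq '[y, w])%:C%C) u|.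
  have [l ->] := word_sum_list R[i] r n s (linv t) u.
  by rewrite ger0_norm // sumr_ge0 // => y _; rewrite lecR csq_ge0.
rewrite word_sum_coef // norm_conjC.
rewrite (iter_transfer_map (T := fun y : H => (y, y)) (r := r)) //.
have h : form_le (@nsq R H)
    (fun y => branch (prep r r) t (kern (u, u)) (y, y)) (nsq u).
  move=> y; rewrite /branch /kern /= (hdotC u) -csqE ger0_norm ?lecR ?csq_ge0 //.
  apply: le_trans (CauchySchwarz_csq _ _) _; rewrite mulrC ler_wpM2l ?nsq_ge0 //.
  by rewrite nsq_lU nsq_lE_le.
apply: le_trans (iter_transfer_le (sum_nsq_transfer r) n h _) _.
by rewrite lecR ler_wpM2l ?nsq_ge0 ?nsq_lE_le.
Qed.

(** The left side is the mean of sums of |Q1 E_s Q2 y u|^2. For each d > 0 they are bounded by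
    finitely many sequences of mean zero plus |u|^2 d per letter, where [d] bounds the tails of the
    operators [K s]. *)
Lemma state_vanish (tau : R[i]) t u :
  (forall w w', mean_form m (prep r r) (fun w : H * H => '[Q1 w.1, w.2]) (w, w') =
     tau * '[w, w']) ->
  lE r t u = 0 -> tau * '[lE r t (Q2 u), lE r t (Q2 u)] = 0.
Proof.
move=> htau tu; rewrite -htau.
set beta := fun w : H * H => _; set x := lE r t (Q2 u).
have ba (w : (H * H)%type) :
    bounded_seq (fun n => iter n (transfer (prep r r)) beta w).
  by apply: (form_le_bounded (sum_qpair r r) _ (dot_le Q1_contr)); rewrite mul1r qpair_ge0.
have beta0 : beta 0 = 0 by rewrite /beta /= hdot0r.
have /choice[l hl] (p : nat * letter I) := word_sum_list R[i] r p.1 p.2 (linv t) u.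
pose K' s y := Q1 (lE r s (Q2 y)).
have step n : iter n.+1 (transfer (prep r r)) beta (x, x) =
    (\sum_s \sum_(y <- l (n, s)) nsq (K' s y))%:C%C.
  rewrite iterSr (_ : transfer (prep r r) beta =
    fun w : (H * H)%type => \sum_s branch (prep r r) s beta w); last first.
    by apply/funext => w; rewrite transfer_branch.
  rewrite iter_transfer_sum rmorph_sum /=; apply: eq_bigr => s _.
  have -> : (x, x) = lE (prep r r) (linv (linv t)) (Q2 u, Q2 u) by rewrite linvK.
  rewrite iter_transfer_branch //.
  rewrite (word_sum_map (T := fun y : H => (Q2 y, Q2 y)) (r := r)); last first.
    by move=> a y; rewrite /= !Q2U.
  rewrite (hl (n, s)) rmorph_sum; apply: eq_bigr => y _ /=.
  (* As Q1 Q2 = 0, only - Q1 E_s Q2 y survives of Q1 (Q2 y - E_s Q2 y); this is where the adjoint of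
     [K s] enters. *)
  rewrite /beta /= -Q1I Q1Q1 (adj_sub Q1Q1) Q12 sub0r hdotNl hdotNr opprK.
  by rewrite hdot_nsq.
pose A n : R := \sum_s \sum_(y <- l (n, s)) nsq (K' s y).
have A0 n : 0 <= A n by rewrite sumr_ge0 // => s _; rewrite sumr_ge0 // => y _; exact: nsq_ge0.
have bA : bounded_seq (fun n => (A n)%:C%C).
  by have [B hB] := ba (x, x); exists B => n; rewrite /A -step.
(* The transfer applied directly to [beta] produces the sum over [s], so [step] starts at the first
   iterate; shift invariance discards the term n = 0. *)
rewrite /mean_form -(mean_shift hm (ba (x, x))).
rewrite (_ : (fun n => _) = (fun n => (A n)%:C%C)); last by apply/funext => n; exact: step.
have g_le n s w : \sum_(y <- l (n, s)) csq '[y, w] <= nsq u * nsq w.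
  rewrite -(@lecR R) rmorph_sum /= -(hl (n, s) (fun y => (csq '[y, w])%:C%C)).
  exact: word_sum_coef_le.
pose g s w n : R[i] := (\sum_(y <- l (n, s)) csq '[y, w])%:C%C.
have bg s w : bounded_seq (g s w).
  exists ((nsq u * nsq w) ^+ 2) => n; rewrite /csq /= expr0n addr0.
  rewrite ler_sqr ?nnegrE ?mulr_ge0 ?nsq_ge0 // sumr_ge0 // => y _.
  exact: csq_ge0.
have mg s w : m (g s w) = 0.
  have -> : g s w = fun n => (iter n (transfer (prep r r))
      (branch (prep r r) t (kern (u, u))) (lE r s w, lE r s w))^*.
    apply/funext => n; rewrite /g rmorph_sum /=.
    rewrite -(hl (n, s) (fun y => (csq '[y, w])%:C%C)) word_sum_coef //.
  rewrite mean_conj //.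
    by rewrite -[m _]/(mean_form _ _ _ _) hc c0 // mul0r conjC0.
  apply: (@form_le_bounded _ _ _ _ (@qpair R H H) (sum_qpair r r) _ (qpair (u, u))).
    by rewrite mulr_ge0 ?qpair_ge0.
  by apply: branch_le; [exact: qpair_ge0|exact: kern_le].
have mA d : 0 < d -> m (fun n => (A n)%:C%C) <= (#|{: letter I}|%:R * (nsq u * d))%:C%C.
  move=> d0.
  have /choice[F hF] s : exists F, forall n,
      \sum_(y <- l (n, s)) nsq (K' s y) <=
      \sum_(e <- F) \sum_(y <- l (n, s)) csq '[y, K s e] + nsq u * d.
    have [B HB [b hb]] := KHS s; have [F oF hF] := hs_tail hb d0.
    exists F => n.
    exact: (hs_tail_bound (K_adj s) HB oF (nsq_ge0 u) hF (g_le n s)).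
  pose b s n := \sum_(e <- F s) g s (K s e) n + (nsq u * d)%:C%C.
  have bb s : bounded_seq (b s).
    by apply: bounded_seqD; [exact: (mean_sum hm _ _).1|exact: bounded_seq_cst].
  have mb s : m (b s) = (nsq u * d)%:C%C.
    rewrite (meanD hm); [|exact: (mean_sum hm _ _).1|exact: bounded_seq_cst].
    rewrite (mean_sum hm _ _).2 // big1 ?add0r => [|e _]; last exact: mg.
    exact: mean_cst.
  have -> : (#|{: letter I}|%:R * (nsq u * d))%:C%C = m (fun n => \sum_s b s n).
    rewrite (mean_sum hm _ bb).2 (eq_bigr _ (fun s _ => mb s)) sumr_const.
    by rewrite mulr_natl rmorphMn.
  apply: mean_le => //; first exact: (mean_sum hm _ bb).1.
  move=> n; rewrite /A /b /g rmorph_sum /=; apply: ler_sum => s _.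
  by rewrite -rmorph_sum -rmorphD lecR hF.
have z0 : 0 <= m (fun n => (A n)%:C%C).
  by apply: mean_ge0 => // n; rewrite lecR.
apply/eqP; rewrite eq_le z0 andbT; move: mA z0.
set z := m _ => mA z0; have zr : z = (complex.Re z)%:C%C by rewrite RRe_real ?ger0_real.
rewrite zr lecR; apply/ler_addgt0Pl => e e0; rewrite addr0.
set N : R := #|{: letter I}|%:R in mA.
have N0 : 0 <= N * nsq u by rewrite mulr_ge0 ?nsq_ge0.
have N1 : 0 < N * nsq u + 1 by rewrite ltr_wpDl.
have := mA (e / (N * nsq u + 1)) ltac:(by rewrite divr_gt0).
rewrite zr lecR /= mulrA => h; apply: le_trans h _.
by rewrite mulrA ler_pdivrMr // mulrDr mulr1 mulrC lerDl ltW.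
Qed.

End Vanishing.

(* If all coefficients vanished, the state of [P] or that of [1 - P] would be
   nonzero, and the Hilbert-Schmidt bound would force [P] to be block diagonal. *)
Lemma coef_nonzero :
  (forall a, hilbert_schmidt (fun v => lE r a (P v) - P (lE r a (P v)))) ->
  exists s e, lE r s e = 0 /\ c s e e <> 0.
Proof.
move=> KHS; apply: contrapT => /forallNP n0.
have c0 s e : lE r s e = 0 -> c s e e = 0.
  by move=> se; apply: contrapT => ne; apply: (n0 s); exists e.
pose Q u := u - P u.
have QQ : adj Q Q by move=> u v; rewrite hdotBl hdotBr PP.
have QI u : Q (Q u) = Q u by rewrite /Q (adj_sub PP) PI subrr subr0.
have QU : lcomm Q by move=> a u; rewrite /Q PU (adj_sub (hU_adj r a)).
have PQ u : P (Q u) = 0 by rewrite /Q (adj_sub PP) PI subrr.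
have QP u : Q (P u) = 0 by rewrite /Q PI subrr.
have Q_contr u : nsq (Q u) <= nsq u.
  have -> : nsq u = nsq (P u) + nsq (Q u).
    have {1}-> : u = P u + Q u by rewrite addrC subrK.
    by rewrite nsqD PP PQ hdot0r mulr0 addr0.
  by rewrite lerDr nsq_ge0.
have Ka a : adj (fun v => lE r a (P v) - P (lE r a (P v))) (fun v => P (lE r a (Q v))).
  by move=> u v; rewrite -[_ - _]/(Q _) QQ (hE_sa r) PP.
have Ka' a : adj (fun v => P (lE r a (Q v))) (fun v => Q (lE r a (P v))).
  by move=> u v; rewrite PP (hE_sa r) QQ.
have [t1 h1] := ex_state PP projection_contr.
have [t2 h2] := ex_state QQ Q_contr.
have [a [u [au aPu]]] := offdiag_projection; apply: aPu.
have hQP := state_vanish PP PI projection_contr QU PQ KHS Ka c0 h1 au.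
have hPQ := state_vanish QQ QI Q_contr PU QP (fun b => hilbert_schmidt_adj (Ka b) (KHS b)) Ka' c0 h2 au.
have [t10|t10] := eqVneq t1 0; last first.
  move/eqP: hQP; rewrite mulf_eq0 (negbTE t10) /= => /eqP/hdot_eq0.
  by rewrite /Q lEB au sub0r => /eqP; rewrite oppr_eq0 => /eqP.
have [t20|t20] := eqVneq t2 0; last first.
  by move/eqP: hPQ; rewrite mulf_eq0 (negbTE t20) /= => /eqP/hdot_eq0.
have [[v0 v0n] _] := irr; exfalso; apply: v0n; apply: hdot_eq0.
(* P + Q = 1 and the transfer preserves the inner product, so the two states add up to 1 and cannot
   both be zero. *)
have key n (x : (H * H)%type) :
    iter n (transfer (prep r r)) (fun w : H * H => '[P w.1, w.2]) x +
    iter n (transfer (prep r r)) (fun w : H * H => '[Q w.1, w.2]) x = '[x.1, x.2].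
  elim: n x => [|n IH] x /=; first by rewrite -hdotDl addrC subrK.
  rewrite /transfer -big_split /= (eq_bigr _ (fun b _ => IH _)) /=.
  have {2}-> : x.1 = \sum_b lE r b x.1 by rewrite lE_sum.
  rewrite hdot_suml; apply: eq_bigr => b _.
  by rewrite (hU_adj r) linvK lUKr (hE_sa r) lEE eqxx -(hE_sa r).
rewrite -[LHS](mean_cst hm).
rewrite (_ : (fun=> _) = fun n : nat =>
    iter n (transfer (prep r r)) (fun w : H * H => '[P w.1, w.2]) (v0, v0) +
    iter n (transfer (prep r r)) (fun w : H * H => '[Q w.1, w.2]) (v0, v0)).
  rewrite (meanD hm).
  - by rewrite -/(mean_form _ _ _ _) -/(mean_form _ _ _ _) h1 h2 t10 t20 !mul0r addr0.
  - apply: (form_le_bounded (sum_qpair r r) _ (dot_le projection_contr)).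
    by rewrite mul1r qpair_ge0.
  apply: (form_le_bounded (sum_qpair r r) _ (dot_le Q_contr)).
  by rewrite mul1r qpair_ge0.
by apply/funext => n; rewrite key.
Qed.

End Commutant.

(** * Uniqueness of the realization *)

Lemma hcomm_adj (R : realType) (I : finType) (H K : hilbertType R) (r : hrep I H)
  (r' : hrep I K) T S : adj T S -> hcomm r r' T -> hcomm r' r S.
Proof.
move=> TS [TU TE]; have ST := adj_sym TS; split=> a u; apply: hdot_ext => w.
  by rewrite ST !hU_adj ST TU.
by rewrite ST !hE_sa ST TE.
Qed.

Lemma adj_comp (R : realType) (H1 H2 H3 : hilbertType R) (T : H1 -> H2) T'
  (S : H2 -> H3) S' : adj T T' -> adj S S' ->
  adj (fun u => S (T u)) (fun u => T' (S' u)).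
Proof. by move=> TT SS u v; rewrite SS TT. Qed.

Lemma bounded_op_comp (R : realType) (H1 H2 H3 : hilbertType R) (T : H1 -> H2)
  (S : H2 -> H3) : bounded_op T -> bounded_op S -> bounded_op (fun u => S (T u)).
Proof.
move=> [C C0 hC] [D D0 hD]; exists (D * C); first exact: mulr_ge0.
move=> u; apply: le_trans (hD _) _; rewrite -mulrA ler_wpM2l //.
Qed.

Lemma hcomm_comp (R : realType) (I : finType) (H1 H2 H3 : hilbertType R)
  (r1 : hrep I H1) (r2 : hrep I H2) (r3 : hrep I H3) (T : H1 -> H2) (S : H2 -> H3) :
  hcomm r1 r2 T -> hcomm r2 r3 S -> hcomm r1 r3 (fun u => S (T u)).
Proof. by move=> [TU TE] [SU SE]; split=> a u; rewrite ?TU ?TE ?SU ?SE. Qed.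

Section Realizations.
Variables (R : realType) (m : (nat -> R[i]) -> R[i]).
Hypothesis hm : shift_mean m.
Variables (I : finType) (H0 H : hilbertType R) (r : hrep I H).
Hypothesis irr : hirr r.
Variables (pU : letter I -> H0 -> H0) (iota : H0 -> H) (iotad : H -> H0).
Hypotheses (iota_adj : adj iota iotad) (iotaK : forall v, iotad (iota v) = v).
Hypothesis iotaU : forall a v, iota (pU a v) = lU r a (iota v).
Hypotheses (iota0 : exists v, iota v <> 0) (iota1 : exists u, iota (iotad u) <> u).

Let P u := iota (iotad u).

Let PP : adj P P.
Proof. by move=> u v; rewrite /P iota_adj (adj_sym iota_adj). Qed.

Let PI u : P (P u) = P u.
Proof. by rewrite /P iotaK. Qed.

Let PU : lcomm r P.
Proof.
move=> a u; have h b v : P (lU r b (P v)) = lU r b (P v).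
  by rewrite {2 3}/P -iotaU /P iotaK.
have <- := h a u.
by apply: hdot_ext => w; rewrite !PP !(hU_adj r) PP h.
Qed.

Let P0 : exists u, P u <> 0.
Proof. by have [v v0] := iota0; exists (iota v); rewrite /P iotaK. Qed.

Hypothesis KHS : forall a, hilbert_schmidt (fun v => lE r a (P v) - P (lE r a (P v))).

Lemma gamma_commutant T : adj T T -> bounded_op T -> lcomm r T ->
  exists l mu : R, forall v, T v = l%:C%C *: P v + mu%:C%C *: v.
Proof.
have [c hc] := ex_coef hm irr.
have [s [e [se ce]]] := coef_nonzero hm irr PP PI PU P0 iota1 hc KHS.
by move=> TT bT TU; have := commutant_of_coef hm irr PP PI PU P0 iota1 hc se ce TT bT TU.
Qed.

(* If all the intertwiners vanished, duality with a nonzero coefficient of [H] would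
   give [key]. Applied to [v = iotad (E_s (1 - P) E_s P y)], it shows that [j v] lives
   on the cylinder of [s], and then that [(1 - P) E_t (iota v) = 0] for all [t]. This
   forces [v = 0], so that [P] commutes with the indicators. *)
Lemma ex_intertwiner (K : hilbertType R) (q : hrep I K) (j : H0 -> K) (jd : K -> H0)
  (Z : K -> K) (theta : R) :
  adj j jd -> (forall v, jd (j v) = theta%:C%C *: v) -> theta != 0 ->
  (forall a v, j (pU a v) = lU q a (j v)) ->
  adj Z Z -> bounded_op Z -> hcomm q q Z -> (forall w, Z (Z w) = Z w) ->
  (forall v, Z (j v) = j v) ->
  exists L Ld, [/\ adj L Ld, bounded_op L, bounded_op Ld, hcomm r q L &
    (forall v, Z (L v) = L v) /\ exists v, L v <> 0].
Proof.
move=> jj jK th0 jU ZZ bZ cZ ZI Zj; apply: contrapT => no.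
have {}no L Ld : adj L Ld -> bounded_op L -> bounded_op Ld -> hcomm r q L ->
    (forall v, Z (L v) = L v) -> forall v, L v = 0.
  move=> LL bL bLd cL ZL v; apply: contrapT => nv; apply: no.
  by exists L, Ld; split=> //; split=> //; exists v.
have [c hc] := ex_coef hm irr.
have [t [u [tu ctu]]] := coef_nonzero hm irr PP PI PU P0 iota1 hc KHS.
(* The limit form on K x H is <T w, w'> with an intertwiner [T]. Its adjoint [S] followed by [Z] is
   an intertwiner from [H] to [K] of the excluded kind, hence zero. *)
have ZM s e w w' : mean_form m (prep q r) (branch (prep q r) s (kern e)) (Z w, w') = 0.
  have [T [S [TS bT bS TC hT]]] := @mean_form_op _ _ hm _ _ _ q r _ _
    (qpair_ge0 e) (branch_sesquilinear q r s (kern_sesquilinear e))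
    (branch_le q r s (qpair_ge0 e) (kern_le e)).
  rewrite hT /= TS ZZ (no (fun v => Z (S v)) (fun w => T (Z w))) ?hdot0r //.
  - exact: adj_comp (adj_sym TS) ZZ.
  - exact: bounded_op_comp bS bZ.
  - exact: bounded_op_comp bZ bT.
  - exact: hcomm_comp (hcomm_adj TS TC) cZ.
have jiU a w : j (iotad (lU r a w)) = lU q a (j (iotad w)).
  have iotadU : iotad (lU r a w) = pU a (iotad w).
    have : iota (iotad (lU r a w)) = iota (pU a (iotad w)) by rewrite iotaU -PU.
    by move=> /(congr1 iotad); rewrite !iotaK.
  by rewrite iotadU jU.
(* The commuting maps put into the duality are [iotad] followed by [j], from [H] to [K], and [P] on
   [H]. The mean on K x H vanishes by [ZM], because [j] takes values in the range of [Z]. *)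
have key s e e' : lE q s e = 0 -> lE r s e' = 0 ->
    '[iota (jd e), lE r s (P e')] = 0.
  move=> se se'.
  have := @mean_duality _ _ hm _ _ _ _ _ r r q r _ _ _ _
    (adj_comp (adj_sym iota_adj) jj) PP jiU PU s t e e' u u se se' tu tu.
  have -> : lE q t (j (iotad u)) = Z (lE q t (j (iotad u))).
    by have [_ ZE] := cZ; rewrite ZE Zj.
  rewrite ZM hc => /esym/eqP; rewrite fmorph_eq0 mulf_eq0.
  move=> /orP[/eqP//|/eqP].
  by rewrite (hE_sa r) lEE eqxx.
have Qd w : '[w, w - P w] = (nsq (w - P w))%:C%C.
  by rewrite -hdot_nsq [RHS]hdotBl PP (adj_sub PP) PI subrr hdot0r subr0.
have compl s w : P w = w -> lE r s (P (w - lE r s w)) =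
    lE r s (lE r s w - P (lE r s w)).
  by move=> Pw; rewrite (adj_sub PP) Pw !lEB !lEE eqxx.
have ker s w : lE r s (w - lE r s w) = 0 by rewrite lE_compl eqxx.
have QEP s y : lE r s (P y) - P (lE r s (P y)) = 0.
  pose b := lE r s (lE r s (P y) - P (lE r s (P y))).
  pose v := iotad b.
  have jv : lE q s (j v) = j v.
    have sj : lE q s (j v - lE q s (j v)) = 0 by rewrite lE_compl eqxx.
    have := key s _ _ sj (ker s (P y)).
    rewrite (compl s (P y)) ?PI // -/b iota_adj (adj_sym jj) -/v => h.
    apply/esym/subr0_eq/hdot_eq0; rewrite hdotBr h.
    by rewrite -(hE_sa q) sj hdot0l subrr.
  have Qt t' : t' != s -> lE r t' (iota v) - P (lE r t' (iota v)) = 0.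
    move=> ts; have tj : lE q t' (j v) = 0 by rewrite -jv lEE (negbTE ts).
    have Pv : P (iota v) = iota v by rewrite /P iotaK.
    have := key t' _ _ tj (ker t' (iota v)).
    rewrite compl // jK (adj_scale iota_adj) hdotZl => /eqP.
    rewrite mulf_eq0 => /orP[/eqP[/eqP]|/eqP]; first by rewrite (negbTE th0).
    by rewrite -(hE_sa r) Qd => -[h]; exact: nsq_eq0.
  have Qs : lE r s (iota v) - P (lE r s (iota v)) = 0.
    have : \sum_b (lE r b (iota v) - P (lE r b (iota v))) = 0.
      by rewrite sumrB -(adj_sum PP) lE_sum /P iotaK subrr.
    by rewrite (bigD1 s) //= big1 ?addr0 // => t' ts; exact: Qt.
  have v0 : iota v = 0.
    apply: hdot_eq0; rewrite {2}/v -/(P b) -PP {1}/P iotaK.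
    rewrite /b -(hE_sa r) hdotBr -PP -hdotBl Qs hdot0l //.
  apply: nsq_eq0; have := Qd (lE r s (P y)).
  have -> : '[lE r s (P y), lE r s (P y) - P (lE r s (P y))] = 0.
    by rewrite (hE_sa r) PP -/b -/(iota _) -[P b]/(iota v) v0 hdot0r.
  by move=> [<-].
have [a [w [aw aPw]]] := offdiag_projection irr PP PI PU P0 iota1.
apply: aPw; have E y : lE r a (P y) = P (lE r a (P y)) by apply/subr0_eq/QEP.
apply: hdot_ext => y; rewrite hdot0l E PP (hE_sa r) PP -E.
by rewrite -(hE_sa r) aw hdot0l.
Qed.

Let iotad_adj : adj iotad iota := adj_sym iota_adj.

Lemma bounded_op_isometry (A B : hilbertType R) (T : A -> B) S : adj T S ->
  (forall v, S (T v) = v) -> bounded_op T.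
Proof. by move=> TS ST; exists 1 => // u; rewrite mul1r /nsq TS ST. Qed.

Section Uniqueness.
Variables (K : hilbertType R) (q : hrep I K) (j : H0 -> K) (jd : K -> H0).
Hypotheses (jj : adj j jd) (jK : forall v, jd (j v) = v).
Hypothesis jU : forall a v, j (pU a v) = lU q a (j v).
Hypothesis cyc : forall V : set K, closed_subspace V -> (forall v, V (j v)) ->
  (forall a v, V v -> V (lU q a v)) -> (forall a v, V v -> V (lE q a v)) -> V = setT.

Lemma cyclic_zero (A : hilbertType R) (s : hrep I A) (T : K -> A) S :
  adj T S -> bounded_op T -> hcomm q s T -> (forall v, T (j v) = 0) ->
  forall w, T w = 0.
Proof.
move=> TS bT [TU TE] Tj w.
have e : [set w | T w = 0] = setT.
  apply: cyc => //; first exact: adj_bounded_closed TS bT.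
    by move=> a v /= Tv; rewrite TU Tv (adj_0 (hU_adj s a)).
  by move=> a v /= Tv; rewrite TE Tv (adj_0 (hE_sa s a)).
by have : [set: K] w by []; rewrite -e.
Qed.

(** The composite of [iotad], [j] and [Ld] commutes with the group, so it is a complex combination
    of [P] and 1. It vanishes on the kernel of [P], which leaves a multiple of [P]. *)
Lemma intertwiner_realization L Ld : adj L Ld -> bounded_op L -> bounded_op Ld ->
  hcomm r q L -> exists l : R[i], forall v, Ld (j v) = l *: iota v.
Proof.
move=> LL bL bLd cL; pose A u := Ld (j (iotad u)); pose A' u := iota (jd (L u)).
have [LdU _] := hcomm_adj LL cL; have [LU _] := cL.
have AA : adj A A'.
  by move=> u v; rewrite /A (adj_sym LL) jj iotad_adj.
have bi := bounded_op_isometry iota_adj iotaK; have bj := bounded_op_isometry jj jK.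
have bA : bounded_op A.
  apply: bounded_op_comp bLd; apply: bounded_op_comp bj.
  exact: bounded_adj iota_adj bi.
have bA' := bounded_adj AA bA.
have AU : lcomm r A.
  move=> a u; rewrite /A -LdU -jU; congr (Ld (j _)).
  have : iota (iotad (lU r a u)) = iota (pU a (iotad u)) by rewrite iotaU -PU.
  by move=> /(congr1 iotad); rewrite !iotaK.
have A'U : lcomm r A'.
  move=> a u; apply: hdot_ext => w.
  by rewrite (adj_sym AA) !(hU_adj r) (adj_sym AA) AU.
have cC (x y : R[i]) : lcomm r (fun u => x *: A u + y *: A' u).
  by move=> a u; rewrite AU A'U (adj_add (hU_adj r a)) !(adj_scale (hU_adj r a)).
have [x [x' hx]] := gamma_commutant (adj_lincomb 1 AA)
  (bounded_op_lincomb _ _ bA bA') (cC _ _).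
have [y [y' hy]] := gamma_commutant (adj_lincomb 'i AA)
  (bounded_op_lincomb _ _ bA bA') (cC _ _).
have i0 : 'i != 0 :> R[i] by rewrite neq0Ci.
pose l : R[i] := x%:C%C / 2 + y%:C%C / (2 * 'i).
pose mu : R[i] := x'%:C%C / 2 + y'%:C%C / (2 * 'i).
have AE v : A v = l *: P v + mu *: v.
  apply: hdot_ext => w.
  have := congr1 (hdot^~ w) (hx v); have := congr1 (hdot^~ w) (hy v).
  rewrite /= !hdotDl !hdotZl conjCi rmorph1 => h1 h2.
  have -> : l * '[P v, w] + mu * '[v, w] =
    (x%:C%C * '[P v, w] + x'%:C%C * '[v, w]) / 2 +
    (y%:C%C * '[P v, w] + y'%:C%C * '[v, w]) / (2 * 'i).
    by rewrite /l /mu; field; exact: i0.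
  by rewrite -h1 -h2; field; exact: i0.
have mu0 : mu = 0.
  have [u nu] := iota1; apply/eqP; apply: contraT => mu0; exfalso; apply: nu.
  have := AE (u - P u); rewrite (adj_sub PP) PI subrr scaler0 add0r.
  have -> : A (u - P u) = 0.
    rewrite /A (adj_sub iotad_adj) /P iotaK subrr (adj_0 jj).
    exact: adj_0 (adj_sym LL).
  by move=> /esym/eqP; rewrite scaler_eq0 (negbTE mu0) subr_eq0 => /eqP.
exists l => v; have := AE (iota v).
by rewrite mu0 scale0r addr0 /A /P !iotaK.
Qed.

(** An intertwiner normalized by Schur's lemma is an isometry [L] with Ld j = l iota. If |l| were
    not 1, then (1 - L Ld) j would be a nonzero multiple of an isometry, and [ex_intertwiner] would
    give a second intertwiner with range orthogonal to that of [L]; this is the purpose of [Z] and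
    [theta] there. Cyclicity would make its adjoint proportional to [Ld], a contradiction. *)
Lemma realization_unique : exists J Jd, [/\ adj J Jd,
  forall v, Jd (J v) = v, forall w, J (Jd w) = w, hcomm r q J &
  forall v, J (iota v) = j v].
Proof.
have bI : bounded_op (id : K -> K) by exists 1 => // u; rewrite mul1r.
have jK1 v : jd (j v) = 1%:C%C *: v by rewrite jK scale1r.
have [L0 [L0d [LL0 bL0 bL0d cL0 [_ [v0 Lv0]]]]] := @ex_intertwiner K q j jd id 1 jj
  jK1 (oner_neq0 R) jU (fun u v => erefl) bI (conj (fun a u => erefl) (fun a u => erefl))
  (fun=> erefl) (fun=> erefl).
have [rho hrho] := @schur_hrep _ _ _ r (fun v => L0d (L0 v)) irr
  (fun u v => etrans (adj_sym LL0 (L0 u) v) (LL0 u (L0 v)))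
  (bounded_op_comp bL0 bL0d) (hcomm_comp cL0 (hcomm_adj LL0 cL0)).
have rho0 : 0 < rho.
  have h : nsq (L0 v0) = rho * nsq v0.
    by rewrite /nsq LL0 hrho hdotZr conj_Creal ?complex_real // hdot_nsq /= mul0r subr0.
  have p : 0 < nsq (L0 v0).
    rewrite lt_neqAle nsq_ge0 andbT eq_sym; apply/eqP => /nsq_eq0; exact: Lv0.
  have := nsq_ge0 v0; rewrite le_eqVlt => /orP[/eqP e|v0p].
    by move: p; rewrite h -e mulr0 ltxx.
  by move: p; rewrite h pmulr_lgt0.
pose s : R[i] := (Num.sqrt rho)^-1%:C%C.
have sJ : s^* = s by rewrite conj_Creal // complex_real.
have ss : s * (s * rho%:C%C) = 1.
  rewrite mulrA -!rmorphM /= -invfM -expr2 sqr_sqrtr ?ltW //.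
  by rewrite mulVf // lt0r_neq0.
pose L u := s *: L0 u; pose Ld u := s *: L0d u.
have LL : adj L Ld by move=> u v; rewrite hdotZl hdotZr sJ LL0.
have bZ (x : R[i]) (A B : hilbertType R) (T : A -> B) :
    bounded_op T -> bounded_op (fun u => x *: T u).
  by move=> bT; apply: bounded_op_comp bT _; exact: bounded_opZ.
have bL : bounded_op L by exact: bZ.
have bLd : bounded_op Ld by exact: bZ.
have cL : hcomm r q L.
  have [LU LE] := cL0; split=> a u; rewrite /L ?LU ?LE.
    by rewrite (adj_scale (hU_adj q a)).
  by rewrite (adj_scale (hE_sa q a)).
have cLd := hcomm_adj LL cL.
have LK v : Ld (L v) = v.
  by rewrite /Ld /L (adj_scale (adj_sym LL0)) hrho !scalerA -mulrA ss scale1r.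
clearbody L Ld.
have dL := adj_sym LL.
have [l hl] := intertwiner_realization LL bL bLd cL.
have l0 : l != 0.
  apply/eqP => l0; have [w wn] := iota0.
  have := cyclic_zero dL bLd cLd (fun v => _); move=> h.
  have {}h x : Ld x = 0 by apply: h => v; rewrite hl l0 scale0r.
  by have := wn; rewrite -(LK (iota w)) h.
pose Z w := w - L (Ld w).
have ZZ : adj Z Z by move=> u v; rewrite hdotBl hdotBr LL dL.
have bZZ : bounded_op Z := bounded_opB bI (bounded_op_comp bLd bL).
have cZ : hcomm q q Z.
  have [LU LE] := cL; have [LdU LdE] := cLd; split=> a u.
    by rewrite /Z LdU LU (adj_sub (hU_adj q a)).
  by rewrite /Z LdE LE (adj_sub (hE_sa q a)).
have LdZ w : Ld (Z w) = 0 by rewrite /Z (adj_sub dL) LK subrr.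
have ZI w : Z (Z w) = Z w by rewrite {1}/Z LdZ (adj_0 LL) subr0.
have jdL v : jd (L (iota v)) = l^* *: v.
  apply: hdot_extr => w; rewrite hdotZr conjCK -jj -(adj_sym LL) hl hdotZl.
  by rewrite iota_adj iotaK.
have jdZ v : jd (Z (j v)) = (1 - csq l)%:C%C *: v.
  rewrite /Z (adj_sub (adj_sym jj)) jK hl (adj_scale LL) (adj_scale (adj_sym jj)).
  by rewrite jdL scalerA -csqE rmorphB scalerBl scale1r.
have l1 : csq l = 1.
  apply/eqP; rewrite eq_sym -subr_eq0; apply: contraT => th0.
  have jZK v : jd (Z (Z (j v))) = (1 - csq l)%:C%C *: v by rewrite ZI jdZ.
  have jZU a v : Z (j (pU a v)) = lU q a (Z (j v)) by rewrite jU; case: cZ => ->.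
  have [L1 [L1d [LL1 bL1 bL1d cL1 [ZL1 [v1 L1v1]]]]] :=
    ex_intertwiner (adj_comp jj ZZ) jZK th0 jZU ZZ bZZ cZ ZI (fun v => ZI (j v)).
  exfalso; apply: L1v1; have [l' hl'] := intertwiner_realization LL1 bL1 bL1d cL1.
  (* At [j v] both terms equal l l' iota v, so [D] is zero by cyclicity; at [L1 v1] the second term
     vanishes because [L1] maps into the range of [Z]. *)
  pose D w := l *: L1d w - l' *: Ld w.
  have DD : adj D (fun v => l^* *: L1 v - l'^* *: L v).
    by move=> w v; rewrite /D hdotBl hdotBr !hdotZl !hdotZr !conjCK
      (adj_sym LL1) dL.
  have bD : bounded_op D.
    by apply: bounded_opB; exact: bZ.
  have cD : hcomm q r D.
    have [L1U L1E] := hcomm_adj LL1 cL1; have [LdU LdE] := cLd; split=> a u.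
      by rewrite /D L1U LdU (adj_sub (hU_adj r a)) !(adj_scale (hU_adj r a)).
    by rewrite /D L1E LdE (adj_sub (hE_sa r a)) !(adj_scale (hE_sa r a)).
  have D0 : forall w, D w = 0.
    apply: (cyclic_zero DD bD cD) => v.
    by rewrite /D hl hl' !scalerA mulrC subrr.
  have := D0 (L1 v1); rewrite /D -[in Ld _]ZL1 LdZ scaler0 subr0 => /eqP.
  rewrite scaler_eq0 (negbTE l0) /= => /eqP h.
  by apply: hdot_eq0; rewrite LL1 h hdot0r.
have Zj v : Z (j v) = 0.
  by apply: hdot_eq0; rewrite ZZ ZI jj jdZ l1 subrr scale0r hdot0r.
have Z0 : forall w, Z w = 0 := cyclic_zero ZZ bZZ cZ Zj.
have LLd w : L (Ld w) = w by have /eqP := Z0 w; rewrite subr_eq0 eq_sym => /eqP.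
have ll : l * l^* = 1 by rewrite -csqE l1.
(* The phase is dictated by L (l iota v) = L (Ld (j v)) = j v. *)
exists (fun u => l *: L u), (fun w => l^* *: Ld w); split.
- by move=> u v; rewrite hdotZl hdotZr conjCK LL.
- by move=> v; rewrite (adj_scale dL) scalerA mulrC ll scale1r.
- by move=> w; rewrite (adj_scale LL) scalerA ll scale1r.
- have [LU LE] := cL; split=> a u; rewrite ?LU ?LE.
    by rewrite (adj_scale (hU_adj q a)).
  by rewrite (adj_scale (hE_sa q a)).
by move=> v; rewrite -(adj_scale LL) -hl LLd.
Qed.

End Uniqueness.

End Realizations.

(** * Generation by letters *)

Section LinearOfAdjoint.
Variables (R : realType) (H K : hilbertType R) (T : H -> K) (S : K -> H).
Hypothesis TS : adj T S.
(** The proof argument allows the linear structure, a consequence of adjointness, to be attached to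
    the function. *)
Definition adj_fun of adj T S := T.
Fact adj_fun_linear : linear (adj_fun TS).
Proof. by move=> c u v; exact: (adj_lin TS). Qed.
HB.instance Definition _ :=
  GRing.isLinear.Build R[i] H K *:%R (adj_fun TS) adj_fun_linear.
Definition adj_linear : {linear H -> K} := adj_fun TS.
End LinearOfAdjoint.

Section FreeGroupGeneration.
Variable I : finType.

Lemma fg_letter_cons (a : letter I) s (P : reduced (a :: s)) :
  FreeWord P = (fg_letter a * FreeWord (reduced_behead P))%g.
Proof.
apply: val_inj => /=; case: s P => //= b s /andP[/negbTE nb _].
by rewrite nb.
Qed.

Lemma fg_letter_linv (a : letter I) : fg_letter (linv a) = (fg_letter a)^-1%g.
Proof. exact: val_inj. Qed.

Lemma freeGroup_ind (Q : freeGroup I -> Prop) : Q 1%g ->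
  (forall a x, Q x -> Q (fg_letter a * x)%g) -> forall x, Q x.
Proof.
move=> Q1 QM [s P]; elim: s P => [|a s IH] P.
  by rewrite (_ : FreeWord P = 1%g) //; exact: val_inj.
by rewrite fg_letter_cons; exact: QM.
Qed.

End FreeGroupGeneration.

(** * Generation of the continuous functions by letter indicators and translations *)

Section Indicators.
Variables (R : realType) (I : finType).
Local Notation C := (cfun R (boundary I)).
Local Notation ind a := (cylinder_indic R (fg_letter a)).
Implicit Types (a b : letter I) (w : boundary I) (F G : C).

Lemma cfun_ext F G : (forall w, F w = G w) -> F = G.
Proof. by move=> FG; apply: val_inj; apply/funext. Qed.

Lemma cfunBE F G w : (F - G) w = F w - G w. Proof. by []. Qed.
Lemma cfunME F G w : (F * G) w = F w * G w. Proof. by []. Qed.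
Lemma cfun1E w : (1 : C) w = 1. Proof. by []. Qed.

Lemma cfun_sumE (J : finType) (F : J -> C) w : (\sum_j F j) w = \sum_j F j w.
Proof. by elim/big_rec2: _ => [|j x y _ <-]. Qed.

Lemma cylinder_indicE (x : freeGroup I) w :
  cylinder_indic R x w = (mkseq w (size x) == x)%:R.
Proof.
rewrite /= /indic; congr (_%:R); congr nat_of_bool.
by apply/idP/eqP => [/set_mem//|e]; apply/mem_set.
Qed.

Lemma letter_indicE a w : ind a w = (w 0%N == a)%:R.
Proof. by rewrite cylinder_indicE /= /mkseq /= eqseq_cons andbT. Qed.

Lemma letter_indic_conj a : cfun_conj (ind a) = ind a.
Proof.
by apply: cfun_ext => w; rewrite -[LHS]/((ind a w)^*) letter_indicE conjC_nat.
Qed.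

Lemma letter_indicM a b : ind a * ind b = if a == b then ind a else 0.
Proof.
apply: cfun_ext => w; rewrite cfunME !letter_indicE.
case: (eqVneq a b) => [<-|ab].
  by rewrite letter_indicE; case: eqP => _; rewrite ?mulr1 ?mulr0.
case: (eqVneq (w 0%N) a) => [->|_]; last by rewrite mul0r.
by rewrite (negbTE ab) mulr0.
Qed.

Lemma letter_indic_sum : \sum_(a : letter I) ind a = 1 :> C.
Proof.
apply: cfun_ext => w; rewrite cfun_sumE cfun1E.
under eq_bigr => a _ do rewrite letter_indicE eq_sym.
by rewrite (bigD1 (w 0%N)) //= eqxx big1 ?addr0 // => a /negbTE->.
Qed.

Lemma ctranslate_letterE a G w : ctranslate (fg_letter a) G w = G (lact (linv a) w).
Proof. by []. Qed.

Lemma ctranslate_letter_indic a :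
  ctranslate (fg_letter a) (ind (linv a)) = 1 - ind a.
Proof.
apply: cfun_ext => w; rewrite ctranslate_letterE cfunBE cfun1E !letter_indicE.
rewrite /= /lact_word linvK; case: (eqVneq (w 0%N) a) => [wa|wa].
  by rewrite subrr; have := bwordP w 0; rewrite wa => /negbTE ->.
by rewrite eqxx subr0.
Qed.

(** The case of empty [s] is different: a translate of the whole boundary is the whole boundary, not
    the cylinder of [a]. *)
Lemma ctranslate_cylinder a s (P : reduced (a :: s)) : s <> [::] ->
  ctranslate (fg_letter a) (cylinder_indic R (FreeWord (reduced_behead P))) =
  cylinder_indic R (FreeWord P).
Proof.
move=> s0; apply: cfun_ext => w; rewrite ctranslate_letterE !cylinder_indicE.
congr (_%:R); congr nat_of_bool; rewrite [fword _]/= [fword (FreeWord P)]/=.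
have -> : mkseq w (size (a :: s)) = w 0%N :: mkseq (fun n => w n.+1) (size s).
  by rewrite /mkseq /= -[1%N]/(1 + 0)%N iotaDl -map_comp.
rewrite eqseq_cons; case: (eqVneq (w 0%N) a) => [wa|wa] /=.
  congr (_ == _); apply: eq_map => n.
  by rewrite /= /lact_word linvK wa eqxx.
case: s P s0 => [//|b s] P _; apply/negbTE; rewrite /mkseq /= eqseq_cons negb_and.
rewrite /lact_word linvK (negbTE wa).
by case/andP: P => /= ba _; rewrite eq_sym ba.
Qed.

Lemma cfun_continuousP G w (e : R) : 0 < e ->
  exists n, forall w', (forall i, (i < n)%N -> w' i = w i) -> csq (G w - G w') < e.
Proof.
move=> e0; have /asboolP/(_ w)/cvgrPdist_lt cG := cfunP G.
have se : 0 < (Num.sqrt e)%:C%C :> R[i] by rewrite ltcR sqrtr_gt0.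
have /nbhs_boundaryP[n hn] := cG _ se; exists n => w' /hn h.
rewrite -(@ltcR R) csqE -normCK.
have -> : e%:C%C = (Num.sqrt e)%:C%C ^+ 2 :> R[i] by rewrite -rmorphXn /= sqr_sqrtr // ltW.
by rewrite ltr_pXn2r // nnegrE ?normr_ge0 // ltW.
Qed.

Section Density.
Variable L : C -> Prop.
Hypotheses (L1 : L 1) (LD : forall (c : R[i]) F G, L F -> L G -> L (c *: F + G))
  (LM : forall F G, L F -> L G -> L (F * G)) (Lind : forall a, L (ind a))
  (LT : forall a F, L F -> L (ctranslate (fg_letter a) F)).

Lemma L_cylinder (x : freeGroup I) : L (cylinder_indic R x).
Proof.
case: x; elim=> [|a s IH] P.
  rewrite (_ : cylinder_indic R _ = 1) //; apply: cfun_ext => w.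
  by rewrite cylinder_indicE.
case: s IH P => [|b s] IH P.
  by rewrite (_ : FreeWord P = fg_letter a) //; exact: val_inj.
by rewrite -ctranslate_cylinder //; apply/LT/IH.
Qed.

Lemma L_sum (J : finType) (F : J -> C) : (forall j, L (F j)) -> L (\sum_j F j).
Proof.
have L0 : L 0 by have := LD (- 1) L1 L1; rewrite scaleN1r addNr.
move=> LF; elim/big_ind: _ => // F1 F2 LF1 LF2.
by have := LD 1 LF1 LF2; rewrite scale1r.
Qed.

(* If [G] were not approximable on the whole boundary, one could choose letters one
   at a time and keep it not approximable on the cylinders of the prefixes; this
   contradicts the continuity of [G] at the resulting infinite word. *)
Lemma uniform_density G (e : R) : 0 < e ->
  exists2 F, L F & forall w, csq (G w - F w) <= e.
Proof.
move=> e0.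
pose good (x : freeGroup I) := exists2 F, L F &
  forall w, cylinder x w -> csq (G w - F w) <= e.
suff [F LF hF] : good 1%g by exists F => // w; exact: hF.
apply: contrapT => bad1.
have step x : exists y : freeGroup I, ~ good x ->
    (exists a, fword y = rcons x a) /\ ~ good y.
  have [gx|bx] := pselect (good x); first by exists 1%g.
  apply: contrapT => /forallNP hy; apply: bx.
  have /choice[F hF] a : exists F, L F /\ forall w, mkseq w (size x).+1 = rcons x a ->
      csq (G w - F w) <= e.
    have [ra|ra] := boolP (reduced (rcons x a)); last first.
      exists 1; split=> // w wx; exfalso; move: ra; rewrite -wx.
      by rewrite reduced_mkseq.
    have [gy|by_] := pselect (good (FreeWord ra)).
      have [F LF hF] := gy; exists F; split=> // w wx; apply: hF.
      by rewrite /cylinder /= size_rcons.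
    by exfalso; apply: (hy (FreeWord ra)) => _; split=> //; exists a.
  have chi a : exists K, L K /\ forall w, K w = (mkseq w (size x).+1 == rcons x a)%:R.
    have [ra|ra] := boolP (reduced (rcons x a)).
      exists (cylinder_indic R (FreeWord ra)); split; first exact: L_cylinder.
      by move=> w; rewrite cylinder_indicE /= size_rcons.
    exists 0; split; first by have := LD (- 1) L1 L1; rewrite scaleN1r addNr.
    move=> w; case: eqP => // wx; exfalso; move: ra; rewrite -wx.
    by rewrite reduced_mkseq.
  have [K hK] := choice chi.
  exists (\sum_a F a * K a).
    by apply: L_sum => a; apply: LM; [case: (hF a)|case: (hK a)].
  move=> w wx; rewrite cfun_sumE.
  have wE : mkseq w (size x).+1 = rcons x (w (size x)) by rewrite mkseqS wx.
  rewrite (eq_bigr (fun a => F a w * (w (size x) == a)%:R)) => [|a _]; last first.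
    by rewrite -[LHS]/(F a w * K a w) (hK a).2 wE eqseq_rcons eqxx.
  rewrite (bigD1 (w (size x))) //= eqxx mulr1 big1 ?addr0 => [|a aw].
    by case: (hF (w (size x))) => _; apply.
  by rewrite eq_sym (negbTE aw) mulr0.
have [g hg] := choice step.
pose X n := iter n g 1%g.
have bX n : ~ good (X n) by elim: n => // n IH; case: (hg _ IH).
have /choice[a ha] n : exists a, fword (X n.+1) = rcons (X n) a.
  by case: (hg _ (bX n)).
have aP n : a n.+1 != linv (a n).
  have := fwordP (X n.+2); rewrite ha ha -cats1 cat_rcons => /cat_sorted2[_ /=].
  by rewrite andbT.
pose w := Boundary aP.
have wX n : mkseq w n = X n by elim: n => // n IH; rewrite mkseqS IH ha.
have [n hn] := cfun_continuousP G w e0.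
apply: (bX n); exists (G w *: (1 : C)).
  have L0 : L 0 by have := LD (- 1) L1 L1; rewrite scaleN1r addNr.
  by have := LD (G w) L1 L0; rewrite addr0.
move=> w'; rewrite /cylinder /= -wX size_mkseq => e1.
have csqN (z : R[i]) : csq (- z) = csq z by case: z => p q; rewrite /csq /= !sqrrN.
rewrite -[(_ *: _) w']/(G w * 1) mulr1 -csqN opprB; apply/ltW/hn => i ltin.
by have := congr1 (nth (w 0%N) ^~ i) e1; rewrite !nth_mkseq.
Qed.

End Density.
End Indicators.

Section Representation.
Variables (R : realType) (I : finType) (H : hilbertType R).

Lemma urep_one (G : groupType) (pi : urep G H) v : pi 1%g v = v.
Proof.
have [_ [g gK _]] := urep_unitary pi 1%g.
by apply: (can_inj gK); rewrite -urepM mulg1.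
Qed.

Lemma urepK (G : groupType) (pi : urep G H) x v : pi x^-1%g (pi x v) = v.
Proof. by rewrite -urepM mulVg urep_one. Qed.

Lemma urepKr (G : groupType) (pi : urep G H) x v : pi x (pi x^-1%g v) = v.
Proof. by rewrite -urepM mulgV urep_one. Qed.

Lemma urep_adj (G : groupType) (pi : urep G H) x : adj (pi x) (pi x^-1%g).
Proof.
move=> u v; have [h _] := urep_unitary pi x.
by rewrite -[v in LHS](urepKr pi x) h.
Qed.

Variable pi : brep I H.
Local Notation A := (brep_algebra pi).
Local Notation C := (cfun R (boundary I)).
Local Notation ind a := (cylinder_indic R (fg_letter a)).
Implicit Types (F G : C) (u v : H).

Lemma starrep_0 v : A 0 v = 0.
Proof.
by have := starrep_linear A (- 1) 1 1 v; rewrite !scaleN1r !addNr.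
Qed.

Lemma starrepD F G v : A (F + G) v = A F v + A G v.
Proof. by have := starrep_linear A 1 F G v; rewrite !scale1r. Qed.

Lemma starrepZ c F v : A (c *: F) v = c *: A F v.
Proof. by have := starrep_linear A c F 0 v; rewrite starrep_0 !addr0. Qed.

Lemma starrepB F G v : A (F - G) v = A F v - A G v.
Proof. by rewrite -scaleN1r starrepD starrepZ scaleN1r. Qed.

Lemma starrep_sum (J : finType) (F : J -> C) v : A (\sum_j F j) v = \sum_j A (F j) v.
Proof.
elim/big_rec2: _ => [|j x y _ <-]; first exact: starrep_0.
exact: starrepD.
Qed.

Lemma starrep_adj F : adj (A F) (A (cfun_conj F)).
Proof. by move=> u v; exact: starrep_conj. Qed.

Hypothesis A1 : forall v, A 1 v = v.

Lemma Re_continuous F : continuous (fun w => complex.Re (F w)).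
Proof.
move=> w; have Fw : Filter (nbhs w) by exact: nbhs_filter.
apply/cvgrPdist_lt => d d0.
have [n hn] := cfun_continuousP F w (exprn_gt0 2 d0).
apply/nbhs_boundaryP; exists n => w' /hn h /=.
rewrite -(@ltr_pXn2r _ 2) ?nnegrE ?normr_ge0 ?ltW // real_normK ?num_real //.
apply: le_lt_trans h; rewrite -raddfB lerDl sqr_ge0 //.
Qed.

Lemma Im_continuous F : continuous (fun w => complex.Im (F w)).
Proof.
move=> w; have Fw : Filter (nbhs w) by exact: nbhs_filter.
apply/cvgrPdist_lt => d d0.
have [n hn] := cfun_continuousP F w (exprn_gt0 2 d0).
apply/nbhs_boundaryP; exists n => w' /hn h /=.
rewrite -(@ltr_pXn2r _ 2) ?nnegrE ?normr_ge0 ?ltW // real_normK ?num_real //.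
by apply: le_lt_trans h; rewrite -raddfB lerDr sqr_ge0.
Qed.

Lemma sqrt_cfun F (e : R) : exists h : C, forall w, h w = (Num.sqrt (e - csq (F w)))%:C%C.
Proof.
suff ch : (fun w => (Num.sqrt (e - csq (F w)))%:C%C) \in
    @continuous_pred R (boundary I) by exists (CFun ch).
apply/asboolP => w; have Fw : Filter (nbhs w) by exact: nbhs_filter.
have cRe := @Re_continuous F w; have cIm := @Im_continuous F w.
have cc : csq (F w') @[w' --> w] --> csq (F w).
  have h1 := @cvgM _ _ _ Fw _ _ _ _ cRe cRe; have h2 := @cvgM _ _ _ Fw _ _ _ _ cIm cIm.
  have h := @cvgD _ _ _ _ Fw _ _ _ _ h1 h2; rewrite /csq !expr2; exact: h.
have cs : e - csq (F w') @[w' --> w] --> e - csq (F w).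
  have h := @cvgB _ _ _ _ Fw _ _ _ _ (@cvg_cst _ e _ _ Fw) cc.
  exact: h.
have : Num.sqrt (e - csq (F w')) @[w' --> w] --> Num.sqrt (e - csq (F w)).
  exact: (@continuous_cvg _ _ _ _ Fw _ Num.sqrt _ (@sqrt_continuous R (e - csq (F w))) cs).
move=> /cvgrPdist_lt hs; apply/cvgrPdist_lt => d d0.
apply: filterS (hs _ (Re_gt0 d0)) => w' h.
have dE : d = (complex.Re d)%:C%C by rewrite RRe_real ?gtr0_real.
by rewrite [ltRHS]dE -rmorphB normc_def /= expr0n addr0 sqrtr_sqr ltcR.
Qed.

(** With the continuous function h = sqrt (e - |F|^2), the identity e = h^2 + |F|^2 is represented
    as e |v|^2 = |A h v|^2 + |A F v|^2. *)
Lemma starrep_bound F (e : R) v : (forall w, csq (F w) <= e) ->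
  nsq (A F v) <= e * nsq v.
Proof.
move=> Fe; have [h hh] := sqrt_cfun F e.
have hC : cfun_conj h = h.
  by apply: cfun_ext => w; rewrite -[LHS]/((h w)^*) hh conj_Creal ?complex_real.
have E : e%:C%C *: (1 : C) = h * h + cfun_conj F * F :> C.
  apply: cfun_ext => w.
  rewrite -[LHS]/(e%:C%C * 1) -[RHS]/(h w * h w + (F w)^* * F w) mulr1 hh.
  rewrite (mulrC (_^*)) -csqE -rmorphM -rmorphD /= -expr2 sqr_sqrtr ?subrK //.
  by rewrite subr_ge0.
have : '[A (e%:C%C *: (1 : C)) v, v] = '[A h v, A h v] + '[A F v, A F v].
  rewrite E starrepD hdotDl !starrepM (starrep_adj h) hC.
  by rewrite -[in RHS](adj_sym (starrep_adj F)).
rewrite starrepZ A1 hdotZl !hdot_nsq -rmorphM -rmorphD /= => -[->].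
by rewrite lerDr nsq_ge0.
Qed.

Let U a : H -> H := brep_group pi (fg_letter a).
Let E a : H -> H := A (ind a).

Let UB a x y : U a (x - y) = U a x - U a y. Proof. exact: linearB. Qed.
Let EB a x y : E a (x - y) = E a x - E a y. Proof. exact: linearB. Qed.
Let UK a x : U (linv a) (U a x) = x.
Proof. by rewrite /U fg_letter_linv urepK. Qed.
Let EE a b x : E a (E b x) = if a == b then E a x else 0.
Proof. by rewrite /E -starrepM letter_indicM; case: eqP => // _; exact: starrep_0. Qed.
Let Esum x : \sum_a E a x = x.
Proof. by rewrite -starrep_sum letter_indic_sum A1. Qed.
Let UE a x : U a (E (linv a) x) = U a x - E a (U a x).
Proof.
have := brep_covariant pi (fg_letter a) (ind (linv a)) (U a x).
by rewrite urepK ctranslate_letter_indic starrepB A1.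
Qed.

Definition lrep_of_brep := LRep UB EB UK EE Esum UE.

Let U_adj a : adj (U a) (U (linv a)).
Proof. by rewrite /U fg_letter_linv; exact: urep_adj. Qed.

Let E_sa a : adj (E a) (E a).
Proof. by have := starrep_adj (ind a); rewrite letter_indic_conj. Qed.

Definition hrep_of_brep : hrep I H := @HRep R I H lrep_of_brep U_adj E_sa.

(** The functions that preserve [V] form a class to which [uniform_density] applies; [starrep_bound]
    turns uniform approximation of [G] into approximation of [A G v], and [V] is closed. *)
Lemma brep_invariant (V : set H) : closed_subspace V ->
  (forall a v, V v -> V (lU hrep_of_brep a v)) ->
  (forall a v, V v -> V (lE hrep_of_brep a v)) ->
  (forall x v, V v -> V (brep_group pi x v)) /\ (forall G v, V v -> V (A G v)).
Proof.
move=> HV VU VE; have VG x : forall v, V v -> V (brep_group pi x v).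
  elim/freeGroup_ind: x => [v Vv|a x IH v Vv]; first by rewrite urep_one.
  by rewrite urepM; apply/VU/IH.
split=> // G v Vv; apply: (closed_nsq (csubspace_closed HV)) => e e0.
pose L F := forall v, V v -> V (A F v).
have L1 : L 1 by move=> u Vu; rewrite A1.
have LD (c : R[i]) F F' : L F -> L F' -> L (c *: F + F').
  move=> LF LF' u Vu; rewrite starrepD starrepZ.
  by apply: (csubspaceP HV); [exact: LF|exact: LF'].
have LM F F' : L F -> L F' -> L (F * F').
  by move=> LF LF' u Vu; rewrite starrepM; exact/LF/LF'.
have LI a : L (ind a) by move=> u Vu; exact: VE.
have LT a F : L F -> L (ctranslate (fg_letter a) F).
  by move=> LF u Vu; rewrite -brep_covariant; exact/VG/LF/VG.
have v1 : 0 < nsq v + 1 by rewrite ltr_wpDl ?nsq_ge0.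
have e1 : 0 < e / 2 / (nsq v + 1) by rewrite !divr_gt0.
have [F LF GF] := uniform_density L1 LD LM LI LT G e1.
exists (A F v); first exact: LF.
rewrite -starrepB; apply: le_lt_trans (@starrep_bound (G - F) _ v GF) _.
rewrite mulrAC ltr_pdivrMr //; have := nsq_ge0 v; nra.
Qed.

End Representation.

Section Intertwiners.
Variables (R : realType) (I : finType) (H K : hilbertType R).
Variables (pi : brep I H) (pi' : brep I K).
Hypotheses (A1 : forall v, brep_algebra pi 1 v = v).
Hypotheses (A1' : forall v, brep_algebra pi' 1 v = v).
Variables (T : H -> K) (S : K -> H).
Hypotheses (TS : adj T S) (bT : bounded_op T).
Hypothesis TC : hcomm (hrep_of_brep A1) (hrep_of_brep A1') T.

Lemma hcomm_group x v : T (brep_group pi x v) = brep_group pi' x (T v).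
Proof.
have [TU _] := TC.
elim/freeGroup_ind: x v => [v|a x IH v]; first by rewrite !urep_one.
by rewrite !urepM -IH; exact: (TU a).
Qed.

Lemma hcomm_algebra G v : T (brep_algebra pi G v) = brep_algebra pi' G (T v).
Proof.
have [_ TE] := TC; pose L F := forall v, T (brep_algebra pi F v) = brep_algebra pi' F (T v).
have L1 : L 1 by move=> u; rewrite A1 A1'.
have LD (c : R[i]) F F' : L F -> L F' -> L (c *: F + F').
  by move=> LF LF' u; rewrite !starrepD !starrepZ (adj_lin TS) LF LF'.
have LM F F' : L F -> L F' -> L (F * F').
  by move=> LF LF' u; rewrite !starrepM LF LF'.
have LI a : L (cylinder_indic R (fg_letter a)) by move=> u; exact: (TE a).
have LT a F : L F -> L (ctranslate (fg_letter a) F).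
  by move=> LF u; rewrite -!brep_covariant !hcomm_group LF hcomm_group.
have [C C0 hC] := bT.
apply/subr0_eq/nsq_eq0/eqP; rewrite eq_le nsq_ge0 andbT.
apply/ler_addgt0Pl => e e0; rewrite addr0.
pose k := 2 * (C * nsq v) + 2 * nsq (T v) + 1.
have k0 : 0 < k.
  by rewrite ltr_wpDl // addr_ge0 // mulr_ge0 ?nsq_ge0 // mulr_ge0 ?nsq_ge0.
have e1 : 0 < e / k by rewrite divr_gt0.
have [F LF GF] := uniform_density L1 LD LM LI LT G e1.
have -> : T (brep_algebra pi G v) - brep_algebra pi' G (T v) =
    T (brep_algebra pi (G - F) v) - brep_algebra pi' (G - F) (T v).
  by rewrite !starrepB (adj_sub TS) LF opprB addrA subrK.
apply: le_trans (nsqD_le _ _) _; rewrite nsqN.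
have h1 := @starrep_bound _ _ _ _ A1 (G - F) _ v GF.
have h2 := @starrep_bound _ _ _ _ A1' (G - F) _ (T v) GF.
have h3 := ler_wpM2l C0 h1; have h4 := hC (brep_algebra pi (G - F) v).
have h5 : e / k * k = e by rewrite divfK // lt0r_neq0.
have : e / k * (2 * (C * nsq v) + 2 * nsq (T v)) <= e / k * k.
  by rewrite ler_pM2l // lerDl.
move: h2 h3; rewrite h5; move: (e / k) => d; lra.
Qed.

End Intertwiners.

Section HilbertSchmidt.
Variables (R : realType) (H : hilbertType R).

Lemma hnorm_nsq (v : H) : hnorm v ^+ 2 = nsq v.
Proof.
have h : `|v| = (hnorm v)%:C%C by rewrite /hnorm RRe_real // ger0_real.
by have := norm_nsq v; rewrite h -rmorphXn /= => -[].
Qed.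

Lemma hs_norm_finite (T : H -> H) : (hs_norm T < +oo)%E -> hilbert_schmidt T.
Proof.
move=> /ereal_inf_lt[_ [B HB <-]] h; exists B => //.
have fin : (\esum_(e in B) ((hnorm (T e)) ^+ 2)%:E < +oo)%E.
  rewrite ltey; apply/eqP => e; move: h; rewrite e poweRyr ?ltxx //.
have e0 : (0 <= \esum_(e in B) ((hnorm (T e)) ^+ 2)%:E)%E.
  by apply: esum_ge0 => e _; rewrite lee_fin sqr_ge0.
exists (fine (\esum_(e in B) ((hnorm (T e)) ^+ 2)%:E)) => F [uF FB].
rewrite -lee_fin fineK ?ge0_fin_numE //.
have -> : ((\sum_(e <- F) nsq (T e))%:E = \sum_(e \in [set` F]) ((hnorm (T e)) ^+ 2)%:E)%E.
  rewrite -sumEFin fsbig_seq //.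
  by apply: eq_fsbigr => e _; rewrite hnorm_nsq.
apply: ereal_sup_ubound; exists [set` F] => //.
by split; [exact: finite_seq|move=> e /= eF; exact: FB].
Qed.

End HilbertSchmidt.

(** * Invariant subspaces and boundary realizations *)

Section OrthogonalProjection.
Variables (R : realType) (H : hilbertType R) (V : set H).
Hypothesis HV : closed_subspace V.
Local Notation p := (orthoproj V).

Lemma csubspaceB u v : V u -> V v -> V (u - v).
Proof. by move=> Vu Vv; rewrite addrC -scaleN1r; exact: csubspaceP. Qed.

Lemma orthoproj_in v : V (p v).
Proof. by case: (orthoprojP v HV). Qed.

Lemma orthoproj_orth v w : V w -> '[v - p v, w] = 0.
Proof. by case: (orthoprojP v HV) => _; apply. Qed.

Lemma orthoproj_uniq v q : V q -> (forall w, V w -> '[v - q, w] = 0) -> p v = q.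
Proof.
move=> Vq hq; apply/subr0_eq/hdot_eq0.
have Vw : V (p v - q) by exact: csubspaceB (orthoproj_in v) Vq.
have {1}-> : p v - q = (v - q) - (v - p v) by rewrite opprB [RHS]addrC addrA subrK.
by rewrite hdotBl hq // orthoproj_orth // subrr.
Qed.

Lemma orthoproj_id v : V v -> p v = v.
Proof. by move=> Vv; apply: orthoproj_uniq => // w _; rewrite subrr hdot0l. Qed.

Lemma orthoproj_0 v : orthocomp V v -> p v = 0.
Proof.
move=> ov; apply: orthoproj_uniq; first exact: csubspace0 HV.
by move=> w Vw; rewrite subr0; exact: ov.
Qed.

Lemma orthoproj_adj : adj p p.
Proof.
move=> u v.
have h x y : '[p x, y] = '[p x, p y].
  apply/subr0_eq; rewrite -hdotBr hdotC orthoproj_orth ?conjC0 //.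
  exact: orthoproj_in.
by rewrite h [RHS]hdotC [in RHS]h -hdotC.
Qed.

Lemma orthoproj_bounded : bounded_op p.
Proof.
exists 1 => // v; rewrite mul1r; apply: projection_contr; first exact: orthoproj_adj.
by move=> u; apply/orthoproj_id/orthoproj_in.
Qed.

Lemma orthoproj_lcomm (I : finType) (r : hrep I H) :
  (forall a v, V v -> V (lU r a v)) -> lcomm r p.
Proof.
move=> VU a u; apply: orthoproj_uniq; first exact/VU/orthoproj_in.
move=> w Vw; rewrite -(adj_sub (hU_adj r a)) (hU_adj r).
by apply: orthoproj_orth; exact: VU.
Qed.

Lemma closure_span_sub (S : set H) : S `<=` V -> closure (linear_span S) `<=` V.
Proof.
move=> SV v /closure_nsq h; apply: (closed_nsq (csubspace_closed HV)) => e e0.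
have [_ [n [c [a [aS ->]]]] ve] := h e e0; exists (\sum_(i < n) c i *: a i) => //.
elim/big_rec: _ => [|i x _ Vx]; first exact: csubspace0 HV.
by apply: csubspaceP => //; exact: SV.
Qed.

End OrthogonalProjection.

Section Isometry.
Variables (R : realType) (H K : hilbertType R) (f : H -> K).

Lemma closed_image_isometry (V : set H) : (forall u v, nsq (f u - f v) = nsq (u - v)) ->
  closed V -> closed (f @` V).
Proof.
move=> fI cV; apply: closed_nsqP => w hw.
have /choice[x hx] (n : nat) : exists x, V x /\ nsq (w - f x) < n.+1%:R^-1.
  have [|_ [x Vx <-] h] := hw n.+1%:R^-1; first by rewrite invr_gt0.
  by exists x.
have [e e0|l hl] := @complete_nsq _ _ x.
  have [N hN] := @invS_lt R (e / 4) ltac:(by rewrite divr_gt0).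
  exists N => a b Na Nb; rewrite -fI.
  have -> : f (x a) - f (x b) = (w - f (x b)) - (w - f (x a)).
    by rewrite opprB [RHS]addrC addrA subrK.
  apply: le_lt_trans (nsqD_le _ _) _; rewrite nsqN.
  have := (hx a).2; have := (hx b).2; have := hN _ Na; have := hN _ Nb.
  move: (a.+1%:R^-1) (b.+1%:R^-1) => s t; lra.
exists l.
  apply: (closed_nsq cV) => e /hl[N /(_ _ (leqnn N)) h].
  by exists (x N) => //; case: (hx N).
apply/subr0_eq/nsq_eq0/eqP; rewrite eq_le nsq_ge0 andbT.
apply/ler_addgt0Pl => e e0; rewrite addr0.
have e4 : 0 < e / 4 by rewrite divr_gt0.
have [N hN] := invS_lt e4; have [M hM] := hl _ e4.
have := hN _ (leq_maxl N M); have := hM _ (leq_maxr N M).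
have := (hx (maxn N M)).2; set y := x _; set t := _^-1 => h1 h2 h3.
have -> : f l - w = (f l - f y) - (w - f y) by rewrite opprB addrA subrK.
apply: le_trans (nsqD_le _ _) _; rewrite nsqN fI; lra.
Qed.

Lemma isometry_hdot : (forall (c : R[i]) u v, f (c *: u + v) = c *: f u + f v) ->
  (forall u, `|f u| = `|u|) -> forall u v, '[f u, f v] = '[u, v].
Proof.
move=> fl fI u v.
have fN x : nsq (f x) = nsq x.
  by have := norm_nsq (f x); rewrite fI norm_nsq => -[].
(* Polarization: the scalars 1 and i give the real and the imaginary part. *)
have re (c : R[i]) : complex.Re (c * '[f u, f v]) = complex.Re (c * '[u, v]).
  have := fN (c *: u + v); rewrite fl !nsqD !nsqZ !fN !hdotZl; lra.
have := re 1; have := re 'i; rewrite !mul1r.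
case: '[f u, f v] => a b; case: '[u, v] => a' b'.
rewrite /= !(mul0r, mul1r, sub0r) => /oppr_inj -> ->.
by [].
Qed.

End Isometry.

Section Restriction.
Variables (R : realType) (G : groupType) (H : hilbertType R) (pi : urep G H).
Variables (V : set H) (HV : closed_subspace V).
Hypothesis Vpi : forall x v, V v -> V (pi x v).

Lemma csub_in (u : csub HV) : V (csub_val u).
Proof. by case: u => u /= /asboolP. Qed.

Definition csub_of v (Vv : V v) : csub HV := @CSub R H V HV v (asboolT Vv).

Definition res_op (x : G) (u : csub HV) : csub HV := csub_of (Vpi x (csub_in u)).

Lemma csub_hdot (u v : csub HV) : '[u, v] = '[csub_val u, csub_val v].
Proof. by []. Qed.

Fact res_op_linear x : linear (res_op x).
Proof. by move=> c u v; apply: val_inj; rewrite /= linearP. Qed.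

HB.instance Definition _ x :=
  GRing.isLinear.Build R[i] (csub HV) (csub HV) *:%R (res_op x) (res_op_linear x).

Fact res_unitary x : unitary_map (res_op x : {linear csub HV -> csub HV}).
Proof.
split=> [u v|]; first by rewrite csub_hdot; case: (urep_unitary pi x) => h _; exact: h.
by exists (res_op x^-1%g) => u; apply: val_inj; rewrite /= ?urepK ?urepKr.
Qed.

Fact res_M x y u : res_op (x * y)%g u = res_op x (res_op y u).
Proof. by apply: val_inj; rewrite /= urepM. Qed.

Definition urep_restriction : urep G (csub HV) :=
  @URep R G (csub HV) (fun x => res_op x : {linear csub HV -> csub HV}) res_unitary res_M.

End Restriction.

Section BoundaryRealization.
Variables (R : realType) (I : finType) (H H' : hilbertType R).
Variables (pi : urep (freeGroup I) H) (pi' : brep I H') (iota : {linear H -> H'}).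
Hypothesis real : boundary_realization pi pi' iota.

Lemma realization_hdot u v : '[iota u, iota v] = '[u, v].
Proof.
apply: isometry_hdot; last exact: breal_isometry real.
by move=> c x y; rewrite linearP.
Qed.

Lemma realization_nsqB u v : nsq (iota u - iota v) = nsq (u - v).
Proof. by rewrite -linearB /nsq realization_hdot. Qed.

Lemma realization_inj u v : iota u = iota v -> u = v.
Proof.
by move=> e; apply/subr0_eq/nsq_eq0; rewrite -realization_nsqB e subrr nsq0.
Qed.

Lemma realization_image V : closed_subspace V -> closed_subspace (iota @` V).
Proof.
move=> HV; split.
- by apply: (closed_image_isometry realization_nsqB); exact: csubspace_closed HV.
- by exists 0; [exact: csubspace0 HV|rewrite linear0].
move=> c _ _ [u Vu <-] [v Vv <-]; exists (c *: u + v); last by rewrite linearP.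
exact: csubspaceP.
Qed.

Lemma realization_range : closed_subspace (range iota).
Proof.
apply: realization_image; split=> //; exact: closedT.
Qed.

Lemma ex_realization_adj : exists iotad, [/\ adj iota iotad,
  forall v, iotad (iota v) = v & forall w, iota (iotad w) = orthoproj (range iota) w].
Proof.
have HV := realization_range.
have /choice[iotad hd] w : exists v, iota v = orthoproj (range iota) w.
  by have [v _ e] := orthoproj_in HV w; exists v.
have fix_ v : iota (iotad (iota v)) = iota v by rewrite hd orthoproj_id //; exists v.
exists iotad; split=> //; last by move=> v; apply: realization_inj.
by move=> u v; rewrite -realization_hdot hd -(orthoproj_adj HV) orthoproj_id.
Qed.

Lemma realization_ind (V : set H') : closed_subspace V ->
  (forall G v, V (brep_algebra pi' G (iota v))) -> V = setT.
Proof.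
move=> HV h; apply/seteqP; split=> // w _.
have : [set: H'] w by [].
rewrite -(breal_cyclic real); apply: closure_span_sub => //.
by move=> _ [G _ [v _ <-]].
Qed.

(** The image of 1 is an orthogonal projection that fixes every [brep_algebra pi' G (iota u)], and
    these vectors have dense span. *)
Lemma realization_unital v : brep_algebra pi' 1 v = v.
Proof.
pose A1 := brep_algebra pi' 1.
have c1 : cfun_conj 1 = 1 :> cfun R (boundary I).
  by apply: cfun_ext => w; exact: conjC1.
have AA : adj A1 A1.
  by move=> u w; have := starrep_adj pi' 1 u w; rewrite c1.
have AI u : A1 (A1 u) = A1 u by rewrite /A1 -starrepM mul1r.
have bA : bounded_op A1 by exists 1 => // u; rewrite mul1r projection_contr.
have BB : adj (fun u => u - A1 u) (fun u => u - A1 u).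
  by move=> u w; rewrite hdotBl hdotBr AA.
have bB : bounded_op (fun u => u - A1 u).
  by apply: bounded_opB bA; exists 1 => // u; rewrite mul1r.
have : [set: H'] v by [].
rewrite -(realization_ind (adj_bounded_closed BB bB)) /=.
  by move=> /subr0_eq.
by move=> G u; rewrite /A1 -starrepM mul1r subrr.
Qed.

Lemma realization_cyclic (V : set H') : closed_subspace V -> (forall v, V (iota v)) ->
  (forall a v, V v -> V (lU (hrep_of_brep realization_unital) a v)) ->
  (forall a v, V v -> V (lE (hrep_of_brep realization_unital) a v)) -> V = setT.
Proof.
move=> HV Vi VU VE; have [_ VA] := brep_invariant HV VU VE.
by apply: realization_ind => // G v; exact: VA.
Qed.

Lemma realization_neq0 : (exists v : H', v <> 0) -> exists v, iota v <> 0.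
Proof.
move=> [w w0]; apply: contrapT => /forallNP h; apply: w0.
have HV : closed_subspace [set (0 : H')].
  split=> //; last by move=> c u v -> ->; rewrite scaler0 addr0.
  apply: closed_nsqP => u hu; apply: nsq_eq0; apply/eqP.
  rewrite eq_le nsq_ge0 andbT; apply/ler_addgt0Pl => e /hu[_ ->].
  by rewrite subr0 addr0 => /ltW.
have : [set: H'] w by [].
rewrite -(realization_ind HV) // => G v.
have -> : iota v = 0 by apply: contrapT => /h.
exact: linear0.
Qed.

Lemma realization_imperfect iotad : ~ perfect iota ->
  (forall v, iotad (iota v) = v) -> exists u, iota (iotad u) <> u.
Proof.
move=> np iK; apply: contrapT => /forallNP h; apply: np.
by exists iotad => // w; apply: contrapT => /h.
Qed.

Lemma brep_irreducible_hrep : brep_irreducible pi' ->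
  hirr (hrep_of_brep realization_unital).
Proof.
move=> [nz irr]; split=> // V HV VU VE.
have [VG VA] := brep_invariant HV VU VE.
exact: irr.
Qed.

End BoundaryRealization.

(** * Irreducibility and inequivalence of the two summands *)

Section Main.
Variables (R : realType) (I : finType) (H H' : hilbertType R).
Variables (pi : urep (freeGroup I) H) (pi' : brep I H') (iota : {linear H -> H'}).
Hypothesis irr' : brep_irreducible pi'.
Hypothesis real : boundary_realization pi pi' iota.
Hypothesis imp : ~ perfect iota.
Let r := hrep_of_brep (realization_unital real).
Variable iotad : H' -> H.
Hypotheses (iota_adj : adj iota iotad) (iotaK : forall v, iotad (iota v) = v).
Let P u := iota (iotad u).
Hypothesis KHS : forall a, hilbert_schmidt (fun v => lE r a (P v) - P (lE r a (P v))).

Let pU a v := pi (fg_letter a) v.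
Let irr : hirr r := brep_irreducible_hrep real irr'.
Let iotaU a v : iota (pU a v) = lU r a (iota v).
Proof. exact: breal_intertwine real _ _. Qed.
Let iota0 : exists v, iota v <> 0.
Proof. by apply: (realization_neq0 real); case: irr'. Qed.
Let iota1 : exists u, iota (iotad u) <> u.
Proof. exact: (realization_imperfect imp). Qed.

Lemma main_commutant T : adj T T -> bounded_op T -> lcomm r T ->
  exists l mu : R, forall v, T v = l%:C%C *: P v + mu%:C%C *: v.
Proof.
have [m hm] := ex_shift_mean R.
exact: (gamma_commutant hm irr iota_adj iotaK iotaU iota0 iota1 KHS).
Qed.

Let Q u := u - P u.
Let PQ u : P (Q u) = 0.
Proof. by rewrite /P /Q (adj_sub (adj_sym iota_adj)) iotaK subrr linear0. Qed.
Let Q0 : exists u, Q u <> 0.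
Proof.
by have [u nu] := iota1; exists u => /subr0_eq e; apply: nu.
Qed.

Let Q_in w : orthocomp (range iota) (Q w).
Proof.
move=> _ [v _ <-]; rewrite hdotC iota_adj.
have -> : iotad (Q w) = 0.
  by rewrite /Q (adj_sub (adj_sym iota_adj)) iotaK subrr.
by rewrite hdot0r conjC0.
Qed.

Lemma orthocomp_iota w : orthocomp (range iota) w -> iotad w = 0.
Proof.
by move=> ow; apply: hdot_eq0; rewrite -iota_adj hdotC ow ?conjC0.
Qed.

Let P_lcomm : lcomm r P.
Proof.
have hP w : P w = orthoproj (range iota) w.
  apply/esym/(orthoproj_uniq (realization_range real)); first by exists (iotad w).
  by move=> _ [v _ <-]; exact: Q_in.
move=> a u; rewrite !hP; apply: (orthoproj_lcomm (realization_range real)).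
by move=> b _ [v _ <-]; exists (pU b v).
Qed.

Lemma range_invariant x v : range iota v -> range iota (brep_group pi' x v).
Proof. by move=> [u _ <-]; exists (pi x u); rewrite ?(breal_intertwine real). Qed.

Lemma orthocomp_invariant x v : orthocomp (range iota) v ->
  orthocomp (range iota) (brep_group pi' x v).
Proof.
move=> ov w rw; rewrite urep_adj ov //; exact: range_invariant.
Qed.

(** The projection onto the image of [V] commutes with the group, so it is l P + mu. It vanishes on
    the complement of the range of [iota], whence mu = 0; if it fixes a nonzero vector, then l = 1
    and it equals [P]. *)
Lemma main_irreducible : urep_irreducible pi.
Proof.
split; first by have [v v0] := iota0; exists v => e; apply: v0; rewrite e linear0.
move=> V HV VU; have HW := realization_image real HV.
have WU a w : (iota @` V) w -> (iota @` V) (lU r a w).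
  by move=> [v Vv <-]; exists (pU a v); [exact: VU|exact: iotaU].
have [l [mu hT]] := main_commutant (orthoproj_adj HW) (orthoproj_bounded HW)
  (orthoproj_lcomm HW WU).
have mu0 : mu%:C%C = 0 :> R[i].
  have [u Qu] := Q0; apply/eqP; apply: contraT => mu0; exfalso; apply: Qu.
  have := hT (Q u); rewrite PQ scaler0 add0r (orthoproj_0 HW) => [/esym/eqP|w [v Vv <-]].
    by rewrite scaler_eq0 (negbTE mu0) => /eqP.
  by apply: Q_in; exists v.
have [V0|/existsNP[v /not_implyP[Vv v0]]] := pselect (forall v, V v -> v = 0).
  left; apply/seteqP; split=> [v /V0//|_ ->]; exact: csubspace0 HV.
right; apply/seteqP; split=> // x _.
have Pi y : P (iota y) = iota y by rewrite /P iotaK.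
have l1 : l%:C%C = 1 :> R[i].
  have := hT (iota v); rewrite (orthoproj_id HW); last by exists v.
  rewrite Pi mu0 scale0r addr0 -[X in X = _]scale1r => /eqP.
  rewrite -subr_eq0 -scalerBl scaler_eq0 subr_eq0 => /orP[/eqP//|/eqP iv0].
  by exfalso; apply: v0; apply: (realization_inj real); rewrite iv0 linear0.
have := orthoproj_in HW (iota x).
rewrite hT Pi l1 mu0 scale1r scale0r addr0 => -[y Vy].
by move=> /(realization_inj real) <-.
Qed.

Let HV2 := closed_subspace_orthocomp (range iota).
Definition complement_rep : urep (freeGroup I) (orthocomp_hilbert (range iota)) :=
  urep_restriction HV2 orthocomp_invariant.

Let P_csub (u : csub HV2) : P (csub_val u) = 0.
Proof. by rewrite /P orthocomp_iota ?linear0 //; exact: csub_in. Qed.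

Lemma complement_irreducible : urep_irreducible complement_rep.
Proof.
split.
  have [u Qu] := Q0; exists (csub_of HV2 (Q_in u)) => e; apply: Qu.
  by have := congr1 (@csub_val _ _ _ _) e.
move=> V HV VU; pose W := @csub_val _ _ _ HV2 @` V.
have HW : closed_subspace W.
  split.
  - apply: closed_image_isometry; last exact: csubspace_closed HV.
    by [].
  - by exists 0 => //; exact: csubspace0 HV.
  - move=> c _ _ [u Vu <-] [v Vv <-]; exists (c *: u + v) => //.
    exact: csubspaceP.
have WU a w : W w -> W (lU r a w).
  by move=> [v Vv <-]; exists (complement_rep (fg_letter a) v) => //; exact: VU.
have [l [mu hT]] := main_commutant (orthoproj_adj HW) (orthoproj_bounded HW)
  (orthoproj_lcomm HW WU).
have [V0|/existsNP[v /not_implyP[Vv v0]]] := pselect (forall v, V v -> v = 0).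
  left; apply/seteqP; split=> [v /V0//|_ ->]; exact: csubspace0 HV.
right; apply/seteqP; split=> // x _.
have cv0 : csub_val v <> 0 by move=> e; apply: v0; exact: val_inj.
(* On the complement [P] vanishes, so the projection acts there as the scalar [mu], and it fixes
   [v]. *)
have mu1 : mu%:C%C = 1 :> R[i].
  have := hT (csub_val v); rewrite (orthoproj_id HW); last by exists v.
  rewrite P_csub scaler0 add0r -[X in X = _]scale1r => /eqP.
  by rewrite -subr_eq0 -scalerBl scaler_eq0 subr_eq0 => /orP[/eqP//|/eqP/cv0].
have := orthoproj_in HW (csub_val x).
by rewrite hT P_csub scaler0 add0r mu1 scale1r => -[y Vy /val_inj <-].
Qed.

(** An equivalence gives a partial isometry [B] from the complement onto the range of [iota] that
    commutes with the group. The sum of [B] and its adjoint is off-diagonal for [P], whereas l P +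
    mu is diagonal, so [B] vanishes on the complement. *)
Lemma complement_inequivalent : ~ urep_equivalent complement_rep pi.
Proof.
move=> [f [[fI [g gK fK]] fU]].
have dad := adj_sym iota_adj.
pose Qs w := csub_of HV2 (Q_in w).
pose B w := iota (f (Qs w)); pose B' w := csub_val (g (iotad w)).
have QsU a w : Qs (lU r a w) = complement_rep (fg_letter a) (Qs w).
  apply: val_inj; rewrite /= /Q (P_lcomm a w).
  by rewrite -(adj_sub (hU_adj r a)).
have BB : adj B B'.
  move=> w z; rewrite /B iota_adj -{1}(fK (iotad z)) fI csub_hdot /= /Q hdotBl -/(B' z).
  by rewrite /P iota_adj (orthocomp_iota (csub_in (g (iotad z)))) hdot0r subr0.
have nB w : nsq (B w) = nsq (Q w).
  by rewrite /nsq /B (realization_hdot real) fI.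
have bB : bounded_op B.
  exists 1 => // w; rewrite mul1r nB.
  have -> : nsq w = nsq (P w) + nsq (Q w).
    have {1}-> : w = P w + Q w by rewrite addrC subrK.
    by rewrite nsqD {2}/P iota_adj (orthocomp_iota (Q_in w)) hdot0r mulr0 addr0.
  by rewrite lerDr nsq_ge0.
have BU : lcomm r B by move=> a w; rewrite /B QsU fU -iotaU.
have B'U : lcomm r B'.
  by move=> a w; apply: hdot_ext => z; rewrite (adj_sym BB) !(hU_adj r) (adj_sym BB) BU.
pose T w := B w + B' w.
have TT : adj T T by move=> w z; rewrite /T hdotDl hdotDr BB (adj_sym BB) addrC.
have bT : bounded_op T := bounded_opD bB (bounded_adj BB bB).
have TU : lcomm r T by move=> a w; rewrite /T BU B'U (adj_add (hU_adj r a)).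
have [l [mu hT]] := main_commutant TT bT TU.
have [u Qu] := Q0; apply: Qu; apply: nsq_eq0.
have := hT (Q u); rewrite PQ scaler0 add0r /T.
have -> : B' (Q u) = 0.
  by rewrite /B' orthocomp_iota // -(linear0 f) gK.
rewrite addr0 => e; have QQ : Q (Q u) = Q u by rewrite {1}/Q PQ subr0.
have h : '[Q u, B (Q u)] = 0 by apply: Q_in; exists (f (Qs (Q u))).
by rewrite -QQ -nB /nsq {1}e hdotZl h mulr0.
Qed.

End Main.

Theorem mainTheorem2 (R : realType) (I : finType) (nonabelian : (1 < #|I|)%N)
    (H H' : hilbertType R) (sepH : separable H) (sepH' : separable H')
    (pi : urep (freeGroup I) H) (pi' : brep I H') (iota : {linear H -> H'}) :
  let H1 : set H' := range iota in
  let P1 : H' -> H' := orthoproj H1 in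
  let P2 : H' -> H' := fun v => v - P1 v in
  brep_irreducible pi' ->
  boundary_realization pi pi' iota ->
  ~ perfect iota ->
  (forall a : letter I,
     (hs_norm (fun v => P2 (brep_algebra pi'
        (cylinder_indic R (fg_letter a)) (P1 v))) < +oo)%E) ->
  urep_irreducible pi /\
  (forall (H'' : hilbertType R) (pi'' : brep I H'') (iota'' : {linear H -> H''}),
     separable H'' -> boundary_realization pi pi'' iota'' ->
     breal_equivalent pi' iota pi'' iota'') /\
  (forall x v, H1 v -> H1 (brep_group pi' x v)) /\
  (forall x v, orthocomp H1 v -> orthocomp H1 (brep_group pi' x v)) /\
  exists pi2 : urep (freeGroup I) (orthocomp_hilbert H1),
    (forall x v, csub_val (pi2 x v) = brep_group pi' x (csub_val v)) /\
    urep_irreducible pi2 /\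
    ~ urep_equivalent pi2 pi.
Proof.
move=> H1 P1 P2 irr' real imp hs.
have [iotad [ad iK iP]] := ex_realization_adj real.
have KHS a : hilbert_schmidt (fun v =>
    lE (hrep_of_brep (realization_unital real)) a (iota (iotad v)) -
    iota (iotad (lE (hrep_of_brep (realization_unital real)) a (iota (iotad v))))).
  have := hs_norm_finite (hs a); congr hilbert_schmidt.
  by apply/funext => v; rewrite /P2 /P1 /H1 -!iP.
split; first exact (main_irreducible irr' imp ad iK KHS).
split.
  move=> H'' pi'' iota'' _ real''.
  have [jd [jad jK _]] := ex_realization_adj real''.
  have [m hm] := ex_shift_mean R.
  pose q := hrep_of_brep (realization_unital real'').
  have jU a v : iota'' (pi (fg_letter a) v) = lU q a (iota'' v).
    exact: breal_intertwine real'' _ _.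
  have [J [Jd [JJ JK KJ JC Jiota]]] := realization_unique hm
    (brep_irreducible_hrep real irr') ad iK (fun a => breal_intertwine real (fg_letter a))
    (realization_neq0 real irr'.1) (realization_imperfect imp iK) KHS
    jad jK jU (@realization_cyclic _ _ _ _ _ _ _ real'').
  have bJ := bounded_op_isometry JJ JK.
  exists (adj_linear JJ); split.
  - split=> [u v|]; first by rewrite /= /adj_fun JJ JK.
    by exists Jd.
  - exact: hcomm_group JC.
  - exact: hcomm_algebra JJ bJ JC.
  - exact: Jiota.
split; first exact: range_invariant real.
split; first exact: orthocomp_invariant real.
exists (complement_rep real); split=> //; split.
  exact (complement_irreducible irr' imp ad iK KHS).
exact (complement_inequivalent irr' imp ad iK KHS).
Qed.
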